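(* Let $\mathcal{A}\subset\mathbb{R}^d$ be a finite action set of size $K$, let $T$ be the horizon and $\delta\in(0,1)$. In the stochastic linear bandit with parameter noise model (context), with probability at least $1-3\delta$ the regret of the VASE algorithm (context) run on $\mathcal{A}$ is bounded by $$\widetilde{O}\Big(d^2+\sqrt{dT\log(K/\delta)\,M_\sigma}\Big),\qquad M_\sigma=\min\Big\{\max_{a\in\mathcal{A}}a^\top\Sigma a,\ \max_{a\in\mathcal{A}}\|a\|_2^2\,\mathrm{tr}(\Sigma)\Big\}.$$ Here $\widetilde O$ hides logarithmic factors.
   Context: Stochastic linear bandits with parameter noise: there is a fixed unknown distribution $\nu$ on $\mathbb{R}^d$ with mean $\theta^\star$ and covariance matrix $\Sigma$. For $t=1,\dots,T$ the learner chooses $a_t\in\mathcal{A}$, the environment draws $\theta_t\sim\nu$ independently of the past, and the learner observes reward $X_t=a_t^\top\theta_t$. It is assumed that $|a^\top\theta|\le 1$ almost surely for $\theta\sim\nu$ and all $a\in\mathcal{A}$. The (pseudo-)regret is $\mathcal{R}_T=\sum_{t=1}^T(a^\star-a_t)^\top\theta^\star$ with $a^\star\in\arg\max_{a\in\mathcal{A}}a^\top\theta^\star$. For $a\in\mathcal{A}$, $\sigma^2(a)=a^\top\Sigma a$. A design on a finite set $\mathcal{B}$ is a probability vector $\pi$ on $\mathcal{B}$; with $V(\pi)=\sum_a\pi(a)aa^\top$, a G-optimal design minimizes $\max_{a\in\mathcal{B}}\|a\|_{V(\pi)^{-1}}$ (its minimal value is $\sqrt d$ and a minimizer with support of size at most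 $d(d+1)/2$ exists; the algorithm uses such a minimizer, working in the span of $\mathcal{B}$ if needed). The Stopping Rule algorithm $\mathcal{SR}(\bar\varepsilon,\bar\delta)$ (Dagum et al.) repeatedly samples a $[0,1]$-valued random variable with mean $\mu>0$ and outputs $\hat\mu$ with $|\hat\mu-\mu|\le\bar\varepsilon\mu$ with probability $1-\bar\delta$, using $O(\log(1/\bar\delta)/(\bar\varepsilon^2\mu))$ samples with probability $1-\bar\delta$. Variance estimation of action $a$ with threshold $\tau$, confidence $\bar\delta$, error $\bar\varepsilon$: each sample is $Z(a)=\max\{\tfrac14(X_s-X_{s+1})^2,\tau/2\}$ where $X_s,X_{s+1}$ are rewards of playing $a$ twice; run $\mathcal{SR}(\bar\varepsilon,\bar\delta)$ on these samples and output its estimate. VASE: set $\mathcal{A}_1=\mathcal{A}$, $t=1$, and for phases $\ell=1,2,\dots$ while $t\le T$: put $\varepsilon_\ell=2^{-\ell}$, $\delta_\ell=\delta/(K\ell(\ell+1))$, $\gamma_\ell=2\delta/(\ell(\ell+1)d(d+1))$; find a G-optimal design $\pi_\ell$ on $\mathcal{A}_\ell$; for each $a\in\mathrm{Supp}(\pi_\ell)$ run variance estimation with threshold $\varepsilon_\ell$, confidence $\gamma_\ell$, error $1/2$, obtaining $\hat\sigma^2_\ell(a)$; play each $a\in\mathrm{Supp}(\pi_\ell)$ exactly $T_\ell(a)=\lceil \tfrac{49d}{\varepsilon_\ell^2}\log(1/\delta_\ell)\hat\sigma_\ell^2(a)\pi_\ell(a)\rceil$ times; compute the weighted least squares estimator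 $\hat\theta^{(\ell)}=V_\ell^{-1}\sum_s\hat\sigma_\ell^2(a_s)^{-1}a_sX_s$ with $V_\ell=\sum_s\hat\sigma_\ell^2(a_s)^{-1}a_sa_s^\top$ (sums over these $T_\ell=\sum_aT_\ell(a)$ rounds); set $\mathcal{A}_{\ell+1}=\{a\in\mathcal{A}_\ell:\max_{b\in\mathcal{A}_\ell}(b-a)^\top\hat\theta^{(\ell)}\le 2\varepsilon_\ell\}$; increase $t$ by $T_\ell$. *)

(* Defs.v *)
From HB Require Import structures.
From mathcomp Require Import all_boot all_order all_algebra.
From mathcomp Require Import all_classical all_reals all_analysis.
Set Implicit Arguments. Unset Strict Implicit. Unset Printing Implicit Defensive.
Import Order.TTheory GRing.Theory Num.Theory.
Local Open Scope ring_scope.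
Local Open Scope classical_set_scope.

Definition dotv (R : realType) (d : nat) (u v : 'rV[R]_d) : R :=
  \sum_(i < d) u ord0 i * v ord0 i.

Definition qform (R : realType) (d : nat) (M : 'M[R]_d) (u : 'rV[R]_d) : R :=
  (u *m M *m u^T) ord0 ord0.

Definition sqnorm (R : realType) (d : nat) (u : 'rV[R]_d) : R := dotv u u.

Definition is_design (R : realType) (d : nat) (B : seq 'rV[R]_d)
    (pi : 'rV[R]_d -> R) : Prop :=
  (forall a, a \in B -> 0 <= pi a) /\ \sum_(a <- undup B) pi a = 1.

Definition Vdesign (R : realType) (d : nat) (B : seq 'rV[R]_d)
    (pi : 'rV[R]_d -> R) : 'M[R]_d :=
  \sum_(a <- undup B) pi a *: (a^T *m a).

Definition supp (R : realType) (d : nat) (B : seq 'rV[R]_d)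
    (pi : 'rV[R]_d -> R) : seq 'rV[R]_d :=
  [seq a <- undup B | 0 < pi a].

(* Working in the span of B: ||a||_{V^{-1}} is finite for every a in B
   iff every a in B lies in the row space of V(pi); there the (pseudo)
   inverse pinvmx gives the well-defined value a V^+ a^T. *)
Definition design_covers (R : realType) (d : nat) (B : seq 'rV[R]_d)
    (pi : 'rV[R]_d -> R) : Prop :=
  forall a, a \in B -> (a <= Vdesign B pi)%MS.

(* max_{a in B} ||a||_{V(pi)^{-1}} (meaningful when design_covers holds) *)
Definition gvalue (R : realType) (d : nat) (B : seq 'rV[R]_d)
    (pi : 'rV[R]_d -> R) : R :=
  \big[Num.max/0]_(a <- undup B) Num.sqrt (qform (pinvmx (Vdesign B pi)) a).

(* pi is a G-optimal design on B: it minimizes max_a ||a||_{V(pi)^{-1}},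
   designs with an infinite value (not covering span B) being excluded. *)
Definition G_optimal (R : realType) (d : nat) (B : seq 'rV[R]_d)
    (pi : 'rV[R]_d -> R) : Prop :=
  [/\ is_design B pi, design_covers B pi &
      forall pi', is_design B pi' -> design_covers B pi' ->
        gvalue B pi <= gvalue B pi'].

Definition eps_l (R : realType) (l : nat) : R := (2 ^+ l)^-1.
Definition delta_l (R : realType) (K : nat) (delta : R) (l : nat) : R :=
  delta / (K%:R * l%:R * l.+1%:R).
Definition gamma_l (R : realType) (d : nat) (delta : R) (l : nat) : R :=
  2 * delta / (l%:R * l.+1%:R * d%:R * d.+1%:R).

(* Stopping Rule algorithm SR(epsb, deltab) of Dagum, Karp, Luby, Ross:
   Upsilon = 4 (e-2) ln(2/deltab) / epsb^2, Upsilon1 = 1 + (1+epsb) Upsilon;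
   N := 0, S := 0; while S < Upsilon1 do (N := N+1; S := S + Z_N);
   output Upsilon1 / N. *)
Definition SR_Upsilon1 (R : realType) (epsb deltab : R) : R :=
  1 + (1 + epsb) * (4 * (expR 1 - 2) * ln (2 / deltab) / epsb ^+ 2).

Definition Tplays (R : realType) (d K : nat) (delta : R) (l : nat)
    (sig2 pia : R) : nat :=
  `|Num.ceil (49 * d%:R / (eps_l R l) ^+ 2 * ln ((delta_l K delta l)^-1)
               * sig2 * pia)|%N.

Inductive vase_mode (R : realType) (d : nat) :=
  (* variance estimation of [cur] (remaining support elements [todo]);
     [first] = reward of the first of the two plays of the current sample;
     [S], [N] = running sum / count of the SR algorithm;
     [done_] = list of (action, estimated variance) already computed *)
  | VarEst of seq 'rV[R]_d & 'rV[R]_d & option R & R & nat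
             & seq ('rV[R]_d * R)
  (* main plays: remaining schedule of (action, estimated variance) and the
     accumulated matrix V_l and vector sum_s sig^-2 X_s a_s *)
  | Play of seq ('rV[R]_d * R) & 'M[R]_d & 'rV[R]_d
  (* unreachable under the hypotheses of the theorem *)
  | Stuck.

Record vase_state (R : realType) (d : nat) := VState {
  vs_phase : nat;
  vs_active : seq 'rV[R]_d;
  vs_mode : vase_mode R d }.

Definition vase_start_phase (R : realType) (d : nat)
    (design : seq 'rV[R]_d -> 'rV[R]_d -> R)
    (l : nat) (Al : seq 'rV[R]_d) : vase_state R d :=
  match supp Al (design Al) with
  | a :: rest => VState l Al (VarEst rest a None 0 0 [::])
  | [::] => VState l Al (Stuck R d)
  end.

Definition vase_end_phase (R : realType) (d : nat)
    (design : seq 'rV[R]_d -> 'rV[R]_d -> R)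
    (l : nat) (Al : seq 'rV[R]_d) (V : 'M[R]_d) (b : 'rV[R]_d)
    : vase_state R d :=
  let thhat := b *m pinvmx V in
  let Anext := [seq a <- Al |
                 all (fun b' => dotv (b' - a) thhat <= 2 * eps_l R l) Al] in
  vase_start_phase design l.+1 Anext.

Definition vase_begin_play (R : realType) (d K : nat) (delta : R)
    (design : seq 'rV[R]_d -> 'rV[R]_d -> R)
    (l : nat) (Al : seq 'rV[R]_d) (est : seq ('rV[R]_d * R))
    : vase_state R d :=
  let sched := flatten [seq nseq (Tplays d K delta l p.2 (design Al p.1)) p
                       | p <- est] in
  match sched with
  | [::] => VState l Al (Stuck R d)
  | _ => VState l Al (Play sched 0 0)
  end.

Definition vase_action (R : realType) (d : nat) (s : vase_state R d)
    : 'rV[R]_d :=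
  match vs_mode s with
  | VarEst _ cur _ _ _ _ => cur
  | Play ((a, _) :: _) _ _ => a
  | _ => 0
  end.

Definition vase_step (R : realType) (d K : nat) (delta : R)
    (design : seq 'rV[R]_d -> 'rV[R]_d -> R)
    (s : vase_state R d) (X : R) : vase_state R d :=
  let l := vs_phase s in
  let Al := vs_active s in
  match vs_mode s with
  | VarEst todo cur None Ssum N done_ =>
      VState l Al (VarEst todo cur (Some X) Ssum N done_)
  | VarEst todo cur (Some X0) Ssum N done_ =>
      let Z := Num.max ((X0 - X) ^+ 2 / 4) (eps_l R l / 2) in
      let U1 := SR_Upsilon1 (1 / 2) (gamma_l d delta l) in
      let S' := Ssum + Z in
      let N' := N.+1 in
      if S' < U1 then VState l Al (VarEst todo cur None S' N' done_)
      else
        let done' := rcons done_ (cur, U1 / N'%:R) in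
        match todo with
        | a :: todo' => VState l Al (VarEst todo' a None 0 0 done')
        | [::] => vase_begin_play K delta design l Al done'
        end
  | Play ((a, sig2) :: rest) V b =>
      let V' := V + sig2^-1 *: (a^T *m a) in
      let b' := b + (sig2^-1 * X) *: a in
      match rest with
      | [::] => vase_end_phase design l Al V' b'
      | _ => VState l Al (Play rest V' b')
      end
  | _ => s
  end.

(* state of VASE at the beginning of round t (rounds numbered from 0),
   when the parameter drawn at round s is theta s *)
Fixpoint vase_state_at (R : realType) (d K : nat) (delta : R)
    (design : seq 'rV[R]_d -> 'rV[R]_d -> R) (A : seq 'rV[R]_d)
    (theta : nat -> 'rV[R]_d) (t : nat) : vase_state R d :=
  match t with
  | 0 => vase_start_phase design 1 A
  | t'.+1 =>
      let s := vase_state_at K delta design A theta t' in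
      vase_step K delta design s (dotv (vase_action s) (theta t'))
  end.

Definition vase_action_at (R : realType) (d K : nat) (delta : R)
    (design : seq 'rV[R]_d -> 'rV[R]_d -> R) (A : seq 'rV[R]_d)
    (theta : nat -> 'rV[R]_d) (t : nat) : 'rV[R]_d :=
  vase_action (vase_state_at K delta design A theta t).

Definition pseudo_regret (R : realType) (d : nat) (astar thstar : 'rV[R]_d)
    (act : nat -> 'rV[R]_d) (T : nat) : R :=
  \sum_(t < T) dotv (astar - act t) thstar.

Definition ev_rect (R : realType) (dd : measure_display) (Om : measurableType dd)
    (d : nat) (X : Om -> 'rV[R]_d) (B : 'I_d -> set R) : set Om :=
  [set w | forall i, B i (X w ord0 i)].

(* (theta_t)_t is an i.i.d. sequence of random vectors of R^d.  The
   measurable rectangles form a pi-system generating the Borel sets of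
   R^d, so independence / equality of laws is expressed on them. *)
Definition iid_vectors (R : realType) (dd : measure_display)
    (Om : measurableType dd) (P : probability Om R) (d : nat)
    (theta : nat -> Om -> 'rV[R]_d) : Prop :=
  [/\ (forall t (i : 'I_d), measurable_fun setT (fun w => theta t w ord0 i)),
      (forall (J : seq nat) (B : nat -> 'I_d -> set R),
         uniq J -> (forall t i, measurable (B t i)) ->
         fine (P (\bigcap_(t in [set t | t \in J]) ev_rect (theta t) (B t)))
         = \prod_(t <- J) fine (P (ev_rect (theta t) (B t))))
    & (forall t (B : 'I_d -> set R), (forall i, measurable (B i)) ->
         P (ev_rect (theta t) B) = P (ev_rect (theta 0%N) B))].

Definition mean_vec (R : realType) (dd : measure_display)
    (Om : measurableType dd) (P : probability Om R) (d : nat)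
    (th : Om -> 'rV[R]_d) : 'rV[R]_d :=
  \row_i fine (\int[P]_w (th w ord0 i)%:E).

Definition cov_mx (R : realType) (dd : measure_display)
    (Om : measurableType dd) (P : probability Om R) (d : nat)
    (th : Om -> 'rV[R]_d) : 'M[R]_d :=
  \matrix_(i, j) fine (\int[P]_w
     ((th w ord0 i - mean_vec P th ord0 i) *
      (th w ord0 j - mean_vec P th ord0 j))%:E).

Definition M_sigma (R : realType) (d : nat) (A : seq 'rV[R]_d)
    (Sigma : 'M[R]_d) : R :=
  Num.min (\big[Num.max/0]_(a <- A) qform Sigma a)
          (\big[Num.max/0]_(a <- A) sqnorm a * \tr Sigma).

(* Main.v *)
(* Each deviation used by the algorithm is controlled by a nonnegative exponential
   test martingale: a product over rounds of factors exp(lambda Y) / E[exp(lambda Y)],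
   one family for the running sums of the stopping rule and one for the weighted
   reward sums tested against V^+ a. All have mean at most one, so a single Markov
   inequality for their weighted sum makes every weight * martingale < 1
   simultaneously, up to probability 3 delta; only finitely many phases, arms and
   values of lambda occur. On that event a deterministic invariant holds along the
   run: the stopping rule returns the mean of its samples up to a factor in
   [1/2, 3/2] after O(log(1/gamma) / eps) samples, so estimated variances dominate
   sigma^2 / 4 and are at most 3/4 (sigma^2 + eps); by Kiefer-Wolfowitz the play
   counts give leverage at most eps^2 / (49 log(1/delta_l)), hence estimates accurate
   up to 17/21 eps, elimination never removes the best arm, and surviving arms have
   gap at most 8 times the next eps. A phase has min(T, d L (M + eps) / eps^2) main
   plays up to d^2, each of regret O(eps), and the geometric mean of the two bounds
   is sqrt(d T L M) / eps; there are O(log T) phases. *)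

Require Import Defs.
From HB Require Import structures.
From mathcomp Require Import all_boot all_order all_algebra perm.
From mathcomp Require Import all_classical all_reals all_analysis.
From mathcomp Require Import measurable_realfun zify ring lra.
Import Order.TTheory GRing.Theory Num.Theory.
Import numFieldNormedType.Exports.
Local Open Scope ring_scope.
Local Open Scope classical_set_scope.

(** * Independence of the next parameter from the history *)

Section History.
Context {R : realType} {dd : measure_display} {Om : measurableType dd}.
Context (P : probability Om R) {d : nat} (theta : nat -> Om -> 'rV[R]_d).

(** The run decides which arms are sampled, how often and with which weights, so there is no fixed
    list of samples to which a concentration inequality could be applied. Two devices deal with
    this. Each tested block has a deterministic index (a phase with the rank of an estimation inside
    it, or with an arm of [A], and one of two values of lambda), and its factor is 1 in every round
    outside the block. The test martingale thus has the same value when its block ends as at the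
    horizon [T], which takes the place of optional stopping and lets the horizon cut a phase
    anywhere. Secondly, each factor is normalised by its exact Laplace transform given the current
    state; upper bounds on these transforms enter only in the deterministic analysis, where the
    state is known to be reachable. What remains for measure theory is that the state before round
    [n] depends measurably on the first [n] parameters, although states carry no sigma-algebra, and
    that independence, assumed on rectangles, extends to the whole history. *)

Definition rect : set (set 'rV[R]_d) :=
  [set C : set 'rV[R]_d | exists2 B : 'I_d -> set R, (forall i, measurable (B i)) &
     C = [set v : 'rV[R]_d | forall i, B i (v ord0 i)]].

(** The i.i.d. hypothesis speaks of rectangles only. They form a pi-system, so on the sigma-algebra
    that they generate two finite measures agreeing on them are equal. *)
Definition vec : measurableType (rect.-sigma)%mdisp := g_sigma_algebraType rect.

Definition hrect (n : nat) : set (set Om) :=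
  [set C : set Om | exists2 B : nat -> 'I_d -> set R,
     (forall t i, measurable (B t i)) &
     C = \bigcap_(t in `I_n) ev_rect (theta t) (B t)].

(* [Om] with the sigma-algebra generated by [theta 0, ..., theta n.-1]. *)
Definition hist (n : nat) : measurableType ((hrect n).-sigma)%mdisp :=
  g_sigma_algebraType (hrect n).

Lemma rectI : setI_closed rect.
Proof.
move=> _ _ [B mB ->] [B' mB' ->]; exists (fun i => B i `&` B' i).
  by move=> i; exact: measurableI.
apply/seteqP; split => v /=; first by move=> [h h'] i.
by move=> h; split=> i; have [] := h i.
Qed.

Lemma rectT : rect setT.
Proof. by exists (fun=> setT) => //; apply/seteqP; split. Qed.

Lemma hrectI n : setI_closed (hrect n).
Proof.
move=> _ _ [B mB ->] [B' mB' ->]; exists (fun t i => B t i `&` B' t i).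
  by move=> t i; exact: measurableI.
apply/seteqP; split => w /=.
  by move=> [h h'] t tn i; split; [exact: h|exact: h'].
by move=> h; split=> t tn i; have [] := h t tn i.
Qed.

Lemma hrectT n : hrect n setT.
Proof. by exists (fun=> fun=> setT) => //; apply/seteqP; split. Qed.

Lemma measurable_coord (i : 'I_d) :
  measurable_fun setT (fun v : vec => (v : 'rV[R]_d) ord0 i).
Proof.
move=> _ Y mY; rewrite setTI; apply: sub_sigma_algebra.
exists (fun j => if j == i then Y else setT).
  by move=> j; case: ifP.
apply/seteqP; split => v /=.
  by move=> Yv j; case: eqP => // ->.
by move=> /(_ i); rewrite eqxx.
Qed.

Lemma measurable_dotv (a : 'rV[R]_d) :
  measurable_fun setT (fun v : vec => dotv a v).
Proof.
rewrite /dotv; apply: measurable_sum => i.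
apply: measurable_funM; first exact: measurable_cst.
exact: measurable_coord.
Qed.

Hypothesis iid : iid_vectors P theta.

Lemma measurable_theta t : measurable_fun setT (theta t : Om -> vec).
Proof.
have [mth _ _] := iid.
apply: (@measurability _ _ Om vec setT (theta t) rect); first by [].
move=> _ [_ [B mB ->] <-].
rewrite setTI.
have -> : theta t @^-1` [set v : 'rV[R]_d | forall i, B i (v ord0 i)] =
    \bigcap_(i in [set: 'I_d]) ((fun w => theta t w ord0 i) @^-1` (B i)).
  by apply/seteqP; split => w /=; [move=> h i _|move=> h i]; exact: h.
apply: fin_bigcap_measurable => // i _; rewrite -[X in measurable X]setTI; exact: mth.
Qed.

Lemma hist_sub n (C : set Om) :
  (measurable : set (set (hist n))) C -> measurable C.
Proof.
move: C; apply: smallest_sub.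
  by split; [exact: measurable0|move=> A mA; rewrite setTD; exact: measurableC|
    move=> F mF; exact: bigcupT_measurable].
move=> _ [B mB ->].
apply: bigcap_measurableType.
move=> t _; have -> : ev_rect (theta t) (B t) =
   theta t @^-1` [set v : 'rV[R]_d | forall i, B t i (v ord0 i)] by [].
rewrite -[X in measurable X]setTI; apply: measurable_theta => //.
by apply: sub_sigma_algebra; exists (B t).
Qed.

Lemma hist_mono n (C : set Om) :
  (measurable : set (set (hist n))) C -> (measurable : set (set (hist n.+1))) C.
Proof.
move: C; apply: smallest_sub.
  by split; [exact: measurable0|move=> A mA; rewrite setTD; exact: measurableC|
    move=> F mF; exact: bigcupT_measurable].
move=> _ [B mB ->]; apply: sub_sigma_algebra.
exists (fun t => if (t < n)%N then B t else fun=> setT).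
  by move=> t i; case: ifP.
apply/seteqP; split => w /= h t /= tn i.
  by case: ifP => // tn'; exact: h.
by have := h t (ltnW tn) i; rewrite tn.
Qed.

Lemma measurable_hist_theta n :
  measurable_fun setT (theta n : hist n.+1 -> vec).
Proof.
apply: (@measurability _ _ (hist n.+1) vec setT (theta n) rect); first by [].
move=> _ [_ [B mB ->] <-].
rewrite setTI; apply: sub_sigma_algebra.
exists (fun t => if t == n then B else fun=> setT).
  by move=> t i; case: ifP.
apply/seteqP; split => w /=.
  by move=> h t _ i; case: eqP => [->|//].
by move=> /(_ n (ltnSn n)) h i; have := h i; rewrite eqxx.
Qed.

Lemma measurable_hist_pair n :
  measurable_fun setT (fun w : hist n.+1 => ((w : hist n), (theta n w : vec))).
Proof.
apply: measurable_fun_pair; last exact: measurable_hist_theta.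
by move=> _ Y mY; rewrite setTI; exact: hist_mono.
Qed.

Lemma measurable_hist_id n : measurable_fun setT (fun w : Om => (w : hist n)).
Proof. by move=> _ Y mY; rewrite setTI; apply: (@hist_sub n). Qed.

Lemma measurable_pair_Om n :
  measurable_fun setT (fun w : Om => ((w : hist n), (theta n w : vec))).
Proof.
by apply: measurable_fun_pair; [exact: measurable_hist_id|exact: measurable_theta].
Qed.

Lemma preim_theta_measurable t (D : set vec) :
  measurable D -> measurable (theta t @^-1` D).
Proof.
by move=> mD; rewrite -[X in measurable X]setTI; apply: measurable_theta.
Qed.

Definition theta_mf t : {mfun Om >-> vec} :=
  HB.pack (theta t : Om -> vec)
    (isMeasurableFun.Build _ _ Om vec _ (measurable_theta t)).

Definition pair_mf n : {mfun Om >-> (hist n * vec)%type} :=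
  HB.pack (fun w : Om => ((w : hist n), (theta n w : vec)))
    (isMeasurableFun.Build _ _ Om (hist n * vec)%type _ (measurable_pair_Om n)).

Definition hist_mf n : {mfun Om >-> hist n} :=
  HB.pack (fun w : Om => (w : hist n))
    (isMeasurableFun.Build _ _ Om (hist n) _ (measurable_hist_id n)).

Definition law : probability vec R := distribution P (theta_mf 0).

Lemma lawE t (D : set vec) : measurable D -> P (theta t @^-1` D) = law D.
Proof.
have [_ _ iidl] := iid.
have -> : P (theta t @^-1` D) = distribution P (theta_mf t) D by [].
apply: (@measure_unique _ _ vec rect (fun=> setT)) => //.
- exact: rectI.
- by move=> _; exact: rectT.
- by rewrite bigcup_const.
- move=> _ [B mB ->]; exact: iidl.
- by move=> _; rewrite (le_lt_trans (probability_le1 _ _))// ltry.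
Qed.

Lemma indep_rect n (C D : set Om) :
  hrect n C -> preimage_set_system setT (theta n) rect D ->
  P (C `&` D) = (P C * P D)%E.
Proof.
have [mth ind _] := iid.
move=> [B mB ->] [_ [B' mB' ->] <-].
pose BB t := if t == n then B' else B t.
have mBB t i : measurable (BB t i) by rewrite /BB; case: ifP.
have E1 : \bigcap_(t in `I_n) ev_rect (theta t) (B t) =
    \bigcap_(t in [set t | t \in iota 0 n]) ev_rect (theta t) (BB t).
  apply/seteqP; split => w /= h t /=.
    rewrite mem_iota add0n => /= tn i; rewrite /BB; case: eqP => [tE|_].
      by rewrite tE ltnn in tn.
    exact: h.
  move=> tn; have := h t; rewrite /= mem_iota add0n => /(_ tn).
  by rewrite /BB; case: eqP => [tE|//]; rewrite tE ltnn in tn.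
have E2 : [set: Om] `&` theta n @^-1` [set v : 'rV[R]_d | forall i, B' i (v ord0 i)] =
    ev_rect (theta n) (BB n).
  by rewrite setTI /BB eqxx.
have E3 : ev_rect (theta n) (BB n) =
    \bigcap_(t in [set t | t \in [:: n]]) ev_rect (theta t) (BB t).
  apply/seteqP; split => w /=.
    by move=> h t /=; rewrite inE => /eqP ->.
  by apply; rewrite /= inE.
have E12 : (\bigcap_(t in [set t | t \in iota 0 n]) ev_rect (theta t) (BB t))
     `&` ev_rect (theta n) (BB n) =
    \bigcap_(t in [set t | t \in rcons (iota 0 n) n]) ev_rect (theta t) (BB t).
  apply/seteqP; split => w /=.
    by move=> [h h'] t /=; rewrite mem_rcons inE => /orP[/eqP ->//|/h].
  move=> h; split; last by apply: h; rewrite /= mem_rcons inE eqxx.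
  by move=> t /= tn; apply: h; rewrite /= mem_rcons inE tn orbT.
have fP (X : set Om) : measurable X -> P X = (fine (P X))%:E.
  by move=> mX; rewrite fineK// fin_num_measure.
have mrect t : measurable (ev_rect (theta t) (BB t)).
  apply: (@preim_theta_measurable t (fun v : 'rV[R]_d => forall i, BB t i (v ord0 i))).
  by apply: sub_sigma_algebra; exists (BB t).
have mcap (J : seq nat) : measurable
    (\bigcap_(t in [set t | t \in J]) ev_rect (theta t) (BB t)).
  by apply: bigcap_measurableType => t _; exact: mrect.
rewrite E2 E1 E12 fP// [in RHS]fP// [X in (_ * X)%E]fP// -EFinM.
congr (_%:E); rewrite !ind ?iota_uniq ?rcons_uniq ?iota_uniq ?mem_iota ?add0n ?ltnn//.
by rewrite -cats1 big_cat big_seq1.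
Qed.

(** The two events are freed from rectangles one at a time: for fixed [C] both sides are finite
    measures in [D] that agree on a pi-system; [indep] repeats this with [D] fixed. *)
Lemma indep_rectl n (C : set Om) (D : set vec) :
  hrect n C -> measurable D -> P (C `&` theta n @^-1` D) = (P C * law D)%E.
Proof.
move=> hC mD.
have mC : measurable C by apply: (@hist_sub n); exact: sub_sigma_algebra.
have -> : P (C `&` theta n @^-1` D) =
    pushforward (mrestr P mC) (theta_mf n) D.
  by rewrite /pushforward /mrestr setIC.
have PC0 : 0 <= fine (P C) by rewrite fine_ge0.
have -> : (P C * law D = mscale (NngNum PC0) law D)%E.
  by rewrite /mscale/= fineK// fin_num_measure.
apply: (@measure_unique _ _ vec rect (fun=> setT)) => //.
- exact: rectI.
- by move=> _; exact: rectT.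
- by rewrite bigcup_const.
- move=> A rA; rewrite /= /pushforward /mrestr /mscale /= fineK ?fin_num_measure//.
  have mA : measurable (A : set vec) by exact: sub_sigma_algebra.
  rewrite -(@lawE n _ mA) setIC (@indep_rect n)//.
  by exists A => //; rewrite setTI.
- move=> _; rewrite /= /pushforward /mrestr.
  by rewrite (le_lt_trans (probability_le1 _ _))// ?ltry// preimage_setT setTI.
Qed.

Lemma indep n (C : set Om) (D : set vec) :
  (measurable : set (set (hist n))) C -> measurable D ->
  P (C `&` theta n @^-1` D) = (P C * law D)%E.
Proof.
move=> mC mD; have mD' := @preim_theta_measurable n _ mD.
have -> : P (C `&` theta n @^-1` D) =
    pushforward (mrestr P mD') (hist_mf n) C by [].
have lD0 : 0 <= fine (law D) by rewrite fine_ge0.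
have -> : (P C * law D = mscale (NngNum lD0) (distribution P (hist_mf n)) C)%E.
  by rewrite /mscale/= fineK ?fin_num_measure// muleC.
apply: (@measure_unique _ _ (hist n) (hrect n) (fun=> setT)) => //.
- exact: hrectI.
- by move=> _; exact: hrectT.
- by rewrite bigcup_const.
- move=> A rA; rewrite /= /pushforward /mrestr /mscale /= fineK ?fin_num_measure//.
  by rewrite muleC; exact: indep_rectl rA mD.
- move=> _; rewrite /= /pushforward /mrestr.
  by rewrite (le_lt_trans (probability_le1 _ _))// ?ltry// preimage_setT setTI.
Qed.

Local Open Scope ereal_scope.

(** By independence the joint law of the history and the next parameter is a product measure, so
    Tonelli averages over [theta n] with the history frozen. *)
Lemma integral_history n (F : hist n * vec -> \bar R) :
  measurable_fun [set: (hist n * vec)%type] F -> (forall x, 0 <= F x) ->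
  \int[P]_w F (w, theta n w) = \int[P]_w \int[law]_v F (w, v).
Proof.
move=> mF F0.
have -> : \int[P]_w F (w, theta n w) = \int[distribution P (pair_mf n)]_z F z.
  by rewrite ge0_integral_pushforward//.
have -> : \int[distribution P (pair_mf n)]_z F z =
    \int[distribution P (hist_mf n) \x law]_z F z.
  apply: eq_measure_integral => A mA _.
  symmetry; apply: product_measure_unique => // C D mC mD.
  exact: indep.
rewrite fubini_tonelli1//.
rewrite ge0_integral_pushforward//.
- exact: measurable_fun_fubini_tonelli_F.
- by move=> x _; exact: integral_ge0.
Qed.

End History.

(** * Products of factors of conditional mean at most one *)

Section Martingale.
Context {R : realType} {dd : measure_display} {Om : measurableType dd}.
Context (P : probability Om R) {d : nat} (theta : nat -> Om -> 'rV[R]_d).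
Hypothesis iid : iid_vectors P theta.
Local Open Scope ereal_scope.

(** Measurability of [M n] is with respect to the history of length [n], which is stronger than
    measurability on [Om]: it makes the integrand a function of the history and [theta n], so that
    [M n] leaves the inner integral. Hence it is carried through the same induction as the mean. *)
Lemma supermartingale_le1 (M : nat -> Om -> R) (f : nat -> Om -> 'rV[R]_d -> R) :
  (forall w, M 0%N w = 1%R) ->
  (forall n w, M n.+1 w = (M n w * f n w (theta n w))%R) ->
  (forall n w v, (0 <= f n w v)%R) ->
  (forall n, measurable_fun [set: (hist theta n * vec)%type]
     (fun z : hist theta n * @vec R d => f n z.1 z.2)) ->
  (forall n w, \int[law P theta iid]_v (f n w v)%:E <= 1) ->
  forall n, [/\ measurable_fun setT (M n : hist theta n -> R),
    (forall w, (0 <= M n w)%R) & \int[P]_w (M n w)%:E <= 1].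
Proof.
move=> M0 MS f0 mf f1; elim=> [|n [mM Mge IH]].
  have -> : M 0%N = cst 1%R by apply/funext => w; rewrite M0.
  split => //.
  rewrite (_ : (fun w : Om => (cst 1%R w)%:E) = cst 1)// integral_cst//.
  by rewrite mul1e; exact: probability_le1.
have mF : measurable_fun [set: (hist theta n * vec)%type]
    (fun z : hist theta n * @vec R d => M n z.1 * f n z.1 z.2)%R.
  apply: measurable_funM; last exact: mf.
  exact: measurableT_comp.
split.
- have -> : (M n.+1 : hist theta n.+1 -> R) =
     (fun z : hist theta n * @vec R d => M n z.1 * f n z.1 z.2)%R \o
     (fun w : hist theta n.+1 => ((w : hist theta n), (theta n w : vec))).
    by apply/funext => w; rewrite MS.
  by apply: measurableT_comp => //; exact: measurable_hist_pair.
- by move=> w; rewrite MS mulr_ge0.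
- under eq_integral do rewrite MS.
  rewrite (@integral_history _ _ _ P _ theta iid n
     (fun z : hist theta n * @vec R d => (M n z.1 * f n z.1 z.2)%:E)); first last.
  + by move=> z; rewrite lee_fin mulr_ge0.
  + exact/measurable_EFinP.
  apply: le_trans IH; apply: ge0_le_integral => //.
  + by move=> w _; apply: integral_ge0 => v _; rewrite lee_fin mulr_ge0.
  + pose F := fun z : hist theta n * @vec R d => (M n z.1 * f n z.1 z.2)%:E.
    have mFF : measurable_fun setT (fun w : hist theta n => \int[law P theta iid]_v F (w, v)).
      apply: measurable_fun_fubini_tonelli_F; first exact/measurable_EFinP.
      by move=> z; rewrite lee_fin mulr_ge0.
    move=> _ Y mY; have := mFF measurableT Y mY.
    by move/(@hist_sub _ _ _ _ _ _ iid).
  + apply/measurable_EFinP => _ Y mY; have := mM measurableT Y mY.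
    by move/(@hist_sub _ _ _ _ _ _ iid).
  + move=> w _ /=.
    rewrite (_ : \int[_]_v _ = (M n w)%:E * \int[law P theta iid]_v (f n w v)%:E).
      by rewrite -[leRHS]mule1 lee_wpmul2l// lee_fin.
    under eq_integral do rewrite EFinM.
    rewrite ge0_integralZl_EFin//.
    * by move=> v _; rewrite lee_fin.
    * apply/measurable_EFinP.
      apply: (measurableT_comp (mf n) (g := fun v : @vec R d => ((w : hist theta n), v))).
      by apply: measurable_fun_pair.
Qed.

End Martingale.

(** * Measurability of the states of a run *)

Section MeasurableState.
Context {R : realType} {d : nat}.
Variables (K : nat) (delta : R) (design : seq 'rV[R]_d -> 'rV[R]_d -> R).

Definition vmeas {dT} (T : measurableType dT) (b : T -> 'rV[R]_d) :=
  forall i, measurable_fun setT (fun w => b w ord0 i).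

(* State-valued maps that are finite gluings, along measurable tests, of maps
   whose discrete part is constant; the type of states carries no sigma-algebra. *)
Inductive mstate {dT} (T : measurableType dT) : (T -> vase_state R d) -> Prop :=
| mstate_est l Al todo cur (o : option (T -> R)) S N done_ :
    (forall X0, o = Some X0 -> measurable_fun setT X0) -> measurable_fun setT S ->
    mstate T (fun w => VState l Al (VarEst todo cur (omap (fun f => f w) o) (S w) N done_))
| mstate_play l Al sched V b : vmeas T b ->
    mstate T (fun w => VState l Al (Play sched V (b w)))
| mstate_stuck l Al : mstate T (fun=> VState l Al (Stuck R d))
| mstate_glue (e : T -> bool) s1 s2 : measurable_fun setT e ->
    mstate T s1 -> mstate T s2 -> mstate T (fun w => if e w then s1 w else s2 w).

Lemma mstate_comp {d1 d2} (T1 : measurableType d1) (T2 : measurableType d2)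
  (phi : T1 -> T2) s : measurable_fun setT phi -> mstate T2 s -> mstate T1 (s \o phi).
Proof.
move=> mphi; elim=> {s} [l Al todo cur o S N dn mo mS|l Al sched V b mb|l Al|e s1 s2 me _ IH1 _ IH2].
- have -> : (fun w : T2 => VState l Al (VarEst todo cur (omap (@^~ w) o) (S w) N dn)) \o phi
   = (fun w : T1 => VState l Al (VarEst todo cur
        (omap (@^~ w) (omap (fun f => f \o phi) o)) ((S \o phi) w) N dn)).
    by apply/funext => w /=; case: o mo.
  constructor; last exact: measurableT_comp.
  case: o mo => // X0 mo _ [<-]; apply: measurableT_comp => //; exact: mo.
- apply: (@mstate_play _ T1 l Al sched V (b \o phi)) => i.
  by apply: (measurableT_comp (mb i)).
- exact: mstate_stuck.
- by apply: (@mstate_glue _ T1 (e \o phi)) => //; exact: measurableT_comp.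
Qed.

Section Step.
Context {dT} (T : measurableType dT).

Lemma mstate_start l Al : mstate T (fun=> vase_start_phase design l Al).
Proof.
rewrite /vase_start_phase; case: supp => [|a rest]; first exact: mstate_stuck.
apply: (@mstate_est _ T l Al rest a None (fun=> 0)) => //; exact: measurable_cst.
Qed.

Lemma mstate_begin l Al est : mstate T (fun=> vase_begin_play K delta design l Al est).
Proof.
rewrite /vase_begin_play; case: flatten => [|p s]; first exact: mstate_stuck.
apply: (@mstate_play _ T _ _ _ _ (fun=> 0)) => i; exact: measurable_cst.
Qed.

(** Elimination produces one of finitely many lists. Deciding one arm at a time gives one measurable
    test per arm; [G] is general so that the arms kept so far can be absorbed into it. *)
Lemma mstate_filter (G : seq 'rV[R]_d -> T -> vase_state R d) Al
    (p : 'rV[R]_d -> T -> bool) :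
  (forall B, mstate T (G B)) -> (forall a, measurable_fun setT (p a)) ->
  mstate T (fun w => G [seq a <- Al | p a w] w).
Proof.
move=> nG mp; elim: Al G nG => [|a Al IH] G nG /=; first exact: nG.
have -> : (fun w => G (if p a w then a :: [seq x <- Al | p x w]
    else [seq x <- Al | p x w]) w) =
    (fun w => if p a w then G (a :: [seq x <- Al | p x w]) w
      else G [seq x <- Al | p x w] w).
  by apply/funext => w; case: ifP.
apply: mstate_glue => //.
  exact: (IH (fun B => G (a :: B))).
exact: IH.
Qed.

Lemma measurable_dotv_fun (a : 'rV[R]_d) (b : T -> 'rV[R]_d) : vmeas T b ->
  measurable_fun setT (fun w => dotv a (b w)).
Proof.
move=> mb; rewrite /dotv; apply: measurable_sum => i.
apply: measurable_funM; [exact: measurable_cst|exact: mb].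
Qed.

Lemma vmeas_mulmx (b : T -> 'rV[R]_d) (M : 'M[R]_d) : vmeas T b ->
  vmeas T (fun w => b w *m M).
Proof.
move=> mb i; under eq_fun do rewrite mxE.
by apply: measurable_sum => j; apply: measurable_funM => //; exact: mb.
Qed.

Lemma mstate_end l Al V (b : T -> 'rV[R]_d) : vmeas T b ->
  mstate T (fun w => vase_end_phase design l Al V (b w)).
Proof.
move=> mb; rewrite /vase_end_phase.
pose p B a w := all (fun b' => dotv (b' - a) (b w *m pinvmx V) <= 2 * eps_l R l) B.
apply: (mstate_filter (fun B w => vase_start_phase design l.+1 B) Al (p Al)).
  by move=> B; exact: mstate_start.
move=> a; elim: Al => [|b' s IH] /=; first exact: measurable_cst.
apply: measurable_and => //; apply: measurable_fun_ler => //.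
by apply: measurable_dotv_fun; exact: vmeas_mulmx.
Qed.

(** The reward is a family indexed by arms because the arm played is constant on each piece of the
    gluing, whereas [vase_action (s w)] varies with [w]. *)
Lemma mstate_step s (X : 'rV[R]_d -> T -> R) : mstate T s ->
  (forall a, measurable_fun setT (X a)) ->
  mstate T (fun w => vase_step K delta design (s w) (X (vase_action (s w)) w)).
Proof.
move=> ns mX.
elim: ns => {s} [l Al todo cur o S N dn mo mS|l Al sched V b mb|l Al|e s1 s2 me _ IH1 _ IH2].
- case: o mo => [X0|] mo; rewrite /vase_step /vase_action/=; last first.
    apply: (@mstate_est _ T l Al todo cur (Some (X cur)) S) => //.
    by move=> _ [<-].
  have {}mo := mo _ erefl.
  have mS' : measurable_fun setT (fun w => S w +
      Num.max ((X0 w - X cur w) ^+ 2 / 4) (eps_l R l / 2)).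
    apply: measurable_funD => //; apply: measurable_maxr => //.
    apply: measurable_funM => //; apply: measurable_funX.
    exact: measurable_funB.
  apply: (@mstate_glue _ T (fun w => _ < _)).
  + by apply: measurable_fun_ltr.
  + exact: (@mstate_est _ T l Al todo cur None).
  + case: todo => [|a todo]; first exact: mstate_begin.
    by apply: (@mstate_est _ T l Al todo a None (fun=> 0)).
- rewrite /vase_step /vase_action/=.
  case: sched => [|[a sig2] rest]; first exact: mstate_play.
  have mb' : vmeas T (fun w => b w + (sig2^-1 * X a w) *: a).
    move=> i; under eq_fun do rewrite mxE [X in _ + X]mxE.
    apply: measurable_funD; first exact: mb.
    by apply: measurable_funM => //; apply: measurable_funM.
  by case: rest => [|p rest]; [exact: mstate_end|exact: mstate_play].
- exact: mstate_stuck.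
- have -> : (fun w => vase_step K delta design (if e w then s1 w else s2 w)
      (X (vase_action (if e w then s1 w else s2 w)) w)) =
    (fun w => if e w then vase_step K delta design (s1 w) (X (vase_action (s1 w)) w)
      else vase_step K delta design (s2 w) (X (vase_action (s2 w)) w)).
    by apply/funext => w; case: ifP.
  exact: mstate_glue.
Qed.

End Step.
End MeasurableState.

(** * Exponential test martingales *)

Section Factors.
Context {R : realType} {d : nat} (nu : probability (@vec R d) R).

(* Arms outside the action set may have unbounded rewards. Clipped rewards drive
   the same run on the almost sure event where rewards lie in [-1, 1]. *)
Definition clip (x : R) : R := Num.max (-1) (Num.min 1 x).

Definition Zsamp (l : nat) (x0 x : R) : R :=
  Num.max ((x0 - x) ^+ 2 / 4) (eps_l R l / 2).

(** The Laplace transform of a variance sample once its first reward is known to be [x0]; [lapZ]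
    averages it over that reward. *)
Definition phiZ (lam : R) (l : nat) (a : 'rV[R]_d) (x0 : R) : R :=
  fine (\int[nu]_v (expR (lam * Zsamp l x0 (clip (dotv a v))))%:E).

Definition lapZ (lam : R) (l : nat) (a : 'rV[R]_d) : R :=
  fine (\int[nu]_v (phiZ lam l a (clip (dotv a v)))%:E).

Definition lapX (c : R) (a : 'rV[R]_d) : R :=
  fine (\int[nu]_v (expR (c * clip (dotv a v)))%:E).

(* Conditional mean one in either half of a sample. Over the [j]-th estimation of
   phase [l] the factors multiply to [exp (lam * S)] over its mean. *)
Definition est_factor (l j : nat) (lam : R) (s : vase_state R d) (x : R) : R :=
  match vs_mode s with
  | VarEst _ cur o _ _ dn =>
      if (vs_phase s == l) && (size dn == j) then
        match o with
        | None => phiZ lam l cur x / lapZ lam l cur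
        | Some x0 => expR (lam * Zsamp l x0 x) / phiZ lam l cur x0
        end
      else 1
  | _ => 1
  end.

Definition total_mx (V : 'M[R]_d) (sched : seq ('rV[R]_d * R)) : 'M[R]_d :=
  V + \sum_(p <- sched) p.2^-1 *: (p.1^T *m p.1).

(* [V + sum of the remaining schedule] is the final matrix of the phase at every
   round of it, so the weight of each reward in the estimator is predictable. *)
Definition play_coef (lam : R) (a : 'rV[R]_d) V (sched : seq ('rV[R]_d * R))
    (p : 'rV[R]_d * R) : R :=
  lam * (p.2^-1 * dotv (a *m pinvmx (total_mx V sched)) p.1).

Definition play_factor (l : nat) (lam : R) (a : 'rV[R]_d) (s : vase_state R d) (x : R) : R :=
  match vs_mode s with
  | Play (p :: rest) V _ =>
      if vs_phase s == l then
        let c := play_coef lam a V (p :: rest) p in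
        expR (c * x) / lapX c p.1
      else 1
  | _ => 1
  end.

Lemma measurable_clip_dotv (a : 'rV[R]_d) : measurable_fun setT (fun v : vec => clip (dotv a v)).
Proof.
apply: measurable_maxr => //; apply: measurable_minr => //.
exact: measurable_dotv.
Qed.

Lemma measurable_Zsamp {dT} (T : measurableType dT) l (f g : T -> R) :
  measurable_fun setT f -> measurable_fun setT g ->
  measurable_fun setT (fun w => Zsamp l (f w) (g w)).
Proof.
move=> mf mg; apply: measurable_maxr => //.
by apply: measurable_funM => //; apply: measurable_funX; exact: measurable_funB.
Qed.

Lemma phiZ_ge0 lam l a x0 : 0 <= phiZ lam l a x0.
Proof. by apply/fine_ge0/integral_ge0 => v _; rewrite lee_fin expR_ge0. Qed.

Lemma lapZ_ge0 lam l a : 0 <= lapZ lam l a.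
Proof. by apply/fine_ge0/integral_ge0 => v _; rewrite lee_fin phiZ_ge0. Qed.

Lemma lapX_ge0 c a : 0 <= lapX c a.
Proof. by apply/fine_ge0/integral_ge0 => v _; rewrite lee_fin expR_ge0. Qed.

Lemma measurable_phiZ lam l a : measurable_fun setT (phiZ lam l a).
Proof.
rewrite /phiZ; apply: (measurableT_comp (@fine_measurable R setT measurableT)).
apply: (@measurable_fun_fubini_tonelli_F _ _ R vec R nu
  (fun z : R * vec => (expR (lam * Zsamp l z.1 (clip (dotv a z.2))))%:E)).
- apply/measurable_EFinP; apply: (measurableT_comp (@measurable_expR R)).
  apply: measurable_funM => //; apply: measurable_Zsamp => //.
  exact: (measurableT_comp (measurable_clip_dotv a)).
- by move=> z; rewrite lee_fin expR_ge0.
Qed.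

Lemma est_factor_ge0 l j lam s x : 0 <= est_factor l j lam s x.
Proof.
rewrite /est_factor; case: vs_mode => // todo cur o S N dn; case: ifP => // _.
by case: o => [x0|]; rewrite divr_ge0 ?expR_ge0 ?phiZ_ge0 ?lapZ_ge0.
Qed.

Lemma play_factor_ge0 l lam a s x : 0 <= play_factor l lam a s x.
Proof.
rewrite /play_factor; case: vs_mode => // -[|p rest] V b //; case: ifP => // _.
by rewrite divr_ge0 ?expR_ge0 ?lapX_ge0.
Qed.

(** If the integral is 0 or infinite, the denominator is 0 and so is the quotient, by the convention
    for inverses; the bound by 1 covers these cases too. *)
Lemma integral_normalized (g : @vec R d -> R) : measurable_fun setT g ->
  (forall v, 0 <= g v) ->
  (\int[nu]_v (g v / fine (\int[nu]_u (g u)%:E))%:E <= 1)%E.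
Proof.
move=> mg g0; set I := (\int[nu]_u (g u)%:E)%E.
have I0 : (0 <= I)%E by apply: integral_ge0 => v _; rewrite lee_fin.
under eq_integral do rewrite mulrC EFinM.
rewrite ge0_integralZl_EFin//; first last.
- by rewrite invr_ge0 fine_ge0.
- exact/measurable_EFinP.
- by move=> v _; rewrite lee_fin.
rewrite -/I; case: I I0 => [r| |]//= r0; last by rewrite invr0 mul0e.
rewrite -EFinM lee_fin; have [->|rn0] := eqVneq r 0; first by rewrite mulr0.
by rewrite mulVf.
Qed.

Lemma integral_est_factor_le1 l j lam s :
  (\int[nu]_v (est_factor l j lam s (clip (dotv (vase_action s) v)))%:E <= 1)%E.
Proof.
have h1 : (\int[nu]__ 1%:E <= 1 :> \bar R)%E.
  rewrite integral_cst//.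
  by rewrite mul1e; exact: probability_le1.
rewrite /est_factor /vase_action; case: vs_mode => [todo cur o S N dn|sched V b|] //.
case: (_ && _) => //; case: o => [x0|]; apply: integral_normalized.
- apply: (measurableT_comp (@measurable_expR R)).
  apply: measurable_funM => //; apply: measurable_Zsamp => //.
  exact: measurable_clip_dotv.
- by move=> v; exact: expR_ge0.
- apply: (measurableT_comp (measurable_phiZ lam l cur)).
  exact: measurable_clip_dotv.
- by move=> v; exact: phiZ_ge0.
Qed.

Lemma integral_play_factor_le1 l lam a s :
  (\int[nu]_v (play_factor l lam a s (clip (dotv (vase_action s) v)))%:E <= 1)%E.
Proof.
have h1 : (\int[nu]__ 1%:E <= 1 :> \bar R)%E.
  rewrite integral_cst//.
  by rewrite mul1e; exact: probability_le1.
rewrite /play_factor /vase_action; case: vs_mode => [todo cur o S N dn|[|[a' sig2] rest] V b|] //.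
case: (_ == l) => //; apply: integral_normalized.
- apply: (measurableT_comp (@measurable_expR R)).
  by apply: measurable_funM => //; exact: measurable_clip_dotv.
- by move=> v; exact: expR_ge0.
Qed.

Lemma measurable_est_factor {dT} (T : measurableType dT) l j lam s (X : 'rV[R]_d -> T -> R) :
  mstate T s -> (forall a, measurable_fun setT (X a)) ->
  measurable_fun setT (fun w => est_factor l j lam (s w) (X (vase_action (s w)) w)).
Proof.
move=> ns mX.
elim: ns => {s} [l' Al todo cur o S N dn mo mS|l' Al sched V b mb|l' Al|e s1 s2 me _ IH1 _ IH2];
  rewrite /est_factor /=.
- case: ((l' == l) && (size dn == j)); last exact: measurable_cst.
  case: o mo => [X0|] mo /=; apply: measurable_funM => //.
  + apply: (measurableT_comp (@measurable_expR R)).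
    apply: measurable_funM => //; apply: measurable_Zsamp => //.
    + exact: mo.
    + exact: mX.
  + under eq_fun do rewrite -powR_inv1 ?phiZ_ge0//.
    apply: (measurableT_comp (measurable_powR (-1))).
    by apply: (measurableT_comp (measurable_phiZ lam l cur)); exact: mo.
  + by apply: (measurableT_comp (measurable_phiZ lam l cur)); exact: mX.
- exact: measurable_cst.
- exact: measurable_cst.
- rewrite [X in measurable_fun _ X](_ : _ = (fun w => if e w then
     est_factor l j lam (s1 w) (X (vase_action (s1 w)) w) else
     est_factor l j lam (s2 w) (X (vase_action (s2 w)) w))).
    exact: measurable_fun_ifT.
  by apply/funext => w; case: ifP.
Qed.

Lemma measurable_play_factor {dT} (T : measurableType dT) l lam a s (X : 'rV[R]_d -> T -> R) :
  mstate T s -> (forall a, measurable_fun setT (X a)) ->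
  measurable_fun setT (fun w => play_factor l lam a (s w) (X (vase_action (s w)) w)).
Proof.
move=> ns mX.
elim: ns => {s} [l' Al todo cur o S N dn mo mS|l' Al sched V b mb|l' Al|e s1 s2 me _ IH1 _ IH2];
  rewrite /play_factor /=.
- exact: measurable_cst.
- case: sched => [|p rest]; first exact: measurable_cst.
  case: (l' == l); last exact: measurable_cst.
  apply: measurable_funM => //.
  apply: (measurableT_comp (@measurable_expR R)).
  by apply: measurable_funM => //; exact: mX.
- exact: measurable_cst.
- rewrite [X in measurable_fun _ X](_ : _ = (fun w => if e w then
     play_factor l lam a (s1 w) (X (vase_action (s1 w)) w) else
     play_factor l lam a (s2 w) (X (vase_action (s2 w)) w))).
    exact: measurable_fun_ifT.
  by apply/funext => w; case: ifP.
Qed.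

End Factors.

(** * One event for all test martingales *)

Section Union.
Context {R : realType} {dd : measure_display} {Om : measurableType dd}.
Context (P : probability Om R) {d : nat} (theta : nat -> Om -> 'rV[R]_d).
Hypothesis iid : iid_vectors P theta.
Variables (K : nat) (delta : R) (design : seq 'rV[R]_d -> 'rV[R]_d -> R).
Variable A : seq 'rV[R]_d.

Fixpoint clip_run (w : Om) (t : nat) : vase_state R d :=
  match t with
  | 0 => vase_start_phase design 1 A
  | t'.+1 => let s := clip_run w t' in
      vase_step K delta design s (clip (dotv (vase_action s) (theta t' w)))
  end.

Definition clip_reward (w : Om) (t : nat) : R :=
  clip (dotv (vase_action (clip_run w t)) (theta t w)).

Lemma mstate_clip_run t : mstate (hist theta t) (fun w => clip_run w t).
Proof.
elim: t => [|t IH] /=; first exact: mstate_start.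
pose s (z : hist theta t * @vec R d) := clip_run z.1 t.
pose X (a : 'rV[R]_d) (z : hist theta t * @vec R d) := clip (dotv a z.2).
have ns : mstate (hist theta t * @vec R d)%type s.
  by apply: (mstate_comp _ (hist theta t) fst (fun w => clip_run w t)).
have mX a : measurable_fun [set: (hist theta t * @vec R d)%type] (X a).
  exact: (measurableT_comp (measurable_clip_dotv a)).
have := mstate_comp _ _ _ _ (measurable_hist_pair theta t) (mstate_step K delta design _ s X ns mX).
by [].
Qed.

(** The common interface of the two families. The mean bound is asked at every state, reachable or
    not, so that no property of the run enters the probabilistic argument. *)
Record test_factor (nu : probability (@vec R d) R)
    (F : vase_state R d -> R -> R) : Prop := TestFactor {
  test_ge0 : forall s x, 0 <= F s x;
  test_le1 : forall s,
    (\int[nu]_v (F s (clip (dotv (vase_action s) v)))%:E <= 1)%E;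
  test_meas : forall dT (T : measurableType dT) s (X : 'rV[R]_d -> T -> R),
    mstate T s -> (forall a, measurable_fun setT (X a)) ->
    measurable_fun setT (fun w => F (s w) (X (vase_action (s w)) w)) }.

Definition test_mart (F : vase_state R d -> R -> R) (T : nat) (w : Om) : R :=
  \prod_(t < T) F (clip_run w t) (clip_reward w t).

Lemma test_martP F T : test_factor (law P theta iid) F ->
  [/\ measurable_fun setT (test_mart F T), (forall w, 0 <= test_mart F T w) &
   (\int[P]_w (test_mart F T w)%:E <= 1)%E].
Proof.
move=> [F0 F1 mF].
have [] := @supermartingale_le1 _ _ _ P _ theta iid (test_mart F)
  (fun n w v => F (clip_run w n) (clip (dotv (vase_action (clip_run w n)) v))) _ _ _ _ _ T.
- by move=> w; rewrite /test_mart big_ord0.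
- by move=> n w; rewrite /test_mart big_ord_recr.
- by move=> n w v; exact: F0.
- move=> n.
  pose s (z : hist theta n * @vec R d) := clip_run z.1 n.
  pose X (a : 'rV[R]_d) (z : hist theta n * @vec R d) := clip (dotv a z.2).
  have := mF _ (hist theta n * @vec R d)%type s X; apply.
    apply: (mstate_comp _ (hist theta n) fst (fun w => clip_run w n)) => //.
    exact: mstate_clip_run.
  by move=> a; exact: (measurableT_comp (measurable_clip_dotv a)).
- by move=> n w; exact: F1.
move=> mM M0 M1; split => // _ Y mY.
by have := mM measurableT Y mY; move/(@hist_sub _ _ _ _ _ _ iid).
Qed.

Lemma test_union (I : finType) (p : I -> R) (F : I -> vase_state R d -> R -> R)
    (T : nat) :
  (forall i, 0 <= p i) -> (forall i, test_factor (law P theta iid) (F i)) ->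
  exists E : set Om, [/\ measurable E, ((1 - \sum_i p i)%:E <= P E)%E &
    forall w, E w -> forall i, p i * test_mart (F i) T w < 1].
Proof.
move=> p0 tF.
pose W w := \sum_i p i * test_mart (F i) T w.
have mterm i : measurable_fun setT (fun w => p i * test_mart (F i) T w).
  by apply: measurable_funM => //; have [] := test_martP _ T (tF i).
have term0 i w : 0 <= p i * test_mart (F i) T w.
  by apply: mulr_ge0 => //; have [_ + _] := test_martP _ T (tF i); exact.
have mW : measurable_fun setT W by exact: measurable_sum.
have W0 w : 0 <= W w by exact: sumr_ge0.
pose E := [set w | W w < 1].
have mE : measurable E.
  rewrite /E -[X in measurable X]setTI.
  have := @measurable_fun_ltr _ Om R setT W (cst 1) mW (measurable_cst _).
  by move=> /(_ measurableT [set true] Logic.I); congr (measurable (_ `&` _)).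
exists E; split => //; last first.
  move=> w Ew i; apply: le_lt_trans Ew.
  by rewrite /W (bigD1 i)//= lerDl sumr_ge0.
have mEc := measurableC mE.
have PEc : (P (~` E) <= (\sum_i p i)%:E)%E.
  rewrite -(setIT (~` E)) -integral_indic//.
  apply: (@le_trans _ _ (\int[P]_w (W w)%:E)%E).
    apply: ge0_le_integral => //.
    - exact/measurable_EFinP/measurable_indic.
    - exact/measurable_EFinP.
    - move=> w _; rewrite lee_fin indicE; case: (boolP (_ \in _)) => //.
      by rewrite inE /E /= => /negP; rewrite -leNgt.
  under eq_integral do rewrite /W -sumEFin.
  rewrite ge0_integral_sum//; first last.
  - by move=> k w _; rewrite lee_fin.
  - by move=> k; exact/measurable_EFinP.
  rewrite -sumEFin; apply: lee_sum => k _.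
  have [mM M0 M1] := test_martP _ T (tF k).
  under eq_integral do rewrite EFinM.
  rewrite ge0_integralZl_EFin//; first last.
  - exact/measurable_EFinP.
  - by move=> w _; rewrite lee_fin.
  by rewrite -[leRHS]mule1 lee_wpmul2l// lee_fin p0.
rewrite -[E]setCK probability_setC// EFinB.
exact: leeB.
Qed.

End Union.

(** * Laplace transforms of rewards and variance samples *)

Section ExpBounds.
Context {R : realType}.

(* Tangent lines of exp at [lam z], evaluated at 0 and at [lam]. *)
Lemma expR_chord (lam z : R) : 0 <= z <= 1 ->
  expR (lam * z) <= 1 + (expR lam - 1) * z.
Proof.
move=> /andP[z0 z1].
have h0 : expR (lam * z) * (1 - lam * z) <= 1.
  have := expR_ge1Dx (- (lam * z)); rewrite expRN => h.
  by have := expR_gt0 (lam * z) => e0; rewrite mulrC -ler_pdivlMr// mul1r.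
have h1 : expR (lam * z) * (1 + (lam - lam * z)) <= expR lam.
  have := expR_ge1Dx (lam - lam * z).
  by rewrite -(ler_pM2l (expR_gt0 (lam * z))) -expRD (addrC (lam * z)) subrK.
have : expR (lam * z) * (1 - lam * z) * (1 - z) +
  expR (lam * z) * (1 + (lam - lam * z)) * z <= 1 * (1 - z) + expR lam * z.
  by apply: lerD; apply: ler_wpM2r => //; rewrite subr_ge0.
set e := expR (lam * z); set f := expR lam; lra.
Qed.

(** Squaring and inverting [1 - x / 2 <= expR (- (x / 2))] reduces the claim to a polynomial
    inequality: [(1 - x/2)^2 (1 + x + 2 x^2)] exceeds 1 by [x^2] times a quadratic that is positive
    on the given range. *)
Lemma expR_le_quad (x : R) : `|x| <= 1 / 2 -> expR x <= 1 + x + 2 * x ^+ 2.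
Proof.
move=> xh; have /andP[xl xr] : - (1/2) <= x <= 1/2 by rewrite -ler_norml.
have h : 1 - x / 2 <= expR (- (x / 2)) by have := expR_ge1Dx (- (x / 2)); lra.
have h0 : 0 < 1 - x / 2 by lra.
have e2 : expR x = (expR (- (x / 2)) ^+ 2)^-1.
  by rewrite -expRM_natl -expRN; congr expR; lra.
rewrite e2 -ler_pV2 ?invrK ?posrE; first last.
- have e0 : 0 < (expR (- (x / 2)) ^+ 2)^-1 by rewrite invr_gt0 exprn_gt0// expR_gt0.
  by rewrite inE unitfE gt_eqF.
- have q0 : 0 < 1 + x + 2 * x ^+ 2 by nra.
  by rewrite inE unitfE gt_eqF.
apply: (@le_trans _ _ ((1 - x / 2) ^+ 2)); last first.
  by rewrite ler_sqr// nnegrE ?expR_ge0// ltW.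
rewrite -[leLHS]mul1r ler_pdivrMr; last nra.
have -> : (1 - x / 2) ^+ 2 * (1 + x + 2 * x ^+ 2) =
  1 + x ^+ 2 * (5/4 - 7/4 * x + x ^+ 2 / 2) by field.
rewrite lerDl mulr_ge0 ?sqr_ge0//; nra.
Qed.

End ExpBounds.

Section Expectation.
Context {R : realType} {dT : measure_display} {T : measurableType dT}.
Variable nu : probability T R.

Definition bounded_meas (f : T -> R) : Prop :=
  measurable_fun setT f /\ exists C, forall v, `|f v| <= C.

Lemma bounded_measW (f : T -> R) (C : R) : measurable_fun setT f -> (forall v, `|f v| <= C) ->
  bounded_meas f.
Proof. by move=> mf fC; split => //; exists C. Qed.

Lemma bounded_meas_integrable f : bounded_meas f ->
  nu.-integrable setT (EFin \o f).
Proof.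
move=> [mf [C fC]]; apply: measurable_bounded_integrable => //.
  by apply: le_lt_trans (probability_le1 _ _) _ => //; rewrite ltry.
by exists C; split; [exact: num_real|move=> M CM v _; exact: le_trans (fC v) (ltW CM)].
Qed.

Lemma le_mean f g : bounded_meas f -> bounded_meas g ->
  (forall v, f v <= g v) -> \int[nu]_v f v <= \int[nu]_v g v.
Proof.
by move=> bf bg fg; apply: le_Rintegral => //; exact: bounded_meas_integrable.
Qed.

Lemma mean_cst (r : R) : \int[nu]_v r = r.
Proof.
rewrite Rintegral_cst//.
transitivity (r * fine 1%:E); last by rewrite mulr1.
by congr (_ * fine _); exact: probability_setT.
Qed.

Lemma mean_ge f C : bounded_meas f -> (forall v, C <= f v) -> C <= \int[nu]_v f v.
Proof.
move=> bf Cf; rewrite -[C]mean_cst; apply: le_mean => //.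
by apply: (bounded_measW _ `|C|).
Qed.

Lemma mean_le f C : bounded_meas f -> (forall v, f v <= C) -> \int[nu]_v f v <= C.
Proof.
move=> bf Cf; rewrite -[C]mean_cst; apply: le_mean => //.
by apply: (bounded_measW _ `|C|).
Qed.

Lemma mean_affine f A B : bounded_meas f ->
  \int[nu]_v (A + B * f v) = A + B * \int[nu]_v f v.
Proof.
move=> bf; have If := bounded_meas_integrable _ bf.
have bA : bounded_meas (fun=> A) by apply: (bounded_measW _ `|A|).
have IA := bounded_meas_integrable _ bA.
have bB : bounded_meas (fun v => B * f v).
  have [mf [C fC]] := bf; apply: (bounded_measW _ (`|B| * C)).
    exact: measurable_funM.
  by move=> v; rewrite normrM ler_wpM2l.
have IB := bounded_meas_integrable _ bB.
by rewrite RintegralD// mean_cst RintegralZl.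
Qed.

Lemma mean_quad f A B C : bounded_meas f ->
  \int[nu]_v (A + B * f v + C * f v ^+ 2) =
  A + B * \int[nu]_v f v + C * \int[nu]_v (f v ^+ 2).
Proof.
move=> bf.
have b2 : bounded_meas (fun v => f v ^+ 2).
  have [mf [c fc]] := bf; apply: (bounded_measW _ (c ^+ 2)).
    exact: measurable_funX.
  move=> v; rewrite normrX ler_sqr ?nnegrE//; exact: le_trans (fc v).
have bAB : bounded_meas (fun v => A + B * f v).
  have [mf [c fc]] := bf; apply: (bounded_measW _ (`|A| + `|B| * c)).
    by apply: measurable_funD => //; exact: measurable_funM.
  by move=> v; rewrite (le_trans (ler_normD _ _))// lerD2l normrM ler_wpM2l.
have bC : bounded_meas (fun v => C * f v ^+ 2).
  have [mf [c fc]] := b2; apply: (bounded_measW _ (`|C| * c)).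
    exact: measurable_funM.
  by move=> v; rewrite normrM ler_wpM2l.
rewrite RintegralD//; try exact: bounded_meas_integrable.
rewrite mean_affine// RintegralZl//; exact: bounded_meas_integrable.
Qed.

End Expectation.

Section ArmMoments.
Context {R : realType} {d : nat} (nu : probability (@vec R d) R).
Variable (a : 'rV[R]_d).

Local Notation Y v := (clip (dotv a v)).

Lemma clip_norm (x : R) : `|clip x| <= 1.
Proof.
rewrite /clip ler_norml le_max lexx/= ge_max ge_min lexx orTb andbT.
lra.
Qed.

Lemma clip_id (x : R) : `|x| <= 1 -> clip x = x.
Proof.
by rewrite ler_norml /clip => /andP[h1 h2]; rewrite (min_idPr h2) (max_idPr h1).
Qed.

Lemma bounded_arm : bounded_meas (fun v : @vec R d => Y v).
Proof.
apply: (bounded_measW _ 1); first exact: measurable_clip_dotv.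
by move=> v; exact: clip_norm.
Qed.

Variables (m s2 : R).
Hypothesis Ym : \int[nu]_v Y v = m.
Hypothesis Ys : \int[nu]_v (Y v ^+ 2) = s2 + m ^+ 2.

Lemma arm_mean_norm : `|m| <= 1.
Proof.
rewrite -Ym ler_norml; apply/andP; split.
  apply: mean_ge; first exact: bounded_arm.
  by move=> v; have := clip_norm (dotv a v); rewrite ler_norml => /andP[].
apply: mean_le; first exact: bounded_arm.
by move=> v; have := clip_norm (dotv a v); rewrite ler_norml => /andP[].
Qed.

Lemma bounded_exp_arm c : bounded_meas (fun v : @vec R d => expR (c * Y v)).
Proof.
apply: (bounded_measW _ (expR `|c|)).
  apply: (measurableT_comp (@measurable_expR R)).
  by apply: measurable_funM => //; exact: measurable_clip_dotv.
move=> v; rewrite ger0_norm ?expR_ge0// ler_expR.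
rewrite (le_trans (ler_norm _))// normrM -[leRHS]mulr1 ler_wpM2l//.
exact: clip_norm.
Qed.

Lemma lapX_gt0 c : 0 < lapX nu c a.
Proof.
apply: (@lt_le_trans _ _ (expR (- `|c|))); first exact: expR_gt0.
apply: (mean_ge nu (fun v : @vec R d => expR (c * Y v))); first exact: bounded_exp_arm.
move=> v; rewrite ler_expR.
have : `|c * Y v| <= `|c|.
  by rewrite normrM -[leRHS]mulr1 ler_wpM2l// clip_norm.
by rewrite ler_norml => /andP[].
Qed.

(** The quadratic bound is applied to the centred exponent [c * (Y - m)], of size at most [2 * |c|],
    hence the range 1/4. [A], [B], [C] are the coefficients of that bound as a polynomial in [Y],
    whose mean needs two moments only. *)
Lemma lapX_le c : `|c| <= 1 / 4 ->
  lapX nu c a <= expR (c * m + 2 * c ^+ 2 * s2).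
Proof.
move=> c4.
pose A := expR (c * m) * (1 - c * m + 2 * c ^+ 2 * m ^+ 2).
pose B := expR (c * m) * (c - 4 * c ^+ 2 * m).
pose C := expR (c * m) * (2 * c ^+ 2).
have b : bounded_meas (fun v : @vec R d => A + B * Y v + C * Y v ^+ 2).
  apply: (bounded_measW _ (`|A| + `|B| + `|C|)).
    apply: measurable_funD; last first.
      by apply: measurable_funM => //; apply: measurable_funX; exact: measurable_clip_dotv.
    by apply: measurable_funD => //; apply: measurable_funM => //; exact: measurable_clip_dotv.
  move=> v; have h := clip_norm (dotv a v).
  rewrite (le_trans (ler_normD _ _))// lerD//; last first.
    by rewrite normrM -[leRHS]mulr1 ler_wpM2l// normrX expr_le1.
  rewrite (le_trans (ler_normD _ _))// lerD//.
  by rewrite normrM -[leRHS]mulr1 ler_wpM2l.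
apply: (@le_trans _ _ (\int[nu]_v (A + B * Y v + C * Y v ^+ 2))).
  apply: (le_mean nu _ _ (bounded_exp_arm c)) => // v.
  have -> : A + B * Y v + C * Y v ^+ 2 =
    expR (c * m) * (1 + c * (Y v - m) + 2 * (c * (Y v - m)) ^+ 2).
    by rewrite /A /B /C; ring.
  have -> : c * Y v = c * m + c * (Y v - m) by ring.
  rewrite expRD ler_wpM2l ?expR_ge0//; apply: expR_le_quad.
  rewrite normrM (_ : 1 / 2 = 1 / 4 * 2); last by field.
  apply: ler_pM => //.
  rewrite (le_trans (ler_normB _ _))// (_ : 2 = 1 + 1)// lerD//.
    exact: clip_norm.
  exact: arm_mean_norm.
rewrite mean_quad ?Ym ?Ys; last exact: bounded_arm.
have -> : A + B * m + C * (s2 + m ^+ 2) = expR (c * m) * (1 + 2 * c ^+ 2 * s2).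
  by rewrite /A /B /C; ring.
by rewrite expRD ler_wpM2l ?expR_ge0// expR_ge1Dx.
Qed.

Variable l : nat.

Lemma eps_gt0 : 0 < eps_l R l.
Proof. by rewrite invr_gt0 exprn_gt0. Qed.

Lemma eps_le1 : eps_l R l <= 1.
Proof. by rewrite invf_le1 ?exprn_gt0// exprn_ege1// ler1n. Qed.

Lemma Zsamp_bound x0 x : `|x0| <= 1 -> `|x| <= 1 ->
  eps_l R l / 2 <= Zsamp l x0 x <= 1.
Proof.
move=> h0 h1; rewrite /Zsamp le_max lexx orbT/= ge_max.
have e1 := eps_le1; apply/andP; split; last lra.
have : `|x0 - x| <= 2.
  by rewrite (le_trans (ler_normB _ _))// (_ : 2 = 1 + 1)// lerD.
move=> h2; have : `|x0 - x| ^+ 2 <= 2 ^+ 2 by rewrite ler_sqr ?nnegrE.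
by rewrite real_normK ?num_real//; lra.
Qed.

Definition psiZ (x0 : R) : R := \int[nu]_v Zsamp l x0 (Y v).
Definition muZ : R := \int[nu]_v psiZ (Y v).

Lemma bounded_Z x0 : `|x0| <= 1 -> bounded_meas (fun v : @vec R d => Zsamp l x0 (Y v)).
Proof.
move=> h; apply: (bounded_measW _ 1).
  by apply: measurable_Zsamp => //; exact: measurable_clip_dotv.
move=> v; have /andP[h0 h1] := Zsamp_bound _ _ h (clip_norm (dotv a v)).
rewrite ger0_norm//; apply: le_trans h0; rewrite divr_ge0// ltW//; exact: eps_gt0.
Qed.

Lemma psiZ_bound x0 : `|x0| <= 1 -> eps_l R l / 2 <= psiZ x0 <= 1.
Proof.
move=> h; have hZ v := Zsamp_bound _ _ h (clip_norm (dotv a v)).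
apply/andP; split.
  by apply: mean_ge; [exact: bounded_Z|move=> v; have /andP[] := hZ v].
by apply: mean_le; [exact: bounded_Z|move=> v; have /andP[] := hZ v].
Qed.

Lemma measurable_psiZ : measurable_fun setT psiZ.
Proof.
apply: (measurableT_comp (@fine_measurable R setT measurableT)).
apply: (@measurable_fun_fubini_tonelli_F _ _ R vec R nu
  (fun z : R * vec => (Zsamp l z.1 (clip (dotv a z.2)))%:E)).
- apply/measurable_EFinP; apply: measurable_Zsamp => //.
  exact: (measurableT_comp (measurable_clip_dotv a)).
- move=> z; rewrite lee_fin /Zsamp le_max; apply/orP; right.
  by rewrite divr_ge0// ltW// eps_gt0.
Qed.

Lemma bounded_psiZ : bounded_meas (fun v : @vec R d => psiZ (Y v)).
Proof.
apply: (bounded_measW _ 1).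
  by apply: (measurableT_comp measurable_psiZ); exact: measurable_clip_dotv.
move=> v; have /andP[h0 h1] := psiZ_bound _ (clip_norm (dotv a v)).
rewrite ger0_norm//; apply: le_trans h0; rewrite divr_ge0// ltW//; exact: eps_gt0.
Qed.

Lemma muZ_ge_eps : eps_l R l / 2 <= muZ.
Proof.
apply: mean_ge; first exact: bounded_psiZ.
by move=> v; have /andP[] := psiZ_bound _ (clip_norm (dotv a v)).
Qed.

(** The square [(x0 - Y)^2 / 4 + e], averaged over the second reward, is again quadratic in the
    first, so [mean_quad] applies twice and gives [s2 / 2 + e]. The value [e = 0] serves the lower
    bound on [muZ], half the threshold the upper one, a maximum being at most the sum. *)
Lemma psi_quad (x0 e : R) :
  \int[nu]_v ((x0 ^+ 2 / 4 + e) + (- x0 / 2) * Y v + 4^-1 * Y v ^+ 2) =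
  (((s2 + m ^+ 2) / 4 + e) + (- m / 2) * x0 + 4^-1 * x0 ^+ 2).
Proof. by rewrite mean_quad ?Ym ?Ys; [field|exact: bounded_arm]. Qed.

Lemma bounded_quad A B C : bounded_meas (fun v : @vec R d => A + B * Y v + C * Y v ^+ 2).
Proof.
apply: (bounded_measW _ (`|A| + `|B| + `|C|)).
  apply: measurable_funD; last first.
    by apply: measurable_funM => //; apply: measurable_funX; exact: measurable_clip_dotv.
  by apply: measurable_funD => //; apply: measurable_funM => //; exact: measurable_clip_dotv.
move=> v; have h := clip_norm (dotv a v).
rewrite (le_trans (ler_normD _ _))// lerD//; last first.
  by rewrite normrM -[leRHS]mulr1 ler_wpM2l// normrX expr_le1.
rewrite (le_trans (ler_normD _ _))// lerD//.
by rewrite normrM -[leRHS]mulr1 ler_wpM2l.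
Qed.

Lemma muZ_ge_var : s2 / 2 <= muZ.
Proof.
have -> : s2 / 2 = \int[nu]_v (((s2 + m ^+ 2) / 4 + 0) + (- m / 2) * Y v + 4^-1 * Y v ^+ 2).
  by rewrite mean_quad ?Ym ?Ys; [field|exact: bounded_arm].
apply: le_mean; [exact: bounded_quad|exact: bounded_psiZ|move=> v].
rewrite -psi_quad; apply: le_mean; [exact: bounded_quad|exact/bounded_Z/clip_norm|].
move=> u; rewrite /Zsamp le_max; apply/orP; left.
by rewrite le_eqVlt; apply/orP; left; apply/eqP; field.
Qed.

Lemma muZ_le : muZ <= s2 / 2 + eps_l R l / 2.
Proof.
have -> : s2 / 2 + eps_l R l / 2 = \int[nu]_v
    (((s2 + m ^+ 2) / 4 + eps_l R l / 2) + (- m / 2) * Y v + 4^-1 * Y v ^+ 2).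
  by rewrite mean_quad ?Ym ?Ys; [field|exact: bounded_arm].
apply: le_mean; [exact: bounded_psiZ|exact: bounded_quad|move=> v].
rewrite -psi_quad; apply: le_mean; [exact/bounded_Z/clip_norm|exact: bounded_quad|].
move=> u.
have e0 := eps_gt0.
have -> : (clip (dotv a v) ^+ 2 / 4 + eps_l R l / 2 + - clip (dotv a v) / 2 * clip (dotv a u) +
   4^-1 * clip (dotv a u) ^+ 2) = (clip (dotv a v) - clip (dotv a u)) ^+ 2 / 4 + eps_l R l / 2.
  by field.
rewrite /Zsamp ge_max; apply/andP; split; first by rewrite lerDl; lra.
by rewrite lerDr divr_ge0// sqr_ge0.
Qed.

Lemma expZ_bound (lam x0 x : R) : `|x0| <= 1 -> `|x| <= 1 ->
  expR (- `|lam|) <= expR (lam * Zsamp l x0 x) <= expR `|lam|.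
Proof.
move=> h0 h1; have /andP[z0 z1] := Zsamp_bound _ _ h0 h1.
have e0 := eps_gt0.
rewrite !ler_expR -ler_norml normrM -[leRHS]mulr1 ler_wpM2l//.
by rewrite ger0_norm//; lra.
Qed.

Lemma bounded_expZ lam x0 : `|x0| <= 1 ->
  bounded_meas (fun v : @vec R d => expR (lam * Zsamp l x0 (Y v))).
Proof.
move=> h; apply: (bounded_measW _ (expR `|lam|)).
  apply: (measurableT_comp (@measurable_expR R)); apply: measurable_funM => //.
  by apply: measurable_Zsamp => //; exact: measurable_clip_dotv.
move=> v; rewrite ger0_norm ?expR_ge0//.
by have /andP[] := expZ_bound lam _ _ h (clip_norm (dotv a v)).
Qed.

Lemma phiZ_bound lam x0 : `|x0| <= 1 ->
  expR (- `|lam|) <= phiZ nu lam l a x0 <= expR `|lam|.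
Proof.
move=> h; apply/andP; split.
  apply: (mean_ge nu (fun v : @vec R d => expR (lam * Zsamp l x0 (Y v)))).
    exact: bounded_expZ.
  by move=> v; have /andP[] := expZ_bound lam _ _ h (clip_norm (dotv a v)).
apply: (mean_le nu (fun v : @vec R d => expR (lam * Zsamp l x0 (Y v)))).
  exact: bounded_expZ.
by move=> v; have /andP[] := expZ_bound lam _ _ h (clip_norm (dotv a v)).
Qed.

Lemma phiZ_gt0 lam x0 : `|x0| <= 1 -> 0 < phiZ nu lam l a x0.
Proof.
by move=> /(phiZ_bound lam)/andP[+ _]; apply: lt_le_trans; exact: expR_gt0.
Qed.

Lemma bounded_phiZ lam : bounded_meas (fun v : @vec R d => phiZ nu lam l a (Y v)).
Proof.
apply: (bounded_measW _ (expR `|lam|)).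
  apply: (measurableT_comp (measurable_phiZ nu lam l a)).
  exact: measurable_clip_dotv.
move=> v; rewrite ger0_norm ?phiZ_ge0//.
by have /andP[] := phiZ_bound lam _ (clip_norm (dotv a v)).
Qed.

Lemma lapZ_gt0 lam : 0 < lapZ nu lam l a.
Proof.
apply: (@lt_le_trans _ _ (expR (- `|lam|))); first exact: expR_gt0.
apply: (mean_ge nu (fun v : @vec R d => phiZ nu lam l a (Y v))); first exact: bounded_phiZ.
by move=> v; have /andP[] := phiZ_bound lam _ (clip_norm (dotv a v)).
Qed.

(** Samples lie in [0, 1], where the chord bounds the exponential by an affine function; this passes
    through both successive averages and only the mean [muZ] survives. *)
Lemma lapZ_le lam : lapZ nu lam l a <= expR ((expR lam - 1) * muZ).
Proof.
have e0 := eps_gt0.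
apply: (@le_trans _ _ (1 + (expR lam - 1) * muZ)); last exact: expR_ge1Dx.
rewrite /muZ -mean_affine; last exact: bounded_psiZ.
have bpsi A B : bounded_meas (fun v : @vec R d => A + B * psiZ (Y v)).
  have [mf [c fc]] := bounded_psiZ; apply: (bounded_measW _ (`|A| + `|B| * c)).
    by apply: measurable_funD => //; exact: measurable_funM.
  by move=> v; rewrite (le_trans (ler_normD _ _))// lerD2l normrM ler_wpM2l.
apply: (le_mean nu (fun v : @vec R d => phiZ nu lam l a (Y v))); [exact: bounded_phiZ|exact: bpsi|].
move=> v /=; rewrite /psiZ -mean_affine; last exact/bounded_Z/clip_norm.
have bZ A B : bounded_meas (fun u : @vec R d => A + B * Zsamp l (Y v) (Y u)).
  have [mf [c fc]] := bounded_Z _ (clip_norm (dotv a v)).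
  apply: (bounded_measW _ (`|A| + `|B| * c)).
    by apply: measurable_funD => //; exact: measurable_funM.
  by move=> u; rewrite (le_trans (ler_normD _ _))// lerD2l normrM ler_wpM2l.
apply: (le_mean nu (fun u : @vec R d => expR (lam * Zsamp l (Y v) (Y u)))).
- exact/bounded_expZ/clip_norm.
- exact: bZ.
- move=> u; apply: expR_chord.
  have /andP[h0 h1] := Zsamp_bound _ _ (clip_norm (dotv a v)) (clip_norm (dotv a u)).
  by rewrite h1 andbT; lra.
Qed.

(** For a sample that the horizon cuts after its first play: the pending ratio of [phiZ] to [lapZ]
    then has a lower bound. *)
Lemma lapZ_neg_le1 : lapZ nu (-1) l a <= 1.
Proof.
have e0 := eps_gt0.
apply: (mean_le nu (fun v : @vec R d => phiZ nu (-1) l a (Y v))); first exact: bounded_phiZ.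
move=> v; apply: (mean_le nu (fun u : @vec R d => expR (-1 * Zsamp l (Y v) (Y u)))).
  exact/bounded_expZ/clip_norm.
move=> u; rewrite expR_le1 mulN1r oppr_le0.
have /andP[h0 h1] := Zsamp_bound _ _ (clip_norm (dotv a v)) (clip_norm (dotv a u)).
lra.
Qed.

End ArmMoments.

(** * Positive semidefinite forms and covariance *)

Section Dotv.
Context {R : realType} {d : nat}.
Implicit Types u v w : 'rV[R]_d.

Lemma dotvE u v : dotv u v = (u *m v^T) ord0 ord0.
Proof. by rewrite mxE; apply: eq_bigr => i _; rewrite mxE. Qed.

Lemma dotvC u v : dotv u v = dotv v u.
Proof. by apply: eq_bigr => i _; rewrite mulrC. Qed.

Lemma dotvDl u v w : dotv (u + v) w = dotv u w + dotv v w.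
Proof. by rewrite !dotvE mulmxDl mxE. Qed.

Lemma dotvBl u v w : dotv (u - v) w = dotv u w - dotv v w.
Proof. by rewrite !dotvE mulmxBl !mxE. Qed.

Lemma dotvDr u v w : dotv u (v + w) = dotv u v + dotv u w.
Proof. by rewrite dotvC dotvDl !(dotvC u). Qed.

Lemma dotvZl c u v : dotv (c *: u) v = c * dotv u v.
Proof. by rewrite !dotvE -scalemxAl mxE. Qed.

Lemma dotvZr c u v : dotv u (c *: v) = c * dotv u v.
Proof. by rewrite dotvC dotvZl dotvC. Qed.

Lemma dotv0l v : dotv 0 v = 0.
Proof. by rewrite dotvE mul0mx mxE. Qed.

Lemma dotv0r v : dotv v 0 = 0.
Proof. by rewrite dotvC dotv0l. Qed.

Lemma dotv_mull u v (M : 'M[R]_d) : dotv (u *m M) v = dotv u (v *m M^T).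
Proof. by rewrite !dotvE trmx_mul trmxK mulmxA. Qed.

Lemma dotv_rank1 u v w : dotv (u *m (w^T *m w)) v = dotv u w * dotv w v.
Proof.
by rewrite !dotvE mulmxA -mulmxA (mx11_scalar (u *m w^T)) mul_scalar_mx mxE [in RHS]mxE eqxx.
Qed.

Definition psd (M : 'M[R]_d) := M^T = M /\ forall u, 0 <= dotv (u *m M) u.

Lemma qformE M u : qform M u = dotv (u *m M) u.
Proof. by rewrite dotvE. Qed.

(* The discriminant of the nonnegative quadratic [t |-> M(u + t v)]. *)
Lemma psd_cauchy M u v : psd M ->
  dotv (u *m M) v ^+ 2 <= dotv (u *m M) u * dotv (v *m M) v.
Proof.
move=> [Ms M0].
pose a := dotv (u *m M) u; pose b := dotv (u *m M) v; pose c := dotv (v *m M) v.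
have bE : dotv (v *m M) u = b by rewrite dotv_mull Ms dotvC.
have key s t : 0 <= s ^+ 2 * a + 2 * (s * t) * b + t ^+ 2 * c.
  have := M0 (s *: u + t *: v).
  rewrite mulmxDl -!scalemxAl !(dotvDl, dotvDr, dotvZl, dotvZr) bE -/a -/b -/c.
  by congr (_ <= _); ring.
rewrite -/a -/b -/c.
have c0 : 0 <= c := M0 v.
have a0 : 0 <= a := M0 u.
have [cp|] := ltP 0 c.
  have := key c (- b).
  have -> : c ^+ 2 * a + 2 * (c * - b) * b + (- b) ^+ 2 * c = c * (a * c - b ^+ 2) by ring.
  by rewrite pmulr_rge0// subr_ge0.
move=> cn; have cz : c = 0 by apply/eqP; rewrite eq_le cn.
have [ap|an] := ltP 0 a.
  have := key (- b) a.
  rewrite cz; have -> : (- b) ^+ 2 * a + 2 * (- b * a) * b + a ^+ 2 * 0 = - (a * b ^+ 2) by ring.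
  by rewrite oppr_ge0 pmulr_rle0// mulr0.
have az : a = 0 by apply/eqP; rewrite eq_le an.
have h1 := key 1 1; have h2 := key 1 (- 1).
move: h1 h2; rewrite az cz => h1 h2.
have -> : b = 0 by lra.
by rewrite expr0n/= mulr0.
Qed.

Lemma psd1 : psd 1%:M.
Proof.
split; first exact: trmx1.
by move=> u; rewrite mulmx1; apply: sumr_ge0 => i _; rewrite -expr2 sqr_ge0.
Qed.

Lemma dotv_cauchy u v : dotv u v ^+ 2 <= sqnorm u * sqnorm v.
Proof. by have := psd_cauchy _ u v psd1; rewrite !mulmx1. Qed.

End Dotv.

(** * Mean and covariance of the parameter *)

Section Moments.
Context {R : realType} {dd : measure_display} {Om : measurableType dd}.
Context (P : probability Om R) {d : nat} (theta : nat -> Om -> 'rV[R]_d).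
Hypothesis iid : iid_vectors P theta.
Local Notation th := (mean_vec P (theta 0%N)).
Local Notation Sig := (cov_mx P (theta 0%N)).
Hypothesis int1 : forall i, P.-integrable setT (fun w => (theta 0%N w ord0 i)%:E).
Hypothesis int2 : forall i, P.-integrable setT (fun w => ((theta 0%N w ord0 i) ^+ 2)%:E).

Local Notation I f := (P.-integrable setT (EFin \o f)).

Lemma Rintegral_sum (J : Type) (s : seq J) (f : J -> Om -> R) :
  (forall j, I (f j)) ->
  I (fun w => \sum_(j <- s) f j w) /\
  \int[P]_w (\sum_(j <- s) f j w) = \sum_(j <- s) \int[P]_w f j w.
Proof.
move=> If; elim: s => [|j s [IH1 IH2]].
  split.
    rewrite (_ : (fun w => _) = fun=> 0); last by apply/funext => w; rewrite big_nil.
    exact: integrable0.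
  under eq_Rintegral do rewrite big_nil.
  by rewrite big_nil Rintegral_cst// mul0r.
split.
  have := integrableD measurableT (If j) IH1; apply: eq_integrable => //.
  by move=> w _; rewrite /= big_cons EFinD.
under eq_Rintegral do rewrite big_cons.
by rewrite RintegralD// IH2 big_cons.
Qed.

Lemma integrable_scale c f : I f -> I (fun w => c * f w).
Proof. by move=> If; have := integrableZl measurableT c If; apply: eq_integrable. Qed.

Lemma integrable_add f g : I f -> I g -> I (fun w => f w + g w).
Proof. by move=> If Ig; have := integrableD measurableT If Ig; apply: eq_integrable. Qed.

Lemma integrable_const c : I (fun=> c).
Proof. exact: finite_measure_integrable_cst. Qed.

Let xi i w := theta 0%N w ord0 i - th ord0 i.

Lemma xiE w i : (theta 0%N w - th) ord0 i = xi i w.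
Proof. by rewrite /xi !mxE. Qed.

Lemma integrable_xi i : I (xi i).
Proof. apply: integrable_add; [exact: int1|exact: integrable_const]. Qed.

Lemma integrable_xi2 i : I (fun w => xi i w ^+ 2).
Proof.
pose c := th ord0 i.
have -> : (fun w => xi i w ^+ 2) = (fun w => theta 0%N w ord0 i ^+ 2 +
    ((-2 * c) * theta 0%N w ord0 i + c ^+ 2)).
  by apply/funext => w; rewrite /xi -/c; ring.
apply: integrable_add; first exact: int2.
by apply: integrable_add; [exact/integrable_scale/int1|exact: integrable_const].
Qed.

Lemma measurable_xi i : measurable_fun setT (xi i).
Proof. by have /measurable_int/measurable_EFinP := integrable_xi i. Qed.

Lemma integrable_xiM i j : I (fun w => xi i w * xi j w).
Proof.
apply: (@le_integrable _ _ _ P setT measurableT _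
    (EFin \o (fun w => xi i w ^+ 2 + xi j w ^+ 2))).
- by apply/measurable_EFinP/measurable_funM; exact: measurable_xi.
- move=> w _ /=; rewrite lee_fin.
  rewrite [leRHS]ger0_norm; last by rewrite addr_ge0 ?sqr_ge0.
  by rewrite ler_norml; apply/andP; split; nra.
- by apply: integrable_add; exact: integrable_xi2.
Qed.

Lemma cov_mxE i j : Sig i j = \int[P]_w (xi i w * xi j w).
Proof. by rewrite mxE. Qed.

Lemma qform_cov a :
  I (fun w => dotv a (theta 0%N w - th) ^+ 2) /\
  qform Sig a = \int[P]_w (dotv a (theta 0%N w - th) ^+ 2).
Proof.
have E w : dotv a (theta 0%N w - th) ^+ 2 =
    \sum_(i < d) \sum_(j < d) a ord0 i * a ord0 j * (xi i w * xi j w).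
  rewrite expr2 /dotv mulr_suml; apply: eq_bigr => i _.
  rewrite mulr_sumr; apply: eq_bigr => j _; rewrite !xiE; ring.
have Iij i j : I (fun w => a ord0 i * a ord0 j * (xi i w * xi j w)).
  by apply: integrable_scale; exact: integrable_xiM.
have Ii i := Rintegral_sum _ (index_enum 'I_d) _ (Iij i).
have [h1 h2] := Rintegral_sum _ (index_enum 'I_d) _ (fun i => (Ii i).1).
split.
  by apply: eq_integrable h1 => // w _; rewrite /= E.
under eq_Rintegral do rewrite E.
rewrite h2 qformE /dotv.
under [RHS]eq_bigr do rewrite (Ii _).2.
rewrite exchange_big/=; apply: eq_bigr => j _.
rewrite mxE mulr_suml; apply: eq_bigr => i _.
rewrite RintegralZl//; last exact: integrable_xiM.
rewrite cov_mxE.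
ring.
Qed.

Lemma qform_cov_ge0 a : 0 <= qform Sig a.
Proof.
by rewrite (qform_cov a).2; apply: Rintegral_ge0 => w _; exact: sqr_ge0.
Qed.

(** Pointwise Cauchy-Schwarz bounds the squared projection by [sqnorm a] times the squared length of
    the centred parameter, whose mean is the trace. This yields the second term of the minimum in
    [M_sigma]. *)
Lemma qform_cov_le a : qform Sig a <= sqnorm a * \tr Sig.
Proof.
have [I1 ->] := qform_cov a.
have [I2 E2] := Rintegral_sum _ (index_enum 'I_d) _ integrable_xi2.
have -> : \tr Sig = \int[P]_w (\sum_(i < d) xi i w ^+ 2).
  by rewrite E2; apply: eq_bigr => i _; rewrite cov_mxE; under eq_Rintegral do rewrite -expr2.
rewrite -RintegralZl//; apply: le_Rintegral => //; first exact: integrable_scale.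
move=> w _; apply: le_trans (dotv_cauchy _ _) _.
rewrite le_eqVlt; apply/orP; left; apply/eqP; congr (_ * _).
by apply: eq_bigr => i _; rewrite xiE -expr2.
Qed.

Lemma mean_dotv a : I (fun w => dotv a (theta 0%N w)) /\
  \int[P]_w dotv a (theta 0%N w) = dotv a th.
Proof.
have Ii i : I (fun w => a ord0 i * theta 0%N w ord0 i).
  by apply: integrable_scale; exact: int1.
have [h1 h2] := Rintegral_sum _ (index_enum 'I_d) _ Ii.
split; first exact: h1.
rewrite h2; apply: eq_bigr => i _.
by rewrite RintegralZl//; [rewrite mxE|exact: int1].
Qed.

Variable a : 'rV[R]_d.
Hypothesis bnd : {ae P, forall w, `|dotv a (theta 0%N w)| <= 1}.

Lemma law_integral (g : @vec R d -> R) : bounded_meas g ->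
  \int[law P theta iid]_v g v = \int[P]_w g (theta 0%N w).
Proof.
move=> [mg [C gC]]; rewrite /Rintegral; congr fine.
apply: (@integral_distribution _ _ _ vec R P (theta_mf P theta iid 0) (EFin \o g)).
  exact/measurable_EFinP.
apply: bounded_meas_integrable.
apply: (bounded_measW _ C) => //.
apply: (measurableT_comp mg); exact: measurable_theta iid 0%N.
Qed.

Lemma ae_Rintegral (f g : Om -> R) : I f -> I g ->
  {ae P, forall w, f w = g w} -> \int[P]_w f w = \int[P]_w g w.
Proof.
move=> If Ig fg; rewrite /Rintegral; congr fine.
apply: ae_eq_integral => //.
- exact: measurable_int If.
- exact: measurable_int Ig.
- by apply: filterS fg => w /= -> _.
Qed.

Lemma bounded_arm0 : bounded_meas (fun w => clip (dotv a (theta 0%N w))).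
Proof.
apply: (bounded_measW _ 1); last by move=> w; exact: clip_norm.
apply: (measurableT_comp (measurable_clip_dotv a)).
exact: measurable_theta iid 0%N.
Qed.

Lemma arm_mean :
  \int[law P theta iid]_v clip (dotv a v) = dotv a th.
Proof.
rewrite law_integral; last exact: bounded_arm.
rewrite -(mean_dotv a).2; apply: ae_Rintegral.
- exact/bounded_meas_integrable/bounded_arm0.
- exact: (mean_dotv a).1.
- by apply: filterS bnd => w; exact: clip_id.
Qed.

Lemma arm_sq :
  \int[law P theta iid]_v (clip (dotv a v) ^+ 2) = qform Sig a + dotv a th ^+ 2.
Proof.
set m := dotv a th.
have bsq : bounded_meas (fun w => clip (dotv a (theta 0%N w)) ^+ 2).
  apply: (bounded_measW _ 1); first by apply: measurable_funX; have [] := bounded_arm0.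
  by move=> w; rewrite normrX expr_le1// clip_norm.
have bsq' : bounded_meas (fun v : @vec R d => clip (dotv a v) ^+ 2).
  apply: (bounded_measW _ 1); first by apply: measurable_funX; exact: measurable_clip_dotv.
  by move=> w; rewrite normrX expr_le1// clip_norm.
rewrite law_integral//.
have [I1 ->] := qform_cov a.
have [I0 E0] := mean_dotv a.
have I2 : I (fun w => (2 * m) * dotv a (theta 0%N w)) by exact: integrable_scale.
have Im : I (fun=> - m ^+ 2) by exact: integrable_const.
transitivity (\int[P]_w (dotv a (theta 0%N w - th) ^+ 2 +
   ((2 * m) * dotv a (theta 0%N w) + - m ^+ 2))).
  apply: ae_Rintegral.
  - exact: bounded_meas_integrable.
  - by apply: integrable_add => //; exact: integrable_add.
  - apply: filterS bnd => w h; rewrite clip_id//.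
    rewrite (dotvC a (_ - _)) dotvBl -!(dotvC a) -/m; ring.
rewrite RintegralD//; last exact: integrable_add.
rewrite RintegralD// RintegralZl// E0 -/m mean_cst; ring.
Qed.

End Moments.

(** * G-optimal designs *)

Section DetLemma.
Context {F : fieldType}.

(** The matrix determinant lemma: a bordered matrix factors into block triangular matrices in two
    ways, and the determinants are compared. *)
Lemma det_add_rank1 n (u : 'cV[F]_n) (v : 'rV[F]_n) :
  \det (1%:M + u *m v) = 1 + (v *m u) ord0 ord0.
Proof.
have e1 : block_mx 1%:M 0 u 1%:M *m block_mx 1%:M (- v) 0 (1%:M + u *m v) =
    block_mx (1%:M : 'M[F]_1) (- v) u 1%:M.
  by rewrite mulmx_block !mul1mx !mul0mx !mulmx1 !addr0 mulmxN addrC addrK.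
have e2 : block_mx 1%:M (- v) 0 1%:M *m block_mx (1%:M + v *m u) 0 u 1%:M =
    block_mx (1%:M : 'M[F]_1) (- v) u 1%:M.
  by rewrite mulmx_block !mul1mx !mul0mx !mulmx1 !add0r mulNmx addrK.
have := congr1 determinant e1; rewrite -e2 !det_mulmx !det_lblock !det_ublock !det1 !mul1r !mulr1.
by move=> ->; rewrite det_mx11 mxE mxE eqxx.
Qed.

End DetLemma.

Section RankOneSums.
Context {R : realType} {n : nat} {I : eqType}.
Variables (s : seq I) (c : I -> 'rV[R]_n) (p : I -> R).
Hypothesis p0 : forall i, i \in s -> 0 <= p i.
Let W := \sum_(i <- s) p i *: ((c i)^T *m c i).

Lemma rank1_sum_mul u v :
  dotv (u *m W) v = \sum_(i <- s) p i * (dotv u (c i) * dotv (c i) v).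
Proof.
rewrite /W; elim: s => [|i t IH]; first by rewrite !big_nil mulmx0 dotv0l.
by rewrite !big_cons mulmxDr dotvDl IH -scalemxAr dotvZl dotv_rank1.
Qed.

Lemma psd_rank1_sum : psd W.
Proof.
split.
  rewrite /W linear_sum; apply: eq_bigr => i _ /=.
  by rewrite linearZ/= trmx_mul trmxK.
move=> u; rewrite rank1_sum_mul big_seq; apply: sumr_ge0 => i si.
by rewrite mulr_ge0 ?p0// (dotvC (c i)) -expr2 sqr_ge0.
Qed.

End RankOneSums.

(** [pinvmx] is merely a generalised inverse and need not be symmetric. For symmetric [V] the value
    can be read off any preimage [x] of [a]. *)
Lemma qform_pinv {R : realType} {d : nat} (V : 'M[R]_d) (a x : 'rV[R]_d) :
  V^T = V -> a = x *m V -> qform (pinvmx V) a = dotv a x.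
Proof.
move=> Vs aE; rewrite qformE.
have aV : (a <= V)%MS by rewrite aE submxMl.
rewrite [X in dotv _ X]aE -[in X in dotv _ X]Vs -dotv_mull.
by rewrite mulmxKpV.
Qed.

Section KieferWolfowitz.
Context {R : realType} {d : nat}.
Variable B : seq 'rV[R]_d.
Hypothesis B0 : B != [::].
Hypothesis d0 : (0 < d)%N.

Let U := undup B.
Let n := size U.
Let BM : 'M[R]_(n, d) := \matrix_(i < n) nth 0 U i.
Let r := \rank BM.
Let F := row_base BM.
Let c (a : 'rV[R]_d) : 'rV[R]_r := a *m pinvmx F.
(** Coordinates [c a] on a basis [F] of the span of [B] make the information matrix square of size
    [r], invertible for some design even when [B] does not span the whole space. Its determinant is
    the criterion of D-optimality. *)
Let W (p : 'rV[R]_d -> R) : 'M[R]_r := \sum_(a <- U) p a *: ((c a)^T *m c a).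

Lemma coordK a : a \in B -> c a *m F = a.
Proof.
rewrite -mem_undup => aU; apply: mulmxKpV; rewrite eq_row_base.
have ai : (index a U < n)%N by rewrite index_mem.
have -> : a = row (Ordinal ai) BM by rewrite rowK nth_index.
exact: row_sub.
Qed.

Lemma VdesignE p : Vdesign B p = F^T *m W p *m F.
Proof.
rewrite /Vdesign /W mulmx_sumr mulmx_suml; apply: eq_big_seq => a.
rewrite mem_undup => aB.
transitivity (p a *: ((c a *m F)^T *m (c a *m F))); first by rewrite coordK.
by rewrite -scalemxAr -scalemxAl trmx_mul !mulmxA.
Qed.

Lemma W_sym p : (W p)^T = W p.
Proof.
rewrite /W linear_sum; apply: eq_bigr => i _ /=.
by rewrite linearZ/= trmx_mul trmxK.
Qed.

Lemma cover_qform p a : W p \in unitmx -> a \in B ->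
  (a <= Vdesign B p)%MS /\
  qform (pinvmx (Vdesign B p)) a = dotv (c a *m invmx (W p)) (c a).
Proof.
move=> uW aB.
pose x := c a *m invmx (W p) *m pinvmx F^T.
have xF : x *m F^T = c a *m invmx (W p).
  rewrite /x mulmxKpV//; apply: submx_full.
  by rewrite /row_full mxrank_tr; exact: row_base_free.
have aE : a = x *m Vdesign B p.
  by rewrite VdesignE 2!(mulmxA x) xF mulmxKV// coordK.
have Vs : (Vdesign B p)^T = Vdesign B p.
  by rewrite VdesignE trmx_mul (trmx_mul F^T) trmxK W_sym mulmxA.
split; first by rewrite aE submxMl.
rewrite (qform_pinv _ _ _ Vs aE) -[in LHS](coordK a aB).
by rewrite dotvE -mulmxA -[F *m x^T]trmxK trmx_mul trmxK xF -dotvE dotvC.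
Qed.

(** Entries of [W p] are averages of products of coordinates, hence bounded uniformly in [p], and
    the Leibniz formula bounds the determinant. It makes the supremum of determinants finite. *)
Lemma det_bounded : exists C, forall p, is_design B p -> `|\det (W p)| <= C.
Proof.
pose k : R := 1 + \sum_(a <- U) \sum_i \sum_j `|c a ord0 i * c a ord0 j|.
have inner0 a : 0 <= \sum_i \sum_j `|c a ord0 i * c a ord0 j|.
  by apply: sumr_ge0 => i _; apply: sumr_ge0 => j _.
exists (\sum_(s : {perm 'I_r}) k ^+ r) => p [p0 p1].
have Wk i j : `|W p i j| <= k.
  have -> : W p i j = \sum_(a <- U) p a * (c a ord0 i * c a ord0 j).
    rewrite /W summxE; apply: eq_bigr => a _.
    by rewrite !mxE big_ord1 !mxE.
  apply: (le_trans (ler_norm_sum _ _ _)).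
  apply: (@le_trans _ _ (\sum_(a <- U) \sum_i \sum_j `|c a ord0 i * c a ord0 j|)); last by rewrite /k lerDr.
  rewrite big_seq [leRHS]big_seq; apply: ler_sum => a aU.
  rewrite normrM.
  apply: (@le_trans _ _ `|c a ord0 i * c a ord0 j|).
    rewrite -[leRHS]mul1r ler_wpM2r// ger0_norm; last by apply: p0; rewrite -mem_undup.
    rewrite -p1 (big_rem a)//= lerDl big_seq; apply: sumr_ge0 => b bU.
    by apply: p0; rewrite -mem_undup; exact: mem_rem bU.
  rewrite (bigD1 i)//= (bigD1 j)//= -addrA lerDl addr_ge0//.
    exact: sumr_ge0.
  by apply: sumr_ge0 => i' _; apply: sumr_ge0.
rewrite /determinant; apply: (le_trans (ler_norm_sum _ _ _)).
apply: ler_sum => s _; rewrite normrM normrX normrN1 expr1n mul1r normr_prod.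
rewrite -[X in _ <= k ^+ X](card_ord r) -prodr_const.
by apply: ler_prod => i _; rewrite normr_ge0 Wk.
Qed.

Lemma n_gt0 : (0 < n)%N.
Proof.
by rewrite /n lt0n size_eq0; apply: contraNneq B0 => /undup_nil ->.
Qed.

(** Makes the supremum of determinants positive. A vector [u] in the kernel of [W p] is orthogonal
    to every [c a], and these span, as [X *m C = 1%:M] shows. *)
Lemma uniform_unit : exists p, is_design B p /\ W p \in unitmx.
Proof.
pose p (a : 'rV[R]_d) : R := n%:R^-1; exists p; split.
  split; first by move=> a _; rewrite invr_ge0.
  rewrite (eq_bigr (fun=> n%:R^-1))// big_const_seq count_predT -/U -/n iter_addr addr0.
  rewrite -[LHS]mulr_natr mulVf//.
  by rewrite pnatr_eq0 -lt0n n_gt0.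
rewrite -row_free_unit -kermx_eq0; apply/eqP/row_matrixP => k.
rewrite row0; set u := row k _.
have uW : u *m W p = 0 by apply/sub_kermxP; exact: row_sub.
have p0 a : a \in U -> 0 <= p a by move=> _; rewrite invr_ge0.
have uc a : a \in U -> dotv u (c a) = 0.
  move=> aU; have := rank1_sum_mul U c p u u; rewrite -/(W p) uW dotv0l => /esym/eqP.
  rewrite big_seq psumr_eq0; last first.
    by move=> b bU; rewrite mulr_ge0 ?p0// (dotvC (c b)) -expr2 sqr_ge0.
  move=> /allP/(_ a aU); rewrite aU/= mulf_eq0 (dotvC (c a)) -expr2 sqrf_eq0.
  by rewrite invr_eq0 pnatr_eq0 eqn0Ngt n_gt0 => /eqP.
pose C : 'M[R]_(n, r) := \matrix_(i < n) c (nth 0 U i).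
have CF : C *m F = BM.
  apply/row_matrixP => i; rewrite row_mul !rowK coordK// -mem_undup.
  exact: mem_nth.
have uC : u *m C^T = 0.
  apply/matrixP => i j; rewrite (ord1 i) [RHS]mxE.
  have := uc (nth 0 U j) (mem_nth _ (ltn_ord j)); rewrite dotvE => <-.
  by rewrite !mxE; apply: eq_bigr => l _; rewrite !mxE.
have [X FX] : exists X, F = X *m BM.
  by apply/submxP; rewrite eq_row_base.
have XC : X *m C = 1%:M.
  apply: (row_free_inj (row_base_free BM)).
  by rewrite -mulmxA CF -FX mul1mx.
by rewrite -[u]mulmx1 -trmx1 -XC trmx_mul mulmxA uC mul0mx.
Qed.

Definition move_design (t : R) (a : 'rV[R]_d) (p : 'rV[R]_d -> R) b : R :=
  (1 - t) * p b + t * (b == a)%:R.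

Lemma move_is_design t a p : 0 <= t <= 1 -> a \in B -> is_design B p ->
  is_design B (move_design t a p).
Proof.
move=> /andP[t0 t1] aB [p0 p1]; split.
  move=> b bB; rewrite addr_ge0// mulr_ge0 ?subr_ge0 ?p0//.
rewrite big_split/= -!mulr_sumr p1 (bigD1_seq a) ?undup_uniq ?mem_undup//= eqxx.
rewrite big1 ?addr0; last by move=> b /negbTE ->.
by rewrite !mulr1 subrK.
Qed.

Lemma move_W t a p : a \in B ->
  W (move_design t a p) = (1 - t) *: W p + t *: ((c a)^T *m c a).
Proof.
move=> aB; rewrite /W /move_design.
under eq_bigr do rewrite scalerDl -!scalerA.
rewrite big_split/= -!scaler_sumr; congr (_ + _ *: _).
rewrite (bigD1_seq a) ?undup_uniq ?mem_undup//= eqxx scale1r.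
by rewrite big1 ?addr0// => b /negbTE ->; rewrite scale0r.
Qed.

(** Moving mass to [a] is a rank-one change of [(1 - t) *: W p], so the matrix determinant lemma
    brings in the leverage of [a]. *)
Lemma det_move t a p : t < 1 -> W p \in unitmx -> a \in B ->
  \det (W (move_design t a p)) =
  \det (W p) * ((1 - t) ^+ r *
    (1 + t / (1 - t) * dotv (c a *m invmx (W p)) (c a))).
Proof.
move=> t1 uW aB; rewrite move_W//.
have t10 : 1 - t != 0 by rewrite gt_eqF// subr_gt0.
have -> : (1 - t) *: W p + t *: ((c a)^T *m c a) =
    W p *m ((1 - t) *: (1%:M + ((t / (1 - t)) *: (invmx (W p) *m (c a)^T)) *m c a)).
  rewrite -scalemxAr mulmxDr mulmx1 scalerDr; congr (_ + _).
  rewrite -scalemxAl -!scalemxAr scalerA mulrCA mulfV// mulr1.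
  by rewrite -mulmxA mulKVmx.
rewrite det_mulmx detZ det_add_rank1; congr (_ * (_ * (1 + _))).
by rewrite -scalemxAr mxE mulmxA -dotvE.
Qed.

Lemma bernoulli_sub (t : R) k : 0 <= t <= 1 -> 1 - k%:R * t <= (1 - t) ^+ k.
Proof.
move=> /andP[t0 t1]; elim: k => [|k IH]; first by rewrite mul0r subr0.
rewrite exprS; apply: le_trans (ler_wpM2l _ IH); last by rewrite subr_ge0.
rewrite -natr1; have : 0 <= k%:R * t ^+ 2 by rewrite mulr_ge0// sqr_ge0.
nra.
Qed.

(** With [D t (1 + eta) = eta / 2] the first-order gain [t D eta] loses exactly half of itself to
    the second-order term. *)
Lemma rho_arith (t D eta : R) : t * (2 * D * (1 + eta)) = eta ->
  1 + t * D * eta / 2 = (1 - D * t) * (1 + t * (D * (1 + eta))).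
Proof. by move=> h; have := congr1 (fun z => D * t * z) h; lra. Qed.

(* A design with nearly maximal [|det W|] is nearly G-optimal: shifting mass to
   an arm with large leverage would multiply the determinant by [rho > 1]. *)
Lemma near_optimal_design (eta : R) : 0 < eta ->
  exists p, [/\ is_design B p, design_covers B p &
    forall a, a \in B -> qform (pinvmx (Vdesign B p)) a <= d%:R * (1 + eta)].
Proof.
move=> eta0.
have dR : 1 <= d%:R :> R by rewrite ler1n.
have [C detC] := det_bounded.
have [p0 [dp0 up0]] := uniform_unit.
pose D := [set x : R | exists2 p, is_design B p & x = `|\det (W p)|].
have Dsup : has_sup D.
  by split; [exists `|\det (W p0)|, p0|exists C => _ [p dp ->]; exact: detC].
have S0 : 0 < sup D.
  apply: (@lt_le_trans _ _ `|\det (W p0)|); last by apply: sup_upper_bound => //; exists p0.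
  by rewrite normr_gt0 -unitfE -unitmxE.
pose t := eta / (2 * d%:R * (1 + eta)).
have den0 : 0 < 2 * d%:R * (1 + eta) by nra.
have t0 : 0 < t by rewrite divr_gt0.
have tE : t * (2 * d%:R * (1 + eta)) = eta by rewrite divfK// gt_eqF.
have dt2 : d%:R * t < 1 / 2 by nra.
have t1 : t < 1 by nra.
pose rho := 1 + t * d%:R * eta / 2.
have rho1 : 1 < rho by rewrite /rho ltrDl divr_gt0// mulr_gt0// mulr_gt0//; lra.
(* As [rho > 1], some design has a determinant above [sup D / rho]; moving mass by [t] can then no
   longer gain a factor [rho]. *)
have [x [p dp ->] xS] : exists2 x, D x & sup D - (sup D - sup D / rho) < x.
  apply: sup_adherent => //; rewrite subr_gt0 ltr_pdivrMr ?ltr_pMr//; lra.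
have {}xS : sup D < `|\det (W p)| * rho by rewrite -ltr_pdivrMr; [lra|lra].
have uW : W p \in unitmx.
  rewrite unitmxE unitfE -normr_gt0.
  have : 0 < `|\det (W p)| * rho by exact: lt_trans xS.
  by rewrite pmulr_lgt0//; lra.
exists p; split => //.
  by move=> a aB; have [] := cover_qform p a uW aB.
move=> a aB; have [_ ->] := cover_qform p a uW aB.
rewrite leNgt; apply/negP; set g := dotv _ _ => gd.
have t01 : 0 <= t <= 1 by rewrite !ltW.
have : `|\det (W (move_design t a p))| <= sup D.
  apply: sup_upper_bound => //; exists (move_design t a p) => //.
  exact: move_is_design.
rewrite det_move// normrM -/g => h.
have : `|\det (W p)| * rho <= `|\det (W p)| * `|(1 - t) ^+ r * (1 + t / (1 - t) * g)|.
  rewrite ler_wpM2l//; apply: le_trans (ler_norm _).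
  have g0 : 0 < g by apply: lt_trans gd; nra.
  have h1 : 1 + t * (d%:R * (1 + eta)) <= 1 + t / (1 - t) * g.
    have ht : t <= t / (1 - t) by rewrite ler_pdivlMr; [nra|lra].
    rewrite lerD2l; apply: ler_pM => //; [lra|nra|exact: ltW].
  have h2 : 1 - d%:R * t <= (1 - t) ^+ r.
    apply: le_trans (bernoulli_sub _ d t01) _.
    rewrite ler_wiXn2l// ?subr_ge0 ?ltW// ?rank_leq_col//; lra.
  apply: le_trans (_ : (1 - d%:R * t) * (1 + t * (d%:R * (1 + eta))) <= _).
    by rewrite /rho (rho_arith _ _ _ tE).
  apply: ler_pM => //.
    by rewrite subr_ge0 (le_trans (ltW dt2))// ler_pdivrMr// mul1r ler1n.
  by rewrite addr_ge0// mulr_ge0 ?(ltW t0)// mulr_ge0// addr_ge0// ltW.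
lra.
Qed.

End KieferWolfowitz.

(** Optimality is compared with near-optimal designs: [eta = e / d] turns their relative slack into
    an additive slack [e], which is then arbitrary. *)
Lemma G_optimal_leverage {R : realType} {d : nat} (B : seq 'rV[R]_d) p :
  (0 < d)%N -> B != [::] -> G_optimal B p ->
  forall a, a \in B -> qform (pinvmx (Vdesign B p)) a <= d%:R.
Proof.
move=> d0 B0 [dp cp opt] a aB; apply/ler_addgt0Pr => e e0.
have dR : 0 < d%:R :> R by rewrite ltr0n.
have [p' [dp' cp' gp']] := near_optimal_design B B0 d0 (e / d%:R) (divr_gt0 e0 dR).
have de : d%:R * (1 + e / d%:R) = d%:R + e.
  by rewrite mulrDr mulr1 mulrCA mulfV ?mulr1// gt_eqF.
have g' : gvalue B p' <= Num.sqrt (d%:R + e).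
  rewrite /gvalue big_seq; apply: bigmax_le; first exact: sqrtr_ge0.
  by move=> b; rewrite mem_undup => bB; rewrite ler_wsqrtr// -de gp'.
have g : Num.sqrt (qform (pinvmx (Vdesign B p)) a) <= Num.sqrt (d%:R + e).
  apply: le_trans g'; apply: le_trans (opt p' dp' cp').
  rewrite /gvalue; apply: (le_bigmax_seq 0 a xpredT (fun a => Num.sqrt (qform (pinvmx (Vdesign B p)) a))) => //.
  by rewrite mem_undup.
by move: g; rewrite ler_sqrt//; lra.
Qed.

(** * The stopping rule *)

Section Numerics.
Context {R : realType}.

(** Certifies rational bounds on exponentials by repeated squaring, each intermediate square being
    rounded down to a short fraction [c]; for an upper bound the argument is negated and the result
    inverted. *)
Lemma sqr_lb (b c x : R) : 0 <= c -> b <= c ^+ 2 -> c <= x -> b <= x ^+ 2.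
Proof.
by move=> c0 bc cx; apply: le_trans bc _; rewrite ler_sqr ?nnegrE// (le_trans c0).
Qed.

(** 21/8 is chosen for the stopping rule: it makes [24 * (expR 1 - 2)] at least 15. The 16th power
    of [17 / 16] is just above it. *)
Lemma expR1_ge : 21 / 8 <= expR 1 :> R.
Proof.
have e1 : expR 1 = (((expR (1 / 16) ^+ 2) ^+ 2) ^+ 2) ^+ 2 :> R.
  by rewrite -!exprM -expRM_natl; congr expR; lra.
rewrite e1.
apply: (sqr_lb _ (203 / 125)); [lra|lra|].
apply: (sqr_lb _ (1593 / 1250)); [lra|lra|].
apply: (sqr_lb _ (11289 / 10000)); [lra|lra|].
apply: (sqr_lb _ (17 / 16)); [lra|lra|].
by have := expR_ge1Dx (1 / 16 : R); lra.
Qed.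

Lemma expR1_le4 : expR 1 <= 4 :> R.
Proof.
have e1 : expR 1 = (expR (- (1 / 2)) ^+ 2)^-1 :> R.
  by rewrite -expRM_natl -expRN; congr expR; lra.
rewrite e1 -(invrK 4) lef_pV2 ?posrE ?invr_gt0 ?exprn_gt0 ?expR_gt0//.
apply: (sqr_lb _ (1 / 2)); [lra|lra|].
by have := expR_ge1Dx (- (1 / 2) : R); lra.
Qed.

Lemma expR25_le : expR (2 / 5) <= 3 / 2 :> R.
Proof.
have e1 : expR (2 / 5) = (((((expR (- (1 / 80)) ^+ 2) ^+ 2) ^+ 2) ^+ 2) ^+ 2)^-1 :> R.
  by rewrite -!exprM -expRM_natl -expRN; congr expR; lra.
rewrite e1 -(invf_div 2 3) lef_pV2 ?posrE ?invr_gt0 ?exprn_gt0 ?expR_gt0 ?divr_gt0//.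
apply: (sqr_lb _ (2043 / 2500)); [lra|lra|].
apply: (sqr_lb _ (113 / 125)); [lra|lra|].
apply: (sqr_lb _ (2377 / 2500)); [lra|lra|].
apply: (sqr_lb _ (9751 / 10000)); [lra|lra|].
apply: (sqr_lb _ (79 / 80)); [lra|lra|].
by have := expR_ge1Dx (- (1 / 80) : R); lra.
Qed.

Lemma expRN1_le : expR (- 1) <= 8 / 21 :> R.
Proof.
rewrite expRN -(invf_div 21 8) lef_pV2 ?posrE ?expR_gt0 ?divr_gt0//.
exact: expR1_ge.
Qed.

Lemma ln2_ge : 1 / 2 <= ln 2 :> R.
Proof.
rewrite -ler_expR lnK ?posrE//.
have e1 : expR (1 / 2) = (expR (- (1 / 4)) ^+ 2)^-1 :> R.
  by rewrite -expRM_natl -expRN; congr expR; lra.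
rewrite e1 -[leRHS]invrK lef_pV2 ?posrE ?invr_gt0 ?exprn_gt0 ?expR_gt0//.
apply: (sqr_lb _ (3 / 4)); [lra|lra|].
by have := expR_ge1Dx (- (1 / 4) : R); lra.
Qed.

(** At lambda 2/5 the weight of [X] is at most 1/2, so [X] is at least [4/5 U - 2 ell];
    [15 * ell <= U] absorbs [2 ell] into [2/15 U], which leaves [2/3 U]. *)
Lemma SR_upper_arith (U ell X S e : R) : U <= S -> 1 + 15 * ell <= U -> 0 <= X ->
  e <= 3 / 2 -> 2 / 5 * S - (e - 1) * X < ell -> 2 / 3 * U <= X.
Proof.
move=> h1 h2 h3 h4; have : (e - 1) * X <= (1 / 2) * X by rewrite ler_wpM2r//; lra.
lra.
Qed.

(** The running sum overshoots [U] by at most one sample, hence by 1. At lambda -1 the weight of [X]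
    is at least 13/21, and [1 + ell] is absorbed by [5/21 U]. *)
Lemma SR_lower_arith (U ell X S e : R) : S <= U + 1 -> 1 + 15 * ell <= U ->
  1 / 2 <= ell -> 0 <= X ->
  e <= 8 / 21 -> -1 * S - (e - 1) * X < ell -> X <= 2 * U.
Proof.
move=> h1 h2 h3 h4 h5.
have : (e - 1) * X <= (8 / 21 - 1) * X by rewrite ler_wpM2r//; lra.
lra.
Qed.

Lemma SR_Upsilon_arith (e ell : R) : 21 / 8 <= e -> e <= 4 -> 1 / 2 <= ell ->
  1 + 15 * ell <= 1 + 24 * (e - 2) * ell /\ 1 + 24 * (e - 2) * ell <= 1 + 48 * ell.
Proof. by move=> h1 h2 h3; split; nra. Qed.

End Numerics.

Section StoppingRule.
Context {R : realType}.
Variables (g : R).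
Hypothesis g0 : 0 < g <= 1.
Let ell := ln (2 / g).
Let U := SR_Upsilon1 (1 / 2) g.

Lemma SR_ell_ge : 1 / 2 <= ell.
Proof.
have /andP[gp g1] := g0.
apply: le_trans ln2_ge _; rewrite ler_ln ?posrE ?divr_gt0//.
by rewrite ler_pdivlMr//; lra.
Qed.

Lemma SR_Upsilon1E : U = 1 + 24 * (expR 1 - 2) * ell.
Proof. by rewrite /U /SR_Upsilon1 -/ell; field. Qed.

Lemma SR_Upsilon1_ge : 1 + 15 * ell <= U.
Proof.
rewrite SR_Upsilon1E.
by have [] := SR_Upsilon_arith _ _ expR1_ge expR1_le4 SR_ell_ge.
Qed.

Lemma SR_Upsilon1_le : U <= 1 + 48 * ell.
Proof.
rewrite SR_Upsilon1E.
by have [] := SR_Upsilon_arith _ _ expR1_ge expR1_le4 SR_ell_ge.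
Qed.

Variables (mu S : R) (N : nat).
Hypothesis mu0 : 0 < mu.

Lemma SR_upper (M : R) : U <= S ->
  expR (2 / 5 * S - N%:R * (expR (2 / 5) - 1) * mu) <= M -> g / 2 * M < 1 ->
  2 / 3 * U <= N%:R * mu.
Proof.
move=> US hM gM.
have /andP[gp g1] := g0.
have : expR (2 / 5 * S - N%:R * (expR (2 / 5) - 1) * mu) < expR ell.
  rewrite /ell lnK ?posrE ?divr_gt0//; apply: le_lt_trans hM _.
  by rewrite ltr_pdivlMr// mulrC; lra.
rewrite ltr_expR.
have h1 := @expR25_le R.
have h2 := SR_Upsilon1_ge.
have N0 : 0 <= N%:R * mu by rewrite mulr_ge0// ltW.
set X := N%:R * mu in N0 *.
have -> : N%:R * (expR (2 / 5) - 1) * mu = (expR (2 / 5) - 1) * X by rewrite /X; ring.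
exact: SR_upper_arith.
Qed.

Lemma SR_lower (M : R) : S <= U + 1 ->
  expR (-1 * S - N%:R * (expR (- 1) - 1) * mu) <= M -> g / 2 * M < 1 ->
  N%:R * mu <= 2 * U.
Proof.
move=> US hM gM.
have /andP[gp g1] := g0.
have : expR (-1 * S - N%:R * (expR (- 1) - 1) * mu) < expR ell.
  rewrite /ell lnK ?posrE ?divr_gt0//; apply: le_lt_trans hM _.
  by rewrite ltr_pdivlMr// mulrC; lra.
rewrite ltr_expR.
have h1 := @expRN1_le R.
have h2 := SR_Upsilon1_ge.
have h3 := SR_ell_ge.
have N0 : 0 <= N%:R * mu by rewrite mulr_ge0// ltW.
set X := N%:R * mu in N0 *.
have -> : N%:R * (expR (- 1) - 1) * mu = (expR (- 1) - 1) * X by rewrite /X; ring.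
exact: SR_lower_arith.
Qed.

End StoppingRule.

Section Schedule.
Context {R : realType} {d : nat}.
Implicit Types (a : 'rV[R]_d) (p : 'rV[R]_d * R).

Definition expand_plays (n : 'rV[R]_d * R -> nat) (est : seq ('rV[R]_d * R)) :=
  flatten [seq nseq (n p) p | p <- est].

Lemma size_expand_plays n est : size (expand_plays n est) = (\sum_(p <- est) n p)%N.
Proof.
rewrite /expand_plays; elim: est => [|p s IH] /=; first by rewrite big_nil.
by rewrite size_cat size_nseq IH big_cons.
Qed.

Lemma mem_expand_plays n est p : p \in expand_plays n est -> p \in est.
Proof.
move=> /flattenP[s /mapP[q qe ->]]; rewrite mem_nseq => /andP[_ /eqP ->].
exact: qe.
Qed.

Lemma total_expand_plays n est :
  total_mx 0 (expand_plays n est) =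
  \sum_(p <- est) ((n p)%:R / p.2) *: (p.1^T *m p.1).
Proof.
rewrite /total_mx add0r /expand_plays; elim: est => [|p s IH] /=; first by rewrite !big_nil.
rewrite big_cat big_cons IH; congr (_ + _).
rewrite big_nseq iter_addr addr0 -scaler_nat scalerA.
by [].
Qed.

(* Cauchy-Schwarz for [V1] turns the Loewner bound into a bound on the
   leverage: [v^2 <= lev(V1) * v / c]. *)
Lemma leverage_mono (V1 V2 : 'M[R]_d) (c g : R) a :
  0 < c -> psd V1 -> psd V2 -> (a <= V1)%MS -> (a <= V2)%MS ->
  (forall u, c * dotv (u *m V1) u <= dotv (u *m V2) u) ->
  qform (pinvmx V1) a <= g ->
  qform (pinvmx V2) a <= g / c.
Proof.
move=> c0 p1 p2 /submxP[y ay] /submxP[x ax] h12.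
rewrite (qform_pinv _ _ _ p1.1 ay) (qform_pinv _ _ _ p2.1 ax) => hg.
have cs := psd_cauchy V1 y x p1.
rewrite -ay in cs.
have h := h12 x; rewrite -ax in h.
have v0 : 0 <= dotv a x by rewrite {1}ax; exact: p2.2.
have w0 := p1.2 x.
rewrite ler_pdivlMr//.
have y0 : 0 <= dotv a y by rewrite {1}ay; exact: p1.2.
move: cs h v0 w0 hg y0.
move: (dotv a x) (dotv (x *m V1) x) (dotv a y) => v w q cs h v0 w0 hg q0.
have [->|vn0] := eqVneq v 0; first by rewrite mul0r; exact: le_trans hg.
have vp : 0 < v by rewrite lt_neqAle eq_sym vn0.
apply: le_trans hg; rewrite -(ler_pM2r vp) mulrAC -expr2 mulrC.
apply: (@le_trans _ _ (c * (q * w))); first by rewrite ler_wpM2l// ltW.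
by rewrite mulrCA ler_wpM2l.
Qed.

End Schedule.

(** * The schedule of a phase *)

Section PsdSub.
Context {R : realType} {d : nat}.

Lemma dotv_delta (u : 'rV[R]_d) i : dotv u (delta_mx 0 i) = u 0 i.
Proof.
rewrite /dotv (bigD1 i)//= !mxE !eqxx mulr1 big1 ?addr0// => j /negbTE ji.
by rewrite mxE ji andbF mulr0.
Qed.

Lemma psd_kernel (V : 'M[R]_d) u : psd V -> dotv (u *m V) u <= 0 -> u *m V = 0.
Proof.
move=> pV uV; apply/rowP => i; rewrite [RHS]mxE -dotv_delta.
have := psd_cauchy V u (delta_mx 0 i) pV.
have -> : dotv (u *m V) u = 0 by apply/eqP; rewrite eq_le uV pV.2.
by rewrite mul0r => h; apply/eqP; rewrite -sqrf_eq0 eq_le h sqr_ge0.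
Qed.

(** Loewner domination passes the kernel of [V2] on to [V1]; for symmetric matrices an inclusion of
    kernels reverses to one of row spaces. *)
Lemma psd_submx (V1 V2 : 'M[R]_d) (c : R) : 0 < c -> psd V1 -> psd V2 ->
  (forall u, c * dotv (u *m V1) u <= dotv (u *m V2) u) -> (V1 <= V2)%MS.
Proof.
move=> c0 p1 p2 h; rewrite submxE; set X := cokermx V2.
have XT : X^T *m V1 = 0.
  apply/row_matrixP => i; rewrite row_mul row0.
  apply: psd_kernel => //.
  rewrite -(pmulr_rle0 _ c0); apply: le_trans (h _) _.
  have -> : row i X^T *m V2 = 0.
    by rewrite -row_mul -[in V2](proj1 p2) -trmx_mul mulmx_coker trmx0 row0.
  by rewrite dotv0l.
by rewrite -[V1](proj1 p1) -[X]trmxK -trmx_mul XT trmx0.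
Qed.

End PsdSub.

Section Tplays.
Context {R : realType}.
Variables (d K : nat) (delta : R) (l : nat).
Local Notation c0 := (49 * d%:R / (eps_l R l) ^+ 2 * ln ((delta_l K delta l)^-1)).

Lemma Tplays_bounds (s p : R) : 0 <= c0 * s * p ->
  c0 * s * p <= (Tplays d K delta l s p)%:R <= c0 * s * p + 1.
Proof.
rewrite /Tplays; set x := c0 * s * p => x0.
have cx := ceil_ge x.
have c0' : 0 <= Num.ceil x by rewrite -(ler0z R); exact: le_trans cx.
rewrite natr_absz ger0_norm// cx /=.
by have := ceilB1_lt x; rewrite rmorphB/=; lra.
Qed.

End Tplays.

Section PhaseParameters.
Context {R : realType}.
Variables (K : nat) (delta : R) (l : nat).
Hypotheses (K0 : (0 < K)%N) (l0 : (0 < l)%N).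
Hypothesis delta01 : 0 < delta < 1.

Lemma gamma_bounds (d : nat) : (0 < d)%N -> 0 < gamma_l d delta l <= 1.
Proof.
move=> d0; have /andP[dp d1] := delta01.
rewrite /gamma_l divr_gt0 ?mulr_gt0 ?ltr0n//=.
rewrite ler_pdivrMr ?mulr_gt0 ?ltr0n// mul1r -!natrM.
apply: (@le_trans _ _ 2%:R); first by lra.
by rewrite ler_nat; clear K0; nia.
Qed.

Lemma delta_l_gt0 : 0 < delta_l K delta l.
Proof.
by have /andP[dp d1] := delta01; rewrite divr_gt0 ?mulr_gt0 ?ltr0n.
Qed.

Lemma logdelta_ge : 1 / 2 <= ln ((delta_l K delta l)^-1).
Proof.
have /andP[dp d1] := delta01.
apply: le_trans ln2_ge _; rewrite ler_ln ?posrE ?invr_gt0 ?delta_l_gt0//.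
rewrite /delta_l invf_div ler_pdivlMr// -!natrM.
apply: (@le_trans _ _ 2%:R); first by lra.
by rewrite ler_nat; nia.
Qed.

Lemma expR_logdelta : expR (ln ((delta_l K delta l)^-1)) = (delta_l K delta l)^-1.
Proof. by rewrite lnK// posrE invr_gt0 delta_l_gt0. Qed.

End PhaseParameters.

Lemma sum_ge0_arith {R : realType} (e q s M : R) : 0 < e -> e / 4 <= q ->
  q <= 3 / 4 * (s + e) -> s <= M -> 0 <= M + e.
Proof. lra. Qed.

Section ScheduleProps.
Context {R : realType} {d : nat}.
Variables (K : nat) (delta : R) (l : nat).
Hypotheses (d0 : (0 < d)%N) (K0 : (0 < K)%N) (l0 : (0 < l)%N).
Hypothesis delta01 : 0 < delta < 1.
Variables (Al : seq 'rV[R]_d) (pi : 'rV[R]_d -> R) (s2 : 'rV[R]_d -> R) (M : R).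
Hypotheses (Al0 : Al != [::]) (optpi : G_optimal Al pi).
Hypothesis s2M : forall a, a \in Al -> s2 a <= M.
Variable est : seq ('rV[R]_d * R).
Hypothesis estE : map fst est = supp Al pi.
Hypothesis est_lo : forall p, p \in est -> eps_l R l / 4 <= p.2.
Hypothesis est_hi : forall p, p \in est -> p.2 <= 3 / 4 * (s2 p.1 + eps_l R l).

Let e := eps_l R l.
Let L := ln ((delta_l K delta l)^-1).
Let c0 := 49 * d%:R / e ^+ 2 * L.
Let np (p : 'rV[R]_d * R) := Tplays d K delta l p.2 (pi p.1).
Let sched := expand_plays np est.
Let V := total_mx 0 sched.

Lemma c0_gt0 : 0 < c0.
Proof.
have h := logdelta_ge K delta l K0 l0 delta01.
have e0 : 0 < e := eps_gt0 l.
by rewrite /c0 mulr_gt0 ?divr_gt0 ?mulr_gt0 ?ltr0n ?exprn_gt0// /L; lra.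
Qed.

Lemma est_supp p : p \in est -> p.1 \in Al /\ 0 < pi p.1.
Proof.
move=> pe; have : p.1 \in supp Al pi by rewrite -estE map_f.
by rewrite /supp mem_filter mem_undup => /andP[-> ->].
Qed.

Lemma est_pos p : p \in est -> 0 < p.2.
Proof.
by move=> /est_lo; apply: lt_le_trans; rewrite divr_gt0// eps_gt0.
Qed.

Lemma est_pi_sum : \sum_(p <- est) pi p.1 = 1.
Proof.
have [[pi0 pi1] _ _] := optpi.
rewrite -(big_map fst predT pi) estE /supp big_filter -pi1 [RHS](bigID (fun a => 0 < pi a))/=.
rewrite [X in _ = _ + X]big_seq_cond [X in _ = _ + X]big1 ?addr0// => a /andP[+ ap].
by rewrite mem_undup => aA; apply/eqP; rewrite eq_le pi0// andbT leNgt.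
Qed.

Lemma np_bounds p : p \in est ->
  c0 * p.2 * pi p.1 <= (np p)%:R <= c0 * p.2 * pi p.1 + 1.
Proof.
move=> pe; apply: Tplays_bounds; have [_ /ltW pp] := est_supp _ pe.
by rewrite mulr_ge0// mulr_ge0// ltW ?c0_gt0 ?est_pos.
Qed.

(** Phases of at least [2 ^ l] rounds make their number logarithmic in the horizon. Estimates of at
    least [e / 4] force [49/4 * d * L / e] plays, and [d * L >= 1 / 2]. *)
Lemma sched_size_ge : (2 ^ l <= size sched)%N.
Proof.
rewrite -(ler_nat R) size_expand_plays natr_sum natrX.
have h := logdelta_ge K delta l K0 l0 delta01.
have e0 : 0 < e := eps_gt0 l.
apply: (@le_trans _ _ (\sum_(p <- est) (c0 * (e / 4) * pi p.1))).
  rewrite -mulr_sumr est_pi_sum mulr1 /c0.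
  have eE : 2 ^+ l = e^-1 :> R by rewrite /e /eps_l invrK.
  have -> : 49 * d%:R / e ^+ 2 * L * (e / 4) = e^-1 * (d%:R * L * (49 / 4)).
    by field; rewrite gt_eqF.
  rewrite eE ler_peMr ?invr_ge0 ?(ltW e0)//.
  have d1 : 1 <= d%:R :> R by rewrite ler1n.
  have : 1 * (1 / 2) <= d%:R * L by apply: ler_pM.
  lra.
rewrite big_seq [leRHS]big_seq; apply: ler_sum => p pe.
have /andP[+ _] := np_bounds p pe; apply: le_trans.
have [_ /ltW pp] := est_supp _ pe.
by rewrite ler_wpM2r// ler_wpM2l ?(ltW c0_gt0) ?est_lo.
Qed.

(** The first term pays for rounding up, one play per arm of the support; 37 exceeds
    [49 * 3 / 4]. *)
Lemma sched_size_le :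
  (size sched)%:R <= (size est)%:R + 37 * d%:R * L * (M + e) / e ^+ 2.
Proof.
rewrite size_expand_plays natr_sum.
have h := logdelta_ge K delta l K0 l0 delta01.
have e0 : 0 < e := eps_gt0 l.
apply: (@le_trans _ _ (\sum_(p <- est) (c0 * (3 / 4 * (M + e)) * pi p.1 + 1))).
  rewrite big_seq [leRHS]big_seq; apply: ler_sum => p pe.
  have /andP[_ +] := np_bounds p pe; move/le_trans; apply.
  have [pA /ltW pp] := est_supp _ pe.
  rewrite lerD2r ler_wpM2r// ler_wpM2l ?(ltW c0_gt0)//.
  apply: (le_trans (est_hi p pe)).
  by rewrite ler_wpM2l// lerD2r s2M.
rewrite big_split/= -mulr_sumr est_pi_sum mulr1 addrC.
rewrite big_const_seq count_predT iter_addr addr0 lerD2l.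
have -> : c0 * (3 / 4 * (M + e)) = (147 / 4) * (d%:R * L * (M + e) / e ^+ 2).
  by rewrite /c0; field; rewrite gt_eqF.
have -> : 37 * d%:R * L * (M + e) / e ^+ 2 = 37 * (d%:R * L * (M + e) / e ^+ 2).
  by rewrite !mulrA.
apply: ler_wpM2r; last lra.
have Me : 0 <= M + e.
  have [p pe] : exists p, p \in est.
    have := est_pi_sum; case: (est) => [|p s _]; last by exists p; exact: mem_head.
    by rewrite big_nil => /esym/eqP; rewrite oner_eq0.
  exact: (sum_ge0_arith _ _ _ _ e0 (est_lo p pe) (est_hi p pe) (s2M p.1 (est_supp p pe).1)).
rewrite divr_ge0 ?exprn_ge0 ?(ltW e0)// mulr_ge0// mulr_ge0//.
by rewrite /L; lra.
Qed.

Lemma psd_V : psd V.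
Proof.
rewrite /V total_expand_plays.
apply: (psd_rank1_sum est fst (fun p => (np p)%:R / p.2)) => p pe.
by rewrite divr_ge0// ltW// est_pos.
Qed.

Lemma psd_Vpi : psd (Vdesign Al pi).
Proof.
have [[pi0 _] _ _] := optpi.
by apply: (psd_rank1_sum (undup Al) id pi) => a; rewrite mem_undup; exact: pi0.
Qed.

(** A play of [p] enters [V] with weight [p.2^-1] while the number of plays is proportional to
    [p.2]: the estimates cancel and [c0 * pi] remains. *)
Lemma V_loewner u : c0 * dotv (u *m Vdesign Al pi) u <= dotv (u *m V) u.
Proof.
have [[pi0 _] _ _] := optpi.
rewrite /V total_expand_plays (rank1_sum_mul est fst (fun p => (np p)%:R / p.2)).
rewrite /Vdesign (rank1_sum_mul (undup Al) id pi).
have -> : \sum_(a <- undup Al) pi a * (dotv u a * dotv a u) =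
    \sum_(p <- est) pi p.1 * (dotv u p.1 * dotv p.1 u).
  rewrite -(big_map fst predT (fun a => pi a * (dotv u a * dotv a u))) estE /supp big_filter.
  rewrite (bigID (fun a => 0 < pi a))/= [X in _ + X]big_seq_cond [X in _ + X]big1 ?addr0// => a /andP[+ ap].
  rewrite mem_undup => aA.
  have -> : pi a = 0 by apply/eqP; rewrite eq_le pi0// andbT leNgt.
  by rewrite mul0r.
rewrite mulr_sumr big_seq [leRHS]big_seq; apply: ler_sum => p pe.
rewrite [leLHS]mulrA ler_wpM2r//; first by rewrite (dotvC p.1) -expr2 sqr_ge0.
rewrite ler_pdivlMr ?est_pos//.
by have /andP[+ _] := np_bounds p pe; rewrite mulrAC.
Qed.

Lemma V_covers a : a \in Al -> (a <= V)%MS.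
Proof.
move=> aA; have [_ cov _] := optpi.
apply: (submx_trans (cov a aA)).
exact: (psd_submx _ _ _ c0_gt0 psd_Vpi psd_V V_loewner).
Qed.

Lemma V_leverage a : a \in Al -> qform (pinvmx V) a <= e ^+ 2 / (49 * L).
Proof.
move=> aA; have [_ cov _] := optpi.
have -> : e ^+ 2 / (49 * L) = d%:R / c0.
  have h := logdelta_ge K delta l K0 l0 delta01.
  rewrite /c0; field; rewrite !gt_eqF ?ltr0n ?eps_gt0//.
  by rewrite /L; lra.
apply: (leverage_mono _ _ _ _ _ c0_gt0 psd_Vpi psd_V (cov a aA) (V_covers a aA) V_loewner).
exact: G_optimal_leverage.
Qed.

End ScheduleProps.

(** * Invariant of a run on the good event *)

(** The quadratic term is at most [8/9 L], so [err] is at most [17/9 L] divided by [7 L / (3 e)].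
    This lambda is a rational value close to the optimum [7 L / (2 sqrt 2 e)]. *)
Lemma error_arith {R : realType} (e L v err : R) : 0 < e -> 1 / 2 <= L ->
  v <= e ^+ 2 / (49 * L) ->
  7 * L / (3 * e) * err - 8 * (7 * L / (3 * e)) ^+ 2 * v < L -> err <= 17 / 21 * e.
Proof.
move=> e0 L2 hv h.
have L0 : 0 < L by lra.
have h8 : 8 * (7 * L / (3 * e)) ^+ 2 * v <= 8 / 9 * L.
  apply: (@le_trans _ _ (8 * (7 * L / (3 * e)) ^+ 2 * (e ^+ 2 / (49 * L)))).
    by rewrite ler_wpM2l// mulr_ge0// sqr_ge0.
  by rewrite le_eqVlt; apply/orP; left; apply/eqP; field; rewrite !gt_eqF.
have {hv} : 7 * L / (3 * e) * err < 17 / 9 * L by move: h h8; lra.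
have -> : 7 * L / (3 * e) * err = (7 / 3 * (err / e)) * L.
  by field; rewrite gt_eqF.
rewrite ltr_pM2r// => h1.
by rewrite -ler_pdivrMr//; lra.
Qed.

(** The floor [e / 4] of the estimated variances limits the weight of a single reward: the product
    is at most 4/21, within the range 1/4 of [lapX_le]. *)
Lemma coef_arith {R : realType} (e L q w : R) : 0 < e -> 1 / 2 <= L ->
  e / 4 <= q -> `|w| <= e ^+ 2 / (49 * L) ->
  7 * L / (3 * e) * (q^-1 * `|w|) <= 1 / 4.
Proof.
move=> e0 L2 hq hw.
have L0 : 0 < L by lra.
have q0 : 0 < q by lra.
have hq' : q^-1 <= 4 / e.
  by rewrite -(invf_div e 4) lef_pV2 ?posrE ?divr_gt0.
apply: (@le_trans _ _ (7 * L / (3 * e) * (4 / e * (e ^+ 2 / (49 * L))))).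
  apply: ler_wpM2l; first by rewrite divr_ge0 ?mulr_ge0// ltW.
  by apply: ler_pM => //; rewrite invr_ge0 ltW.
have -> : 7 * L / (3 * e) * (4 / e * (e ^+ 2 / (49 * L))) = 4 / 21.
  by field; rewrite !gt_eqF.
lra.
Qed.

Lemma elim_arith1 {R : realType} (e u v u' v' : R) : 0 < e -> v <= v' ->
  - (17 / 21 * e) <= u' - v' -> u - v <= 17 / 21 * e -> u - u' <= 2 * e.
Proof. lra. Qed.

(** The elimination threshold plus two estimation errors is [2 + 34/21 <= 4] in units of [e]. In
    [elim_arith1] the two errors alone stay below the threshold 2. *)
Lemma elim_arith2 {R : realType} (e u v u' v' : R) : 0 < e ->
  - (17 / 21 * e) <= u' - v' -> u - v <= 17 / 21 * e -> u' - u <= 2 * e ->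
  v' - v <= 8 * (e / 2).
Proof. lra. Qed.

Lemma gap_arith {R : realType} (u v : R) : u <= 1 -> - 1 <= v -> u - v <= 8 * (1 / 2).
Proof. lra. Qed.

Section Estimator.
Context {R : realType} {d : nat}.
Variables (V : 'M[R]_d) (b th : 'rV[R]_d) (e L : R).
Hypotheses (e0 : 0 < e) (L2 : 1 / 2 <= L) (pV : psd V) (bV : (b <= V)%MS).

(** The weights of single rewards come from [a *m pinvmx V], the estimate from [b *m pinvmx V]. As
    [pinvmx V] need not be symmetric, the two are identified through the symmetry of [V] and
    membership in its row space. *)
Lemma estimator_pairing a : (a <= V)%MS ->
  dotv (a *m pinvmx V) b = dotv a (b *m pinvmx V).
Proof.
move=> aV; have dV u w : dotv u (w *m V) = dotv (u *m V) w by rewrite dotv_mull (proj1 pV).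
by rewrite -[in LHS](mulmxKpV bV) dV mulmxKpV.
Qed.

Lemma estimator_error a : (a <= V)%MS -> qform (pinvmx V) a <= e ^+ 2 / (49 * L) ->
  (forall lam, lam = 7 * L / (3 * e) \/ lam = - (7 * L / (3 * e)) ->
     expR (lam * (dotv (a *m pinvmx V) b - dotv (a *m pinvmx V *m V) th)
       - 8 * lam ^+ 2 * dotv (a *m pinvmx V *m V) (a *m pinvmx V)) < expR L) ->
  `|dotv a (b *m pinvmx V) - dotv a th| <= 17 / 21 * e.
Proof.
move=> aV hq hM.
have vE : dotv a (a *m pinvmx V) = qform (pinvmx V) a by rewrite qformE dotvC.
rewrite ler_norml; apply/andP; split.
  have := hM _ (or_intror erefl).
  rewrite ltr_expR estimator_pairing// mulmxKpV// vE sqrrN => h.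
  rewrite lerNl; apply: (error_arith e L _ _ e0 L2 hq); apply: le_lt_trans h.
  by rewrite mulNr mulrN.
have := hM _ (or_introl erefl).
rewrite ltr_expR estimator_pairing// mulmxKpV// vE => h.
exact: (error_arith e L _ _ e0 L2 hq).
Qed.

End Estimator.

Section Run.
Context {R : realType} {d : nat} (nu : probability (@vec R d) R).
Variables (A : seq 'rV[R]_d) (delta : R) (design : seq 'rV[R]_d -> 'rV[R]_d -> R).
Variables (th astar : 'rV[R]_d) (s2 : 'rV[R]_d -> R) (M B : R).
Let K := size A.
Let D := ((d * d.+1) %/ 2)%N.
Local Notation e l := (eps_l R l).
Local Notation L l := (ln ((delta_l K delta l)^-1)).
Local Notation U1 l := (SR_Upsilon1 (1 / 2) (gamma_l d delta l)).
Local Notation lamX l := (7 * L l / (3 * e l)).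
Hypotheses (d0 : (0 < d)%N) (K0 : (0 < K)%N) (delta01 : 0 < delta < 1).
Hypothesis arm1 : forall a, a \in A -> (\int[nu]_v clip (dotv a v) = dotv a th)%R.
Hypothesis arm2 : forall a, a \in A ->
  (\int[nu]_v (clip (dotv a v) ^+ 2) = s2 a + dotv a th ^+ 2)%R.
Hypothesis s2M : forall a, a \in A -> s2 a <= M.
Hypothesis designP : forall C : seq 'rV[R]_d, {subset C <= A} -> C != [::] ->
  G_optimal C (design C) /\ (size (supp C (design C)) <= D)%N.
Hypotheses (astarA : astar \in A)
  (opt : forall a, a \in A -> dotv a th <= dotv astar th).

Variables (st : nat -> vase_state R d) (x : nat -> R) (T : nat).
Hypotheses (st0 : st 0%N = vase_start_phase design 1 A)
  (stS : forall t, st t.+1 = vase_step K delta design (st t) (x t))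
  (xb : forall t, `|x t| <= 1).

Definition run_mart (F : vase_state R d -> R -> R) (t : nat) : R :=
  \prod_(r < t) F (st r) (x r).

Local Notation ME l j lam t := (run_mart (est_factor nu l j lam) t).
Local Notation MP l lam a t := (run_mart (play_factor nu l lam a) t).

Hypothesis goodE : forall l j lam, (0 < l <= T.+1)%N -> (j < D)%N ->
  lam = 2 / 5 \/ lam = -1 -> gamma_l d delta l / 2 * ME l j lam T < 1.
Hypothesis goodP : forall l lam a, (0 < l <= T.+1)%N -> a \in A ->
  lam = lamX l \/ lam = - lamX l -> delta_l K delta l * MP l lam a T < 1.
(** [B] bounds the regret of one phase, complete or cut by the horizon. [B1] is for a cut during
    variance estimation, where each of at most [D] estimations takes at most [8 * U1 l / e l] rounds
    and the 2 absorbs a pending first play; [B2] is for the main plays. *)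
Hypothesis B1 : forall l, (0 < l <= T.+1)%N ->
  8 * e l * (D%:R * (8 * U1 l / e l + 2)) <= B.
Hypothesis B2 : forall l n, (0 < l <= T.+1)%N -> (n <= T)%N ->
  n%:R <= D%:R + 37 * d%:R * L l * (M + e l) / e l ^+ 2 ->
  8 * e l * (D%:R * (8 * U1 l / e l) + n%:R) <= B.

Lemma run_martS F t : run_mart F t.+1 = run_mart F t * F (st t) (x t).
Proof. by rewrite /run_mart big_ord_recr. Qed.

Definition past_est l j (s : vase_state R d) :=
  (l < vs_phase s)%N || (vs_phase s == l) &&
    (if vs_mode s is VarEst _ _ _ _ _ dn then (j < size dn)%N else true).

Definition past_play l (s : vase_state R d) := (l < vs_phase s)%N.

Lemma start_phase_phase l Al : vs_phase (vase_start_phase design l Al) = l.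
Proof. by rewrite /vase_start_phase; case: supp. Qed.

Lemma begin_play_phase l Al est :
  vs_phase (vase_begin_play K delta design l Al est) = l.
Proof. by rewrite /vase_begin_play; case: flatten. Qed.

Lemma past_est_step l j s y : past_est l j s ->
  past_est l j (vase_step K delta design s y).
Proof.
rewrite /past_est /vase_step; case: s => l' Al [todo cur o S N dn|sched V b|] //=.
  case: o => [x0|] //; case: ifP => //= _; case: todo => [|a todo] /=.
    rewrite begin_play_phase; case/orP => [->//|/andP[/eqP -> _]].
    rewrite /vase_begin_play; case: flatten => *; by rewrite eqxx orbT.
  by rewrite size_rcons; case/orP => [->//|/andP[-> /ltnW h]]; rewrite ltnS h orbT.
case: sched => [|[a sig] rest] //; case: rest => [|p rest] //=.
rewrite /vase_end_phase start_phase_phase andbT ltnS.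
by case/orP => [/ltnW ->//|/eqP ->]; rewrite leqnn.
Qed.

Lemma past_play_step l s y : past_play l s ->
  past_play l (vase_step K delta design s y).
Proof.
rewrite /past_play /vase_step; case: s => l' Al [todo cur o S N dn|sched V b|] //=.
  case: o => [x0|] //; case: ifP => //= _; case: todo => [|a todo] //=.
  by rewrite begin_play_phase.
case: sched => [|[a sig] rest] //; case: rest => [|p rest] //=.
by rewrite /vase_end_phase start_phase_phase => /ltnW.
Qed.

Lemma past_est_factor l j lam s y : past_est l j s -> est_factor nu l j lam s y = 1.
Proof.
rewrite /past_est /est_factor; case: s => l' Al [todo cur o S N dn|sched V b|] //=.
case/orP => [h|/andP[_ h]]; first by rewrite gtn_eqF.
by rewrite [size dn == j]gtn_eqF// andbF.
Qed.

Lemma past_play_factor l lam a s y : past_play l s -> play_factor nu l lam a s y = 1.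
Proof.
rewrite /past_play /play_factor; case: s => l' Al [todo cur o S N dn|[|p sched] V b|] //= h.
by rewrite gtn_eqF.
Qed.

Lemma run_mart_frozen (past : vase_state R d -> bool) F t :
  (forall s y, past s -> past (vase_step K delta design s y)) ->
  (forall s y, past s -> F s y = 1) -> (t <= T)%N ->
  past (st t) -> run_mart F t = run_mart F T.
Proof.
move=> pS pF tT pt.
suff H k : past (st (t + k)) /\ run_mart F (t + k) = run_mart F t.
  by have [_] := H (T - t)%N; rewrite subnKC.
elim: k => [|k [IH1 IH2]]; first by rewrite addn0.
by rewrite addnS stS run_martS IH2 pF ?mulr1//; split => //; exact: pS.
Qed.

Lemma frozen_est l j lam t : (0 < l <= T.+1)%N -> (j < D)%N ->
  lam = 2 / 5 \/ lam = -1 -> (t <= T)%N -> past_est l j (st t) ->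
  gamma_l d delta l / 2 * ME l j lam t < 1.
Proof.
move=> hl hj hlam tT pt.
rewrite (run_mart_frozen (past_est l j))//; first exact: goodE.
- by move=> s y; exact: past_est_step.
- by move=> s y; exact: past_est_factor.
Qed.

Lemma frozen_play l lam a t : (0 < l <= T.+1)%N -> a \in A ->
  lam = lamX l \/ lam = - lamX l -> (t <= T)%N -> past_play l (st t) ->
  delta_l K delta l * MP l lam a t < 1.
Proof.
move=> hl hj hlam tT pt.
rewrite (run_mart_frozen (past_play l))//; first exact: goodP.
- by move=> s y; exact: past_play_step.
- by move=> s y; exact: past_play_factor.
Qed.

Local Notation mu l a := (muZ nu a l).

Definition okest l (p : 'rV[R]_d * R) :=
  mu l p.1 / 2 <= p.2 /\ p.2 <= 3 / 2 * mu l p.1.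

Lemma okest_lo l p : p.1 \in A -> okest l p -> e l / 4 <= p.2.
Proof.
move=> pA [h _]; apply: le_trans h.
by have := muZ_ge_eps nu p.1 l; lra.
Qed.

Lemma okest_var l p : p.1 \in A -> okest l p -> s2 p.1 <= 4 * p.2.
Proof.
by move=> pA [h _]; have := muZ_ge_var nu p.1 _ _ (arm1 _ pA) (arm2 _ pA) l; lra.
Qed.

Lemma okest_hi l p : p.1 \in A -> okest l p -> p.2 <= 3 / 4 * (s2 p.1 + e l).
Proof.
by move=> pA [_ h]; have := muZ_le nu p.1 _ _ (arm1 _ pA) (arm2 _ pA) l; lra.
Qed.

Definition regret t := \sum_(r < t) dotv (astar - vase_action (st r)) th.

Lemma regretS t : regret t.+1 = regret t + dotv (astar - vase_action (st t)) th.
Proof. by rewrite /regret big_ord_recr. Qed.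

(** The clause [2 ^ l.-1 <= t.+1] keeps [l] within the range of the good event and later counts the
    phases. The last two clauses let a new phase start with its tests at 1. *)
Definition phase_inv t l (Al : seq 'rV[R]_d) : Prop :=
  [/\ (0 < l)%N, (2 ^ l.-1 <= t.+1)%N, {subset Al <= A}, astar \in Al &
    [/\ forall a, a \in Al -> dotv (astar - a) th <= 8 * e l,
       forall l' j lam, (l < l')%N -> ME l' j lam t = 1 &
       forall l' lam a, (l < l')%N -> MP l' lam a t = 1]].

(** The exponential counts complete samples; with a first reward pending, its factor is kept exactly
    because [phiZ] cancels at the second play. In rounds, a sample costs 2 and a pending play 1. *)
Definition est_inv t l (Al : seq 'rV[R]_d) todo cur (o : option R) S N
    (dn : seq ('rV[R]_d * R)) : Prop :=
  [/\ map fst dn ++ cur :: todo = supp Al (design Al),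
    (forall p, p \in dn -> okest l p), S < U1 l /\
    (forall x0, o = Some x0 -> `|x0| <= 1),
    [/\ forall lam, expR (lam * S - N%:R * (expR lam - 1) * mu l cur) *
      (if o is Some x0 then phiZ nu lam l cur x0 / lapZ nu lam l cur else 1) <=
        ME l (size dn) lam t,
      forall j lam, (size dn < j)%N -> ME l j lam t = 1 &
      forall lam a, MP l lam a t = 1] &
    regret t <= l.-1%:R * B + 8 * e l *
      ((size dn)%:R * (8 * U1 l / e l) + 2 * N%:R + (isSome o)%:R)].

(** [n] counts the main plays made, [nf] those of the whole phase. Leverages refer to
    [total_mx V sched], constant while plays move from [sched] into [V]; the exponent uses the
    current [V], so [xa *m V] paired with [th] and [xa] gives the mean and the variance proxy
    accumulated so far. *)
Definition play_inv t l (Al : seq 'rV[R]_d) (sched : seq ('rV[R]_d * R))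
    (V : 'M[R]_d) (b : 'rV[R]_d) : Prop :=
  exists n nf : nat, [/\ sched != [::], (n + size sched)%N = nf /\ (n <= t)%N,
    (2 ^ l <= nf)%N /\ nf%:R <= D%:R + 37 * d%:R * L l * (M + e l) / e l ^+ 2,
    [/\ psd (total_mx V sched), (b <= total_mx V sched)%MS,
      forall a, a \in Al -> (a <= total_mx V sched)%MS /\
        qform (pinvmx (total_mx V sched)) a <= e l ^+ 2 / (49 * L l),
      forall p, p \in sched -> [/\ p.1 \in Al, s2 p.1 <= 4 * p.2 & e l / 4 <= p.2] &
      forall a lam, a \in Al -> lam = lamX l \/ lam = - lamX l ->
        let xa := a *m pinvmx (total_mx V sched) in
        expR (lam * (dotv xa b - dotv (xa *m V) th)
           - 8 * lam ^+ 2 * dotv (xa *m V) xa) <= MP l lam a t] &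
    regret t <= l.-1%:R * B + 8 * e l * (D%:R * (8 * U1 l / e l) + n%:R)].

Definition run_inv t : Prop :=
  phase_inv t (vs_phase (st t)) (vs_active (st t)) /\
  match vs_mode (st t) with
  | VarEst todo cur o Z N dn =>
      est_inv t (vs_phase (st t)) (vs_active (st t)) todo cur o Z N dn
  | Play sched V b => play_inv t (vs_phase (st t)) (vs_active (st t)) sched V b
  | Stuck => False
  end.

Lemma phase_le t l Al : phase_inv t l Al -> (t <= T)%N -> (0 < l <= T.+1)%N.
Proof.
move=> [l0 h _ _ _] tT; rewrite l0/=.
have := ltn_expl l.-1 (ltnSn 1).
by lia.
Qed.

Lemma U1_gt1 l : (0 < l)%N -> 1 < U1 l.
Proof.
move=> l0; have g := gamma_bounds delta l l0 delta01 d d0.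
have h1 := SR_Upsilon1_ge _ g.
by have := SR_ell_ge _ g; lra.
Qed.

Lemma start_inv t l Al : st t = vase_start_phase design l Al ->
  phase_inv t l Al ->
  (forall j lam, ME l j lam t = 1) -> (forall lam a, MP l lam a t = 1) ->
  regret t <= l.-1%:R * B -> run_inv t.
Proof.
move=> stE pI hE hP hR; rewrite /run_inv stE start_phase_phase.
have [l0 _ AlA sA _] := pI.
have Al0 : Al != [::] by apply: contraTneq sA => ->.
have [[[pi0 pi1] _ _] _] := designP Al AlA Al0.
rewrite /vase_start_phase; case E: (supp Al (design Al)) => [|a rest].
  exfalso; move: pi1; rewrite (bigID (fun a => 0 < design Al a))/= -big_filter.
  rewrite -/(supp Al (design Al)) E big_nil add0r big_seq_cond big1.
    by move=> /esym/eqP; rewrite oner_eq0.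
  move=> a /andP[]; rewrite mem_undup => aA ap.
  by apply/eqP; rewrite eq_le pi0// andbT leNgt.
split => //; split => //=.
- by split => //; apply: lt_trans (U1_gt1 l l0).
- split => // lam; by rewrite hE mulr1 mulr0 mul0r mul0r subr0 expR0.
- by rewrite mul0r mulr0 !addr0 mulr0 addr0.
Qed.

Lemma est_factor_other_phase l j lam s y : vs_phase s != l -> est_factor nu l j lam s y = 1.
Proof. by move=> /negbTE h; rewrite /est_factor h; case: vs_mode. Qed.

Lemma play_factor_other_phase l lam a s y : vs_phase s != l -> play_factor nu l lam a s y = 1.
Proof. by move=> /negbTE h; rewrite /play_factor h; case: vs_mode => // -[]. Qed.

Lemma phase_inv_step t l Al : vs_phase (st t) = l -> phase_inv t l Al ->
  phase_inv t.+1 l Al.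
Proof.
move=> stl [l0 h AlA sA [gap fE fP]]; split => //; first by lia.
split => // [l' j lam ll'|l' lam a ll'].
  by rewrite run_martS fE// mul1r est_factor_other_phase// stl ltn_eqF.
by rewrite run_martS fP// mul1r play_factor_other_phase// stl ltn_eqF.
Qed.

Lemma regret_step t l Al : phase_inv t l Al -> vase_action (st t) \in Al ->
  regret t.+1 <= regret t + 8 * e l.
Proof. by move=> [_ _ _ _ [gap _ _]] aA; rewrite regretS lerD2l gap. Qed.

Lemma supp_sub Al a : a \in supp Al (design Al) -> a \in Al.
Proof. by rewrite mem_filter mem_undup => /andP[]. Qed.

Lemma begin_inv t l Al est : st t = vase_begin_play K delta design l Al est ->
  phase_inv t l Al -> map fst est = supp Al (design Al) ->
  (forall p, p \in est -> okest l p) -> (forall lam a, MP l lam a t = 1) ->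
  regret t <= l.-1%:R * B + 8 * e l * (D%:R * (8 * U1 l / e l)) -> run_inv t.
Proof.
move=> stE pI estE ok hP hR; rewrite /run_inv stE begin_play_phase.
have [l0 _ AlA sA [gap _ _]] := pI.
have Al0 : Al != [::] by apply: contraTneq sA => ->.
have [optA szA] := designP Al AlA Al0.
have estA p : p \in est -> p.1 \in Al.
  by move=> pe; apply: supp_sub; rewrite -estE map_f.
have lo p : p \in est -> e l / 4 <= p.2.
  by move=> pe; apply: okest_lo; [exact/AlA/estA|exact: ok].
have hi p : p \in est -> p.2 <= 3 / 4 * (s2 p.1 + e l).
  by move=> pe; apply: okest_hi; [exact/AlA/estA|exact: ok].
have vr p : p \in est -> s2 p.1 <= 4 * p.2.
  by move=> pe; apply: (okest_var l); [exact/AlA/estA|exact: ok].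
have sz1 := sched_size_ge K delta l d0 K0 l0 delta01 Al _ optA est estE lo.
have sz2 := sched_size_le K delta l d0 K0 l0 delta01 Al _ s2 M optA
  (fun a aA => s2M _ (AlA _ aA)) est estE lo hi.
have pV := psd_V K delta l (design Al) est lo.
have cV := V_covers K delta l d0 K0 l0 delta01 Al _ optA est estE lo.
have lV := V_leverage K delta l d0 K0 l0 delta01 Al _ Al0 optA est estE lo.
have me := @mem_expand_plays R d (fun p => Tplays d K delta l p.2 (design Al p.1)) est.
rewrite /vase_begin_play -/(expand_plays _ _).
move: sz1 sz2 pV cV lV me; set sched := expand_plays _ _ => sz1 sz2 pV cV lV me.
(* The schedule holds at least [2 ^ l] plays, so [Stuck] cannot arise here. *)
case E : sched => [|p rest]; first by move: sz1; rewrite E leqNgt expn_gt0.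
rewrite -E; split => //=.
exists 0%N, (size sched); split => //.
- by rewrite E.
- split => //; apply: le_trans sz2 _; rewrite lerD2r ler_nat.
  by rewrite -(size_map fst) estE.
- split => //; first exact: sub0mx.
  + by move=> a aA; split; [exact: cV|exact: lV].
  + by move=> q /me qe; split; [exact: estA|exact: vr|exact: lo].
  + move=> a lam _ _; cbv zeta.
    by rewrite hP dotv0r mulmx0 !dotv0l subr0 !mulr0 subr0 expR0.
- by rewrite addr0.
Qed.

Lemma est_accuracy l cur N Z (ME1 ME2 : R) : (0 < l)%N ->
  U1 l <= Z -> Z <= U1 l + 1 ->
  expR (2 / 5 * Z - N.+1%:R * (expR (2 / 5) - 1) * mu l cur) <= ME1 ->
  gamma_l d delta l / 2 * ME1 < 1 ->
  expR (-1 * Z - N.+1%:R * (expR (- 1) - 1) * mu l cur) <= ME2 ->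
  gamma_l d delta l / 2 * ME2 < 1 ->
  okest l (cur, U1 l / N.+1%:R) /\ 2 * N.+1%:R <= 8 * U1 l / e l.
Proof.
move=> l0 UZ ZU h1 g1 h2 g2.
have g := gamma_bounds delta l l0 delta01 d d0.
have m0 := muZ_ge_eps nu cur l; have e0 : 0 < e l := eps_gt0 l.
have mp : 0 < mu l cur by apply: lt_le_trans m0; rewrite divr_gt0.
have r1 := SR_upper _ g _ _ _ mp _ UZ h1 g1.
have r2 := SR_lower _ g _ _ _ mp _ ZU h2 g2.
have N0 : 0 < N.+1%:R :> R by rewrite ltr0n.
split.
  split => /=.
    by rewrite ler_pdivlMr// mulrAC ler_pdivrMr// mulrC [U1 l * 2]mulrC.
  rewrite ler_pdivrMr// -[leRHS]mulrA [mu l cur * _]mulrC.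
  have -> : U1 l = 3 / 2 * (2 / 3 * U1 l) by field.
  by rewrite ler_wpM2l.
rewrite ler_pdivlMr//.
have : N.+1%:R * (e l / 2) <= 2 * U1 l by apply: le_trans r2; rewrite ler_wpM2l// ltW.
lra.
Qed.

Lemma est_step t l Al todo cur o Z N dn : (t < T)%N ->
  st t = VState l Al (VarEst todo cur o Z N dn) -> phase_inv t l Al ->
  est_inv t l Al todo cur o Z N dn -> run_inv t.+1.
Proof.
move=> tT stE pI [spE ok [ZU x0b] [hE hEj hP] hR].
have pI1 : phase_inv t.+1 l Al by apply: phase_inv_step => //; rewrite stE.
have [l0 _ AlA sA _] := pI.
have Al0 : Al != [::] by apply: contraTneq sA => ->.
have [optA szA] := designP Al AlA Al0.
have curA : cur \in Al.
  by apply: supp_sub; rewrite -spE mem_cat mem_head orbT.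
have hR1 : regret t.+1 <= regret t + 8 * e l.
  by apply: regret_step pI _; rewrite stE.
have hEj1 j lam : (size dn < j)%N -> ME l j lam t.+1 = 1.
  by move=> jd; rewrite run_martS hEj// stE /est_factor/= eqxx/= ltn_eqF// mulr1.
have hP1 lam a : MP l lam a t.+1 = 1.
  by rewrite run_martS hP stE /play_factor/= mulr1.
have dnD : (size dn < D)%N.
  apply: leq_trans szA; by rewrite -spE size_cat size_map /= addnS ltnS leq_addr.
have lT : (0 < l <= T.+1)%N by apply: phase_le pI (ltnW tT).
have stE1 := stS t; rewrite stE /vase_step/= /vase_action/= in stE1.
case: o stE hE hR x0b stE1 => [x0|] stE hE hR x0b stE1; last first.
  rewrite /run_inv stE1; split => //=; split => //.
  - by split => // _ [<-].
  - split => // lam; rewrite run_martS stE /est_factor/= !eqxx/=.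
    have := hE lam; rewrite mulr1 => h.
    by rewrite ler_wpM2r// divr_ge0 ?phiZ_ge0 ?lapZ_ge0.
  - apply: (le_trans hR1); apply: (le_trans (lerD hR (lexx _))).
    by rewrite -addrA lerD2l -{2}[8 * e l]mulr1 -mulrDr /= addr0.
have {}x0b := x0b _ erefl.
pose Z' := Z + Zsamp l x0 (x t).
(* [phiZ] cancels between the two halves of the sample, and [lapZ_le] raises the count from [N] to
   [N.+1]. *)
have H lam : expR (lam * Z' - N.+1%:R * (expR lam - 1) * mu l cur) <=
    ME l (size dn) lam t.+1.
  rewrite run_martS stE /est_factor/= !eqxx/=.
  have lp := lapZ_gt0 nu cur l lam; have pp := phiZ_gt0 nu cur l lam _ x0b.
  apply: (@le_trans _ _ (expR (lam * Z - N%:R * (expR lam - 1) * mu l cur) *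
     (phiZ nu lam l cur x0 / lapZ nu lam l cur) *
     (expR (lam * Zsamp l x0 (x t)) / phiZ nu lam l cur x0))); last first.
    by rewrite ler_wpM2r// divr_ge0 ?expR_ge0// ltW.
  have -> : expR (lam * Z - N%:R * (expR lam - 1) * mu l cur) *
     (phiZ nu lam l cur x0 / lapZ nu lam l cur) *
     (expR (lam * Zsamp l x0 (x t)) / phiZ nu lam l cur x0) =
     expR (lam * Z' - N%:R * (expR lam - 1) * mu l cur) / lapZ nu lam l cur.
    have -> : lam * Z' - N%:R * (expR lam - 1) * mu l cur =
      (lam * Z - N%:R * (expR lam - 1) * mu l cur) + lam * Zsamp l x0 (x t).
      by rewrite /Z'; ring.
    by rewrite [in RHS]expRD; field; rewrite !gt_eqF.
  rewrite ler_pdivlMr//; apply: (@le_trans _ _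
     (expR (lam * Z' - N.+1%:R * (expR lam - 1) * mu l cur) *
      expR ((expR lam - 1) * mu l cur))).
    by rewrite ler_wpM2l ?expR_ge0// lapZ_le.
  rewrite -expRD ler_expR le_eqVlt; apply/orP; left; apply/eqP.
  by rewrite -natr1; ring.
rewrite -/(Zsamp l x0 (x t)) -/Z' in stE1.
have hR2 : regret t.+1 <= l.-1%:R * B +
   8 * e l * ((size dn)%:R * (8 * U1 l / e l) + 2 * N.+1%:R).
  apply: (le_trans hR1); apply: (le_trans (lerD hR (lexx _))).
  rewrite -addrA lerD2l -{2}[8 * e l]mulr1 -mulrDr /= ler_wpM2l//.
    by rewrite mulr_ge0// ltW// eps_gt0.
  by rewrite -!addrA lerD2l -[N.+1%:R]natr1; lra.
case: ltP stE1 => UZ stE1.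
  rewrite /run_inv stE1; split => //=; split => //.
  - by split => // lam; rewrite mulr1.
  - by rewrite addr0.
have Z'U : Z' <= U1 l + 1.
  by rewrite /Z'; have /andP[_] := Zsamp_bound l _ _ x0b (xb t); lra.
(* The estimation of rank [size dn] is over, so its test has its final value and the good event
   applies already at round [t.+1]. *)
have pst : past_est l (size dn) (st t.+1).
  rewrite /past_est stE1; case: (todo) => [|a todo'] /=.
    rewrite begin_play_phase eqxx /vase_begin_play; case: flatten => *; by rewrite orbT.
  by rewrite eqxx size_rcons ltnSn orbT.
have [okc cnt] := est_accuracy l cur N Z' _ _ l0 UZ Z'U (H (2 / 5))
  (frozen_est l _ _ _ lT dnD (or_introl erefl) tT pst) (H (- 1))
  (frozen_est l _ _ _ lT dnD (or_intror erefl) tT pst).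
have hR3 : regret t.+1 <= l.-1%:R * B +
   8 * e l * ((size dn).+1%:R * (8 * U1 l / e l)).
  apply: (le_trans hR2); rewrite lerD2l ler_wpM2l//.
    by rewrite mulr_ge0// ltW// eps_gt0.
  have -> : (size dn).+1%:R = (size dn)%:R + 1 :> R by rewrite natr1.
  by rewrite (mulrDl (size dn)%:R 1) lerD2l (mul1r (_ / e l)).
have ok' p : p \in rcons dn (cur, U1 l / N.+1%:R) -> okest l p.
  by rewrite mem_rcons inE => /orP[/eqP ->//|]; exact: ok.
case: todo spE stE stE1 => [|a todo] spE stE stE1.
  apply: (begin_inv _ _ _ _ stE1) => //.
    by rewrite map_rcons -spE cats1.
  apply: (le_trans hR3); rewrite lerD2l ler_wpM2l//.
    by rewrite mulr_ge0// ltW// eps_gt0.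
  rewrite ler_wpM2r ?ler_nat// divr_ge0 ?(ltW (eps_gt0 l))// mulr_ge0//.
  by have := U1_gt1 l l0; lra.
rewrite /run_inv stE1; split => //=; split => //.
- by rewrite map_rcons cat_rcons.
- by split => //; have := U1_gt1 l l0; lra.
- split => //.
    move=> lam; rewrite size_rcons hEj1// !mulr1 mulr0 !mul0r subr0.
    by rewrite expR0.
  by move=> j lam; rewrite size_rcons => jd; apply: hEj1; exact: ltnW.
- by rewrite size_rcons mulr0 !addr0.
Qed.

Lemma total_mx_cons (V : 'M[R]_d) p rest :
  total_mx (V + p.2^-1 *: (p.1^T *m p.1)) rest = total_mx V (p :: rest).
Proof. by rewrite /total_mx big_cons addrA. Qed.

(** Cauchy-Schwarz for the final matrix bounds the mixed leverage of [a] and [p.1] by their common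
    leverage bound; [coef_arith] does the rest. *)
Lemma play_coef_bound (V : 'M[R]_d) (sched : seq ('rV[R]_d * R))
    (p : 'rV[R]_d * R) (a : 'rV[R]_d) (lam : R) (l : nat) : psd (total_mx V sched) ->
  (p.1 <= total_mx V sched)%MS -> (a <= total_mx V sched)%MS -> (0 < l)%N ->
  qform (pinvmx (total_mx V sched)) p.1 <= e l ^+ 2 / (49 * L l) ->
  qform (pinvmx (total_mx V sched)) a <= e l ^+ 2 / (49 * L l) ->
  e l / 4 <= p.2 -> lam = lamX l \/ lam = - lamX l ->
  `|play_coef lam a V sched p| <= 1 / 4.
Proof.
set W := total_mx V sched => pW pc ac l0 hp ha p2 hlam.
have L2 := logdelta_ge K delta l K0 l0 delta01; have e0 : 0 < e l := eps_gt0 l.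
have p20 : 0 < p.2 by apply: lt_le_trans p2; rewrite divr_gt0.
have lx0 : 0 <= lamX l.
  have L0 : 0 <= L l by apply: le_trans L2; rewrite divr_ge0.
  by rewrite divr_ge0 ?mulr_ge0// ltW.
rewrite /play_coef -/W normrM normrM.
have -> : `|lam| = lamX l by case: hlam => ->; rewrite ?normrN ger0_norm.
rewrite (ger0_norm (x := p.2^-1)) ?invr_ge0 ?(ltW p20)//.
apply: coef_arith => //.
have pE : p.1 = p.1 *m pinvmx W *m W by rewrite mulmxKpV.
have w1 : dotv (a *m pinvmx W) p.1 = dotv (a *m pinvmx W *m W) (p.1 *m pinvmx W).
  by rewrite [in RHS]dotv_mull (proj1 pW) -pE.
have cs := psd_cauchy W (a *m pinvmx W) (p.1 *m pinvmx W) pW.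
rewrite -w1 mulmxKpV// in cs; rewrite mulmxKpV// in cs.
have qa : dotv a (a *m pinvmx W) = qform (pinvmx W) a by rewrite qformE dotvC.
have qp : dotv p.1 (p.1 *m pinvmx W) = qform (pinvmx W) p.1 by rewrite qformE dotvC.
rewrite qa qp in cs.
have qa0 : 0 <= qform (pinvmx W) a.
  by rewrite -qa -{1}(mulmxKpV ac); exact: (proj2 pW).
have qp0 : 0 <= qform (pinvmx W) p.1.
  by rewrite -qp -{1}(mulmxKpV pc); exact: (proj2 pW).
set y := e l ^+ 2 / _ in ha hp *.
have y0 : 0 <= y by exact: le_trans ha.
rewrite -ler_sqr ?nnegrE// real_normK ?num_real//.
by apply: (le_trans cs); rewrite expr2; apply: ler_pM.
Qed.

(** The Laplace bound charges [2 * c ^+ 2 * s2 p.1]. The true variance is at most four times the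
    estimate, so this is at most [8 * lam ^+ 2] times the increment of [dotv (xa *m V) xa]: the
    origin of the 8. *)
Lemma play_factor_ge (V : 'M[R]_d) (b : 'rV[R]_d) (sched : seq ('rV[R]_d * R))
    (p : 'rV[R]_d * R) (a : 'rV[R]_d) (lam c y : R) (xa : 'rV[R]_d) : 0 < p.2 -> p.1 \in A ->
  s2 p.1 <= 4 * p.2 ->
  xa = a *m pinvmx (total_mx V sched) ->
  c = play_coef lam a V sched p -> `|c| <= 1 / 4 ->
  forall m0 : R, expR (lam * (dotv xa b - dotv (xa *m V) th)
           - 8 * lam ^+ 2 * dotv (xa *m V) xa) <= m0 ->
  expR (lam * (dotv xa (b + (p.2^-1 * y) *: p.1) -
               dotv (xa *m (V + p.2^-1 *: (p.1^T *m p.1))) th)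
     - 8 * lam ^+ 2 * dotv (xa *m (V + p.2^-1 *: (p.1^T *m p.1))) xa) <=
  m0 * (expR (c * y) / lapX nu c p.1).
Proof.
move=> p20 pA sp xaE cE c4 m0 hm.
have cE' : c = lam * (p.2^-1 * dotv xa p.1) by rewrite cE xaE.
apply: (@le_trans _ _ (expR (lam * (dotv xa b - dotv (xa *m V) th)
           - 8 * lam ^+ 2 * dotv (xa *m V) xa) * (expR (c * y) / lapX nu c p.1))); last first.
  by rewrite ler_wpM2r// divr_ge0 ?expR_ge0 ?lapX_ge0.
rewrite mulrA ler_pdivlMr ?lapX_gt0//.
apply: (@le_trans _ _ (expR (lam * (dotv xa (b + (p.2^-1 * y) *: p.1) -
               dotv (xa *m (V + p.2^-1 *: (p.1^T *m p.1))) th)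
     - 8 * lam ^+ 2 * dotv (xa *m (V + p.2^-1 *: (p.1^T *m p.1))) xa) *
     expR (c * dotv p.1 th + 2 * c ^+ 2 * s2 p.1))).
  by rewrite ler_wpM2l ?expR_ge0//; exact: (lapX_le nu p.1 _ _ (arm1 _ pA) (arm2 _ pA)).
rewrite -!expRD ler_expR.
rewrite dotvDr dotvZr !mulmxDr -!scalemxAr !dotvDl !dotvZl !dotv_rank1.
rewrite (dotvC p.1 xa).
have hs : 2 * c ^+ 2 * s2 p.1 <= 8 * lam ^+ 2 * (p.2^-1 * dotv xa p.1 ^+ 2).
  apply: (@le_trans _ _ (2 * c ^+ 2 * (4 * p.2))).
    by rewrite ler_wpM2l// mulr_ge0// sqr_ge0.
  rewrite le_eqVlt; apply/orP; left; apply/eqP; rewrite cE'.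
  by field; rewrite gt_eqF.
have -> : c * dotv p.1 th = lam * (p.2^-1 * dotv xa p.1) * dotv p.1 th by rewrite -cE'.
have -> : c * y = lam * (p.2^-1 * dotv xa p.1) * y by rewrite -cE'.
move: hs.
move: (dotv xa b) (dotv (xa *m V) th) (dotv (xa *m V) xa) (dotv xa p.1) (dotv p.1 th)
  (s2 p.1) (p.2^-1) => u1 u2 u3 u4 u5 u6 u7.
move: (2 * c ^+ 2 * u6) => q hq; lra.
Qed.

Lemma play_step t l Al sched V b : (t < T)%N ->
  st t = VState l Al (Play sched V b) -> phase_inv t l Al ->
  play_inv t l Al sched V b -> run_inv t.+1.
Proof.
move=> tT stE pI [n [nf [sched0 [nfE nt] [nf1 nf2] [pW bW cW hs hM] hR]]].
have pI1 : phase_inv t.+1 l Al by apply: phase_inv_step => //; rewrite stE.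
have lT : (0 < l <= T.+1)%N by apply: phase_le pI (ltnW tT).
have lT1 := lT.
have [l0 _ AlA sA [gap hE hP]] := pI.
case: sched sched0 stE nfE pW bW cW hs hM => // p rest _ stE nfE pW bW cW hs hM.
have [pAl sp p2] := hs p (mem_head _ _).
have e0 : 0 < e l := eps_gt0 l.
have p20 : 0 < p.2 by apply: lt_le_trans p2; rewrite divr_gt0.
have hR1 : regret t.+1 <= l.-1%:R * B + 8 * e l * (D%:R * (8 * U1 l / e l) + n.+1%:R).
  apply: (@le_trans _ _ (regret t + 8 * e l)).
    by apply: regret_step pI _; rewrite stE /vase_action/=; case: (p) pAl.
  apply: (le_trans (lerD hR (lexx _))).
  have -> : n.+1%:R = n%:R + 1 :> R by rewrite natr1.
  by rewrite addrA (mulrDr _ _ 1) mulr1 addrA.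
have stE1 := stS t; rewrite stE /vase_step/= in stE1.
set V' := V + p.2^-1 *: (p.1^T *m p.1).
set b' := b + (p.2^-1 * x t) *: p.1.
have {}stE1 : st t.+1 = match rest with
    | [::] => vase_end_phase design l Al V' b'
    | _ => VState l Al (Play rest V' b') end.
  by rewrite stE1 /V' /b'; case: (p).
have totE : total_mx V' rest = total_mx V (p :: rest) by exact: total_mx_cons.
have bW' : (b' <= total_mx V' rest)%MS.
  by rewrite totE addmx_sub// scalemx_sub//; exact: (cW _ pAl).1.
have hM' a lam : a \in Al -> lam = lamX l \/ lam = - lamX l ->
    let xa := a *m pinvmx (total_mx V' rest) in
    expR (lam * (dotv xa b' - dotv (xa *m V') th)
       - 8 * lam ^+ 2 * dotv (xa *m V') xa) <= MP l lam a t.+1.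
  move=> aA hlam; rewrite totE.
  rewrite run_martS stE /play_factor/= eqxx.
  apply: (play_factor_ge V b (p :: rest) p a lam) => //; first exact: AlA.
    apply: (play_coef_bound _ _ _ _ _ l) => //.
    - exact: (cW _ pAl).1.
    - exact: (cW _ aA).1.
    - exact: (cW _ pAl).2.
    - exact: (cW _ aA).2.
  exact: hM.
case: rest stE hs nfE pW bW cW hM stE1 totE bW' hM' =>
  [|q rest] stE hs nfE pW bW cW hM stE1 totE bW' hM'; last first.
  rewrite /run_inv stE1; split => //=; exists n.+1, nf; split => //.
  - by split; [rewrite -nfE /= addSnnS|].
  - split => //; rewrite ?totE//.
    by move=> r rr; apply: hs; rewrite inE rr orbT.
have nfn : nf = n.+1 by rewrite -nfE addn1.
have V'E : V' = total_mx V' [::] by rewrite /total_mx big_nil addr0.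
rewrite -totE -V'E in pW bW cW; rewrite -V'E in bW' hM'.
have L2 := logdelta_ge K delta l K0 l0 delta01.
have dl0 := delta_l_gt0 K delta l K0 l0 delta01.
have err a : a \in Al -> `|dotv a (b' *m pinvmx V') - dotv a th| <= 17 / 21 * e l.
  move=> aA; have [cA qA] := cW _ aA.
  apply: (estimator_error V' b' th (e l) (L l) e0 L2 pW bW' a cA qA) => lam hlam.
  apply: (le_lt_trans (hM' a lam aA hlam)).
  rewrite expR_logdelta// -[X in _ < X]mul1r ltr_pdivlMr// mulrC.
  apply: frozen_play => //; first exact: AlA.
  by rewrite /past_play stE1 /vase_end_phase start_phase_phase.
have eS : e l.+1 = e l / 2 by rewrite /eps_l exprS invfM mulrC.
set An := [seq a <- Al | all (fun b0 => dotv (b0 - a) (b' *m pinvmx V') <= 2 * e l) Al].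
have stE2 : st t.+1 = vase_start_phase design l.+1 An by rewrite stE1.
have AnAl a : a \in An -> a \in Al by rewrite mem_filter => /andP[].
have Rl : regret t.+1 <= l%:R * B.
  apply: (le_trans hR1).
  apply: (le_trans (lerD (lexx _) (B2 l n.+1 lT1 _ _))).
  - exact: leq_ltn_trans nt tT.
  - by rewrite -nfn.
  - by rewrite -{2}[B]mul1r -mulrDl natr1 prednK.
apply: (start_inv _ _ _ stE2) => //.
- split => //.
  + by rewrite /=; apply: (leq_trans nf1); rewrite nfn leqW.
  + by move=> a /AnAl; exact: AlA.
  + rewrite mem_filter sA andbT; apply/allP => b0 b0A.
    rewrite dotvBl.
    have := err _ b0A; have := err _ sA; have := opt _ (AlA _ b0A).
    rewrite !ler_norml => h1 /andP[h2 h3] /andP[h4 h5].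
    exact: (elim_arith1 _ _ _ _ _ e0 h1 h2 h5).
  split.
  + move=> a aAn; have aA := AnAl _ aAn.
    move: aAn; rewrite mem_filter => /andP[/allP/(_ _ sA) + _].
    rewrite !dotvBl eS.
    have := err _ aA; have := err _ sA.
    rewrite !ler_norml => /andP[h2 h3] /andP[h4 h5] h6.
    exact: (elim_arith2 _ _ _ _ _ e0 h2 h5 h6).
  + by move=> l' j lam ll'; have [_ _ _ _ [_ + _]] := pI1; apply; exact: ltnW.
  + by move=> l' lam a ll'; have [_ _ _ _ [_ _ +]] := pI1; apply; exact: ltnW.
- by move=> j lam; have [_ _ _ _ [_ + _]] := pI1; apply.
- by move=> lam a; have [_ _ _ _ [_ _ +]] := pI1; apply.
Qed.

Lemma inv0 : run_inv 0.
Proof.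
apply: (start_inv 0 1 A st0).
- split => //; split => //.
  + move=> a aA; rewrite dotvBl.
    have := arm_mean_norm nu a _ (arm1 _ aA).
    have := arm_mean_norm nu astar _ (arm1 _ astarA).
    rewrite !ler_norml => /andP[h1 h2] /andP[h3 h4].
    have -> : e 1 = 1 / 2 :> R by rewrite /eps_l expr1 div1r.
    exact: (gap_arith _ _ h2 h3).
  + by move=> l' j lam _; rewrite /run_mart big_ord0.
  + by move=> l' lam a _; rewrite /run_mart big_ord0.
- by move=> j lam; rewrite /run_mart big_ord0.
- by move=> lam a; rewrite /run_mart big_ord0.
- by rewrite /regret big_ord0 mul0r.
Qed.

Lemma run_invP t : (t <= T)%N -> run_inv t.
Proof.
elim: t => [|t IH] tT; first exact: inv0.
have [pI mI] := IH (ltnW tT).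
case E : (st t) pI mI => [l Al [todo cur o Z N dn|sched V b|]] /= pI mI.
- exact: est_step tT E pI mI.
- exact: play_step tT E pI mI.
- by [].
Qed.

Lemma run_action t : (t <= T)%N -> vase_action (st t) \in A.
Proof.
move=> tT; have [pI mI] := run_invP t tT; move: pI mI.
case: (st t) => l Al [todo cur o Z N dn|sched V b|] //=.
  move=> [_ _ AlA _ _] [spE _ _ _ _]; apply/AlA/supp_sub.
  by rewrite -spE mem_cat mem_head orbT.
move=> [_ _ AlA _ _] [n [nf [s0 _ _ [_ _ _ hs _] _]]].
case: sched s0 hs => // p rest _ hs; have [pA _ _] := hs p (mem_head _ _).
by rewrite /vase_action/=; case: (p) pA => a s aA; exact: AlA.
Qed.

Lemma run_regret : exists l, [/\ (0 < l)%N, (2 ^ l.-1 <= T.+1)%N &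
  regret T <= l%:R * B].
Proof.
have [pI mI] := run_invP T (leqnn T).
exists (vs_phase (st T)).
have lT := phase_le _ _ _ pI (leqnn T).
have [l0 lp AlA sA _] := pI; split => //.
set l := vs_phase (st T) in l0 lT pI mI lp *.
have lB X : regret T <= l.-1%:R * B + X -> X <= B -> regret T <= l%:R * B.
  move=> h1 h2; apply: (le_trans h1); apply: (le_trans (lerD (lexx _) h2)).
  by rewrite -{2}[B]mul1r -mulrDl natr1 prednK.
have e0 : 0 < e l := eps_gt0 l.
case E : (vs_mode (st T)) mI => [todo cur o Z N dn|sched V b|] // mI.
- have [spE ok [ZU x0b] [hE _ _] hR] := mI.
  have Al0 : vs_active (st T) != [::] by apply: contraTneq sA => ->.
  have [optA szA] := designP _ AlA Al0.
  have dnD : (size dn < D)%N.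
    by apply: leq_trans szA; rewrite -spE size_cat size_map /= addnS ltnS leq_addr.
  have g := gamma_bounds delta l l0 delta01 d d0.
  have m0 := muZ_ge_eps nu cur l.
  have mp : 0 < mu l cur by apply: lt_le_trans m0; rewrite divr_gt0.
  (* The horizon cut this estimation, and the good event is stated there. A pending factor may cost
     [expR (- 1)], paid by replacing [Z] with [Z + 1], which is still at most [U1 l + 1]. *)
  have hN : N%:R * mu l cur <= 2 * U1 l.
    have h1 : expR (-1 * (Z + 1) - N%:R * (expR (- 1) - 1) * mu l cur) <=
       ME l (size dn) (-1) T.
      apply: le_trans (hE (- 1)).
      have -> : -1 * (Z + 1) - N%:R * (expR (- 1) - 1) * mu l cur =
         (-1 * Z - N%:R * (expR (- 1) - 1) * mu l cur) + - 1 by ring.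
      rewrite expRD ler_wpM2l ?expR_ge0//.
      case: (o) x0b => [x0|] x0b; last by rewrite expR_le1 lerN10.
      have lp0 := lapZ_gt0 nu cur l (- 1).
      rewrite ler_pdivlMr//.
      have /andP[+ _] := phiZ_bound nu cur l (- 1) _ (x0b _ erefl).
      rewrite normrN1; apply: le_trans.
      by rewrite -[leRHS]mulr1 ler_wpM2l ?expR_ge0// lapZ_neg_le1.
    apply: (SR_lower _ g _ _ _ mp _ _ h1); first by rewrite lerD2r ltW.
    by apply: goodE => //; right.
  apply: (lB _ hR); apply: le_trans (B1 l lT); rewrite ler_wpM2l//.
    by rewrite mulr_ge0// ltW.
  have N4 : 2 * N%:R <= 8 * U1 l / e l.
    rewrite ler_pdivlMr//.
    have : N%:R * (e l / 2) <= 2 * U1 l by apply: le_trans hN; rewrite ler_wpM2l.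
    by move: (N%:R) (U1 l) (e l) => q1 q2 q3; lra.
  have o1 : (isSome o)%:R <= 2 :> R by case: (o) => [?|]; rewrite /= ?ler0n// ler_nat.
  have DE : (size dn).+1%:R <= D%:R :> R by rewrite ler_nat.
  have Y0 : 0 <= 8 * U1 l / e l by apply: le_trans N4; rewrite mulr_ge0.
  move: DE Y0 N4 o1; rewrite -natr1.
  move: (8 * U1 l / e l) (D%:R) ((size dn)%:R) (ler0n R (size dn)) (2 * N%:R) ((isSome o)%:R).
  move=> Y D' z z0 q r DE Y0 N4 o1.
  apply: (@le_trans _ _ ((z + 1) * (Y + 2))); first by lra.
  by rewrite ler_wpM2r// addr_ge0.
- have [n [nf [_ [nfE nT] [_ nf2] _ hR]]] := mI.
  apply: (lB _ hR); apply: B2 => //; apply: le_trans nf2.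
  by rewrite ler_nat -nfE leq_addr.
Qed.

End Run.

(** * Size of the regret bound *)

Section PhaseBound.
Context {R : realType}.
Variables (d K T : nat) (delta M H : R).
Hypotheses (d0 : (0 < d)%N) (K0 : (0 < K)%N) (delta01 : 0 < delta < 1).
Hypotheses (M0 : 0 <= M) (H2 : 1 / 2 <= H).
Let D := ((d * d.+1) %/ 2)%N.
Let Y : R := expR 1 + d%:R + K%:R + T%:R + delta^-1.
Let Lam := ln Y.
Let S := Num.sqrt (d%:R * T%:R * H * M).
Let B := 18000 * Lam * ((d ^ 2)%:R + S).
Local Notation e l := (eps_l R l).
Local Notation L l := (ln ((delta_l K delta l)^-1)).
Local Notation U1 l := (SR_Upsilon1 (1 / 2) (gamma_l d delta l)).

Lemma delta_inv_ge1 : 1 <= delta^-1.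
Proof. by have /andP[dp d1] := delta01; rewrite -[leLHS]invr1 lef_pV2 ?posrE// ltW. Qed.

Lemma scale_bounds : [/\ d.+1%:R <= Y, K%:R <= Y, T.+2%:R <= Y, delta^-1 <= Y & expR 1 <= Y].
Proof.
have e2 : 2 <= expR 1 :> R by apply: le_trans expR1_ge; lra.
rewrite /Y -[d.+1%:R]natr1 -[T.+2%:R]natr1 -[T.+1%:R]natr1.
move: e2 delta_inv_ge1 (ler0n R d) (ler0n R K) (ler0n R T).
by move: (expR 1) (delta^-1) d%:R K%:R T%:R => a b c g h *; split; lra.
Qed.

Lemma scale_gt0 : 0 < Y.
Proof. by have [_ _ _ _] := scale_bounds; apply: lt_le_trans; exact: expR_gt0. Qed.

Lemma Lam_ge1 : 1 <= Lam.
Proof.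
have [_ _ _ _ h] := scale_bounds.
by rewrite -[1](expRK 1) ler_ln ?posrE ?expR_gt0 ?scale_gt0.
Qed.

(** Quantities under a logarithm are products of factors at most [Y], and [n] counts them: four for
    the inverse of [delta_l], five for [2 / gamma_l]. *)
Lemma ln_le_Lam (x : R) (n : nat) : 0 < x -> x <= Y ^+ n -> ln x <= n%:R * Lam.
Proof.
move=> x0 xY; rewrite mulr_natl -lnXn ?scale_gt0//.
by rewrite ler_ln// posrE exprn_gt0 ?scale_gt0.
Qed.

Section Phase.
Variable l : nat.
Hypothesis lT : (0 < l <= T.+1)%N.

Lemma phase_scale : l%:R <= Y /\ l.+1%:R <= Y.
Proof.
have /andP[l0 l1] := lT; have [_ _ h _ _] := scale_bounds.
split; apply: le_trans h; rewrite ler_nat; first exact: leqW.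
by rewrite ltnS.
Qed.

Lemma L_le : L l <= 4 * Lam.
Proof.
have /andP[l0 l1] := lT; have /andP[dp d1] := delta01.
apply: (ln_le_Lam _ 4%N).
  by rewrite invr_gt0 delta_l_gt0.
have [h1 h2] := phase_scale; have [_ h3 _ h4 _] := scale_bounds.
rewrite /delta_l invf_div mulrC !exprS expr0 mulr1.
rewrite ler_pM ?invr_ge0 ?(ltW dp) ?mulr_ge0// -mulrA.
by rewrite !ler_pM ?mulr_ge0.
Qed.

(** 241 is [1 + 48 * 5], the 1 being at most [Lam]. *)
Lemma U1_le : U1 l <= 241 * Lam.
Proof.
have /andP[l0 l1] := lT; have /andP[dp d1] := delta01.
have g := gamma_bounds delta l l0 delta01 d d0.
apply: (le_trans (SR_Upsilon1_le _ g)).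
have : ln (2 / gamma_l d delta l) <= 5%:R * Lam.
  apply: ln_le_Lam; first by rewrite divr_gt0//; case/andP: g.
  have [h1 h2] := phase_scale; have [h3 _ _ h4 _] := scale_bounds.
  have -> : 2 / gamma_l d delta l = delta^-1 * (l%:R * l.+1%:R * d%:R * d.+1%:R).
    by rewrite /gamma_l invf_div; field; rewrite gt_eqF.
  have h5 : d%:R <= Y by apply: le_trans h3; rewrite ler_nat.
  rewrite !exprS expr0 mulr1 ler_pM ?invr_ge0 ?(ltW dp) ?mulr_ge0// -!mulrA.
  by rewrite !ler_pM ?mulr_ge0.
have := Lam_ge1; move: (ln _) Lam => x y; lra.
Qed.

Lemma D_le : D%:R <= (d ^ 2)%:R :> R.
Proof.
rewrite ler_nat /D; apply: (@leq_trans ((d * (d + d)) %/ 2)).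
  by apply: leq_div2r; rewrite leq_mul2l -addn1 leq_add2l d0 orbT.
by rewrite addnn -muln2 mulnA mulnK.
Qed.

Lemma S_ge0 : 0 <= S. Proof. exact: sqrtr_ge0. Qed.

Lemma eps_bounds : 0 < e l <= 1 / 2.
Proof.
have /andP[l0 _] := lT; rewrite eps_gt0 /=.
case: (l) l0 => // m _; rewrite /eps_l exprS invfM div1r ler_piMr//.
by rewrite invf_le1 ?exprn_gt0// exprn_ege1// ler1n.
Qed.

Lemma U1_ge0 : 0 <= U1 l.
Proof.
have /andP[l0 _] := lT; have g := gamma_bounds delta l l0 delta01 d d0.
by apply: le_trans (SR_Upsilon1_ge _ g); have := SR_ell_ge _ g; lra.
Qed.

Lemma L_ge0 : 0 <= L l.
Proof.
have /andP[l0 _] := lT; apply: le_trans (logdelta_ge K delta l K0 l0 delta01).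
by rewrite divr_ge0.
Qed.

Lemma phase_bound1 : 8 * e l * (D%:R * (8 * U1 l / e l + 2)) <= B.
Proof.
have /andP[ep e12] := eps_bounds.
have -> : 8 * e l * (D%:R * (8 * U1 l / e l + 2)) = D%:R * (64 * U1 l + 16 * e l).
  by field; rewrite gt_eqF.
(* 15432 is [64 * 241 + 8], using [e l <= 1 / 2] and [1 <= Lam]. *)
apply: (@le_trans _ _ ((d ^ 2)%:R * (15432 * Lam))).
  apply: ler_pM D_le _ => //.
    by rewrite addr_ge0// mulr_ge0 ?U1_ge0// ltW.
  by move: Lam_ge1 U1_le e12; move: (U1 l) (e l) Lam => x y z; lra.
have Lam0 : 0 <= Lam by apply: le_trans Lam_ge1.
have Sp : 0 <= Lam * S by rewrite mulr_ge0// S_ge0.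
have dp : 0 <= Lam * (d ^ 2)%:R by rewrite mulr_ge0.
rewrite /B mulrDr -!mulrA mulrCA; move: Sp dp; rewrite (mulrC _ Lam).
move: (Lam * S) (Lam * (d ^ 2)%:R) => x y; lra.
Qed.

(** The variance term is at most [74 d L / e], whose denominator cancels. Then [8 e D <= 4 d^2] and
    [592 d L <= 2368 Lam d^2] add up to 2372. *)
Lemma small_variance_plays n : M <= e l ->
  n%:R <= D%:R + 37 * d%:R * L l * (M + e l) / e l ^+ 2 ->
  8 * e l * n%:R <= 2372 * Lam * (d ^ 2)%:R.
Proof.
have /andP[ep e12] := eps_bounds => Me hn.
have hn' : n%:R <= D%:R + 74 * d%:R * L l / e l.
  apply: (le_trans hn); rewrite lerD2l.
  have -> : 74 * d%:R * L l / e l = 37 * d%:R * L l * (e l + e l) / e l ^+ 2.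
    by field; rewrite gt_eqF.
  rewrite ler_wpM2r ?invr_ge0 ?exprn_ge0 ?(ltW ep)// ler_wpM2l ?mulr_ge0 ?L_ge0//.
  by rewrite lerD2r.
have {hn'} : 8 * e l * n%:R <= 8 * e l * (D%:R + 74 * d%:R * L l / e l).
  by rewrite ler_wpM2l// mulr_ge0// ltW.
move/le_trans; apply.
have -> : 8 * e l * (D%:R + 74 * d%:R * L l / e l) = 8 * e l * D%:R + 592 * (d%:R * L l).
  by field; rewrite gt_eqF.
have dL : d%:R * L l <= (d ^ 2)%:R * (4 * Lam).
  by rewrite ler_pM ?L_ge0 ?L_le// ler_nat -{1}(expn1 d) leq_pexp2l.
have eD : e l * D%:R <= 1 / 2 * (d ^ 2)%:R.
  by rewrite ler_pM ?(ltW ep) ?D_le.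
have dLam : (d ^ 2)%:R <= (d ^ 2)%:R * Lam by rewrite ler_peMr// Lam_ge1.
rewrite -!mulrA; move: dL eD dLam; rewrite mulrCA (mulrC Lam).
move: (d%:R * L l) (e l * D%:R) ((d ^ 2)%:R * Lam) (d ^ 2)%:R => x1 x2 x3 x4; lra.
Qed.

(* The excess [n - D] over the rounding is at most [T] and at most
   [74 d L M / e^2]; their geometric mean is free of [e] after multiplying by it. *)
Lemma large_variance_plays n : e l <= M -> (n <= T)%N ->
  n%:R <= D%:R + 37 * d%:R * L l * (M + e l) / e l ^+ 2 ->
  8 * e l * n%:R <= 4 * (d ^ 2)%:R + 200 * Lam * S.
Proof.
have /andP[ep e12] := eps_bounds => Me nT hn.
have Lam1 := Lam_ge1; have Lam0 : 0 <= Lam by apply: le_trans Lam1.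
have hx : e l * (n%:R - D%:R) <= 25 * Lam * S.
  have [nD|Dn] := lerP n%:R (D%:R : R).
    apply: (@le_trans _ _ 0); last by rewrite !mulr_ge0 ?S_ge0.
    by rewrite mulr_ge0_le0 ?(ltW ep)// subr_le0.
  have m0 : 0 <= n%:R - D%:R :> R by rewrite subr_ge0 ltW.
  rewrite -ler_sqr ?nnegrE ?mulr_ge0 ?S_ge0 ?(ltW ep)//.
  rewrite [leRHS]exprMn sqr_sqrtr ?mulr_ge0 //; last by apply: le_trans H2; rewrite divr_ge0.
  have h1 : n%:R - D%:R <= T%:R :> R.
    by apply: (@le_trans _ _ n%:R); rewrite ?ler_nat// gerBl.
  have h2 : n%:R - D%:R <= 74 * d%:R * L l * M / e l ^+ 2.
    rewrite lerBlDl; apply: (le_trans hn); rewrite lerD2l.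
    rewrite ler_wpM2r ?invr_ge0 ?exprn_ge0 ?(ltW ep)//.
    have -> : 74 * d%:R * L l * M = 37 * d%:R * L l * (M + M) by ring.
    by rewrite ler_wpM2l ?mulr_ge0 ?L_ge0// lerD2l.
  have h3 : (e l * (n%:R - D%:R)) ^+ 2 <= 74 * (d%:R * T%:R * L l * M).
    have -> : 74 * (d%:R * T%:R * L l * M) =
        e l ^+ 2 * (T%:R * (74 * d%:R * L l * M / e l ^+ 2)).
      by field; rewrite gt_eqF.
    by rewrite exprMn ler_wpM2l ?exprn_ge0 ?(ltW ep)// expr2 ler_pM.
  apply: (le_trans h3).
  have h4 : L l <= 8 * Lam * H.
    apply: (le_trans L_le); have -> : 4 * Lam = 8 * Lam * (1 / 2) by lra.
    by rewrite ler_wpM2l// mulr_ge0.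
  have h5 : d%:R * T%:R * L l * M <= d%:R * T%:R * (8 * Lam * H) * M.
    by rewrite ler_wpM2r// ler_wpM2l// mulr_ge0.
  have h6 : Lam <= Lam ^+ 2 by rewrite expr2 ler_peMr.
  set G := d%:R * T%:R * H * M.
  have G0 : 0 <= G by rewrite !mulr_ge0//; apply: le_trans H2; rewrite divr_ge0.
  have h7 : Lam * G <= Lam ^+ 2 * G by rewrite ler_wpM2r.
  move: h5; have -> : d%:R * T%:R * (8 * Lam * H) * M = 8 * (Lam * G) by rewrite /G; ring.
  (* 25 is taken because [74 * 8 = 592 <= 625]. *)
  have -> : (25 * Lam) ^+ 2 * G = 625 * (Lam ^+ 2 * G) by ring.
  have LG0 : 0 <= Lam ^+ 2 * G by rewrite mulr_ge0// exprn_ge0.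
  move: h7 LG0; move: (Lam * G) (Lam ^+ 2 * G) (d%:R * T%:R * L l * M) => x y z; lra.
have eD : e l * D%:R <= 1 / 2 * (d ^ 2)%:R.
  by rewrite ler_pM ?(ltW ep) ?D_le.
move: hx; rewrite mulrBr -!mulrA.
move: eD; move: (e l * D%:R) (e l * n%:R) (Lam * S) (d ^ 2)%:R => x y z u; lra.
Qed.

(** 18000 exceeds [64 * 241 + 2372], the coefficients of [Lam * d^2] from variance estimation and
    from the main plays. *)
Lemma phase_bound2 n : (n <= T)%N ->
  n%:R <= D%:R + 37 * d%:R * L l * (M + e l) / e l ^+ 2 ->
  8 * e l * (D%:R * (8 * U1 l / e l) + n%:R) <= B.
Proof.
move=> nT hn; have /andP[ep e12] := eps_bounds.
have Lam1 := Lam_ge1; have Lam0 : 0 <= Lam by apply: le_trans Lam1.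
have -> : 8 * e l * (D%:R * (8 * U1 l / e l) + n%:R) =
    64 * (D%:R * U1 l) + 8 * e l * n%:R.
  by field; rewrite gt_eqF.
have h1 : D%:R * U1 l <= (d ^ 2)%:R * (241 * Lam).
  by rewrite ler_pM ?D_le ?U1_le ?U1_ge0.
have h2 : 8 * e l * n%:R <= 2372 * Lam * (d ^ 2)%:R + 200 * Lam * S.
  have [Me|eM] := lerP M (e l).
    apply: (le_trans (small_variance_plays n Me hn)).
    by rewrite lerDl !mulr_ge0 ?S_ge0.
  apply: (le_trans (large_variance_plays n (ltW eM) nT hn)).
  rewrite lerD2r ler_wpM2r//; move: Lam1; move: Lam => x; lra.
have Sp : 0 <= Lam * S by rewrite mulr_ge0// S_ge0.
have dp : 0 <= Lam * (d ^ 2)%:R by rewrite mulr_ge0.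
have -> : B = 18000 * (Lam * (d ^ 2)%:R) + 18000 * (Lam * S).
  by rewrite /B mulrDr !mulrA.
move: h1 h2 Sp dp; rewrite mulrCA (mulrC _ Lam) -!mulrA.
move: (D%:R * U1 l) (e l * n%:R) (Lam * S) (Lam * (d ^ 2)%:R) => x y z u; lra.
Qed.

End Phase.

(** [ln 2 >= 1 / 2] gives [l.-1 <= 2 * Lam], and the missing 1 is at most [Lam]. *)
Lemma phase_count l : (0 < l)%N -> (2 ^ l.-1 <= T.+1)%N -> l%:R <= 3 * Lam.
Proof.
move=> l0 hl; have [_ _ hT _ _] := scale_bounds.
have h : ln ((2 : R) ^+ l.-1) <= 1%:R * Lam.
  apply: ln_le_Lam; first by rewrite exprn_gt0.
  by rewrite expr1; apply: le_trans hT; rewrite -natrX ler_nat ltnW.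
move: h; rewrite mul1r lnXn// -(mulr_natr (ln 2)) => h.
have h2 : 1 / 2 * l.-1%:R <= Lam.
  by apply: le_trans h; rewrite ler_wpM2r// ln2_ge.
rewrite -(prednK l0) -natr1.
by move: h2 Lam_ge1; move: (l.-1%:R) Lam => x y; lra.
Qed.

End PhaseBound.

(** * Probability of the good event *)

Section Tests.
Context {R : realType} {d : nat} (nu : probability (@vec R d) R).

Lemma test_est_factor l j lam : test_factor nu (est_factor nu l j lam).
Proof.
split; first exact: est_factor_ge0.
- exact: integral_est_factor_le1.
- by move=> dT T s X ns mX; exact: measurable_est_factor.
Qed.

Lemma test_play_factor l lam a : test_factor nu (play_factor nu l lam a).
Proof.
split; first exact: play_factor_ge0.
- exact: integral_play_factor_le1.
- by move=> dT T s X ns mX; exact: measurable_play_factor.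
Qed.

End Tests.

Lemma sum_inv_mul_succ_le1 {R : realType} n :
  \sum_(l < n) (l.+1%:R * l.+2%:R)^-1 <= 1 :> R.
Proof.
suff -> : \sum_(l < n) (l.+1%:R * l.+2%:R)^-1 = 1 - n.+1%:R^-1 :> R.
  by rewrite gerBl invr_ge0.
elim: n => [|n IH]; first by rewrite big_ord0 invr1 subrr.
rewrite big_ord_recr/= IH -[n.+2%:R]natr1 -[n.+1%:R]natr1.
by field; apply/andP; split; rewrite gt_eqF//; have := ler0n R n; lra.
Qed.

Section GoodEvent.
Context {R : realType} {dd : measure_display} {Om : measurableType dd}.
Context (P : probability Om R) {d : nat} (theta : nat -> Om -> 'rV[R]_d).
Hypothesis iid : iid_vectors P theta.
Variables (delta : R) (design : seq 'rV[R]_d -> 'rV[R]_d -> R).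
Variables (A : seq 'rV[R]_d) (T : nat).
Hypotheses (d0 : (0 < d)%N) (K0 : (0 < size A)%N) (delta01 : 0 < delta < 1).
Let K := size A.
Let D := ((d * d.+1) %/ 2)%N.
Let nu := law P theta iid.
Local Notation lamX l := (7 * ln ((delta_l K delta l)^-1) / (3 * eps_l R l)).

(** Estimations are indexed by their rank in the phase, below the bound [D] on the support, because
    the arm estimated depends on the run. The booleans select one of two values of lambda; [T]
    rounds never lead beyond phase [T.+1]. *)
Definition test_index : finType :=
  ('I_T.+1 * ('I_D * bool + 'I_K * bool))%type.

Definition test_weight (i : test_index) : R :=
  match i.2 with
  | inl _ => gamma_l d delta i.1.+1 / 2
  | inr _ => delta_l K delta i.1.+1
  end.

Definition test_fun (i : test_index) : vase_state R d -> R -> R :=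
  let l := i.1.+1 in
  match i.2 with
  | inl (j, b) => est_factor nu l j (if b then 2 / 5 else - 1)
  | inr (k, b) => play_factor nu l (if b then lamX l else - lamX l) (nth 0 A k)
  end.

Lemma test_weight_ge0 i : 0 <= test_weight i.
Proof.
case: i => l [i|i]; rewrite /test_weight/=.
  by have /andP[g _] := gamma_bounds delta l.+1 isT delta01 d d0; rewrite divr_ge0// ltW.
by rewrite ltW// delta_l_gt0.
Qed.

(** In phase [l] the [2 D] tests of weight [gamma_l / 2] cost at most [delta / (l (l + 1))], as
    [2 D <= d (d + 1)], and the [2 K] tests of weight [delta_l] cost twice that. The sum over phases
    telescopes. *)
Lemma sum_test_weight : \sum_i test_weight i <= 3 * delta.
Proof.
have /andP[dp d1] := delta01.
apply: (@le_trans _ _ (\sum_(l < T.+1) 3 * delta * (l.+1%:R * l.+2%:R)^-1)); last first.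
  by rewrite -mulr_sumr ler_piMr ?sum_inv_mul_succ_le1// mulr_ge0// ltW.
rewrite (eq_bigr (fun i => test_weight (i.1, i.2))); last by case.
rewrite -(pair_bigA _ (fun l c => test_weight (l, c)))/=.
apply: ler_sum => l _; rewrite big_sumType/= /test_weight/=.
rewrite !sumr_const !cardT/= -!cardT !card_prod !card_ord card_bool.
have hD : D%:R * 2 <= d%:R * d.+1%:R :> R.
  by rewrite -!natrM ler_nat leq_divM.
have l0 : 0 < l.+1%:R * l.+2%:R :> R by rewrite mulr_gt0.
have dd0 : 0 < d%:R * d.+1%:R :> R by rewrite mulr_gt0// ltr0n.
have K0' : 0 < K%:R :> R by rewrite ltr0n.
have -> : gamma_l d delta l.+1 / 2 *+ (D * 2) =
    D%:R * 2 / (d%:R * d.+1%:R) * (delta * (l.+1%:R * l.+2%:R)^-1).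
  by rewrite -mulr_natr natrM /gamma_l; field; rewrite !gt_eqF// ltr0n.
have -> : delta_l K delta l.+1 *+ (K * 2) = 2 * (delta * (l.+1%:R * l.+2%:R)^-1).
  by rewrite -(mulr_natr (delta_l _ _ _)) natrM /delta_l; field; rewrite !gt_eqF// ltr0n.
rewrite -(mulrA 3 delta) -mulrDl ler_wpM2r ?mulr_ge0 ?invr_ge0 ?(ltW l0) ?(ltW dp)//.
have : D%:R * 2 / (d%:R * d.+1%:R) <= 1 :> R by rewrite ler_pdivrMr// mul1r.
by move: (_ / _) => y; lra.
Qed.

Lemma good_event :
  (forall t a, a \in A -> {ae P, forall w, `|dotv a (theta t w)| <= 1}) ->
  exists E : set Om, [/\ measurable E, ((1 - 3 * delta)%:E <= P E)%E &
    forall w, E w ->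
      [/\ (forall t a, a \in A -> `|dotv a (theta t w)| <= 1),
        (forall l j lam, (0 < l <= T.+1)%N -> (j < D)%N -> lam = 2 / 5 \/ lam = -1 ->
           gamma_l d delta l / 2 *
             test_mart theta K delta design A (est_factor nu l j lam) T w < 1) &
        (forall l lam a, (0 < l <= T.+1)%N -> a \in A ->
           lam = lamX l \/ lam = - lamX l ->
           delta_l K delta l *
             test_mart theta K delta design A (play_factor nu l lam a) T w < 1)]].
Proof.
move=> bnd.
have [|E [mE PE hE]] := test_union P theta iid K delta design A test_index
  test_weight test_fun T test_weight_ge0.
  by case=> l [[j b]|[k b]]; [exact: test_est_factor|exact: test_play_factor].
(* Rounds and arm indices form countably many pairs, hence one null set [N] for all of them. *)
have : {ae P, forall w, forall t k, (k < K)%N -> `|dotv (nth 0 A k) (theta t w)| <= 1}.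
  apply: ae_foralln => t; apply: ae_foralln => k.
  have [kK|kK] := boolP (k < K)%N; last by apply: aeW.
  by apply: filterS (bnd t _ (mem_nth 0 kK)) => w.
move=> [N [mN PN hN]].
exists (E `\` N); split; first exact: measurableD.
  rewrite measureD//; last by rewrite (le_lt_trans (probability_le1 _ _))// ltry.
  rewrite (@subset_measure0 _ _ _ P (E `&` N) N)//; last exact: measurableI.
  rewrite sube0; apply: le_trans PE; rewrite lee_fin lerD2l lerN2.
  exact: sum_test_weight.
move=> w [Ew Nw]; split.
- move=> t a aA.
  apply: contrapT => ne; apply/Nw/hN => /(_ t (index a A)).
  by rewrite index_mem nth_index// => /(_ aA).
- move=> l j lam lT jD hlam.
  have /andP[l0 l1] := lT.
  have lo : (l.-1 < T.+1)%N by rewrite prednK.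
  have : gamma_l d delta l.-1.+1 / 2 * test_mart theta K delta design A
      (est_factor nu l.-1.+1 j (if lam == 2 / 5 then 2 / 5 else - 1)) T w < 1.
    exact: (hE w Ew (Ordinal lo, inl (Ordinal jD, lam == 2 / 5))).
  rewrite (prednK l0); have [<-|ne] := eqVneq lam (2 / 5); first exact: id.
  case: hlam => [h|->]; last exact: id.
  by case/eqP: ne.
- move=> l lam a lT aA hlam.
  have /andP[l0 l1] := lT.
  have lo : (l.-1 < T.+1)%N by rewrite prednK.
  have kA : (index a A < K)%N by rewrite index_mem.
  have : delta_l K delta l.-1.+1 * test_mart theta K delta design A
      (play_factor nu l.-1.+1 (if lam == lamX l then lamX l.-1.+1 else - lamX l.-1.+1)
        (nth 0 A (index a A))) T w < 1.
    exact: (hE w Ew (Ordinal lo, inr (Ordinal kA, lam == lamX l))).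
  rewrite (prednK l0) (nth_index 0 aA).
  have [<-|ne] := eqVneq lam (lamX l); first exact: id.
  case: hlam => [h|->]; last exact: id.
  by case/eqP: ne.
Qed.

End GoodEvent.

Lemma M_sigma_bounds {R : realType} {dd : measure_display} {Om : measurableType dd}
    (P : probability Om R) {d : nat} (theta : nat -> Om -> 'rV[R]_d)
    (A : seq 'rV[R]_d) :
  (forall i, P.-integrable setT (fun w => (theta 0%N w ord0 i)%:E)) ->
  (forall i, P.-integrable setT (fun w => ((theta 0%N w ord0 i) ^+ 2)%:E)) ->
  forall a, a \in A -> 0 <= qform (cov_mx P (theta 0%N)) a <= M_sigma A (cov_mx P (theta 0%N)).
Proof.
move=> i1 i2 a aA; rewrite (qform_cov_ge0 P theta i1 i2)/= /M_sigma.
have bm (F : 'rV[R]_d -> R) : F a <= \big[Num.max/0]_(b <- A) F b.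
  elim: (A) aA => // b s IH; rewrite inE big_cons le_max => /orP[/eqP ->|/IH ->].
    by rewrite lexx.
  by rewrite orbT.
rewrite le_min bm/=.
apply: (le_trans (qform_cov_le P theta i1 i2 a)).
rewrite ler_wpM2r ?bm//; apply: sumr_ge0 => i _.
(* A diagonal entry of the covariance is its form at a basis vector, so the trace is nonnegative. *)
have := qform_cov_ge0 P theta i1 i2 (delta_mx 0 i).
by rewrite /qform trmx_delta -rowE -colE !mxE.
Qed.

(** In dimension 0 the support would have to be empty, while a design has total mass 1. *)
Lemma dim_gt0 {R : realType} {d : nat} (A : seq 'rV[R]_d) (p : 'rV[R]_d -> R) :
  is_design A p -> (size (supp A p) <= (d * d.+1) %/ 2)%N -> (0 < d)%N.
Proof.
move=> [p0 p1] sz; rewrite lt0n; apply/eqP => dE.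
have D0 : ((d * d.+1) %/ 2 = 0)%N by rewrite dE.
move: sz; rewrite D0 leqn0 size_eq0 => /eqP sE.
have s0 : \sum_(a <- undup A) p a = 0.
  apply: big1_seq => a /andP[_ aA]; apply/eqP.
  rewrite eq_le p0 ?andbT; last by rewrite -mem_undup.
  rewrite leNgt; apply/negP => pa.
  have : a \in supp A p by rewrite mem_filter pa.
  by rewrite sE.
by move/eqP: p1; rewrite s0 eq_sym oner_eq0.
Qed.

(* Theorem 3.1: with probability >= 1 - 3 delta the regret of VASE is
   O~( d^2 + sqrt(d T log(K/delta) M_sigma) ), the O~ hiding an absolute
   constant C and a polylogarithmic factor log(e+d+K+T+1/delta)^k. *)
Theorem theorem3p1 :
  exists C k : nat,
  forall (R : realType) (dd : measure_display) (Om : measurableType dd)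
    (P : probability Om R) (d : nat) (A : seq 'rV[R]_d) (T : nat)
    (delta : R) (theta : nat -> Om -> 'rV[R]_d)
    (design : seq 'rV[R]_d -> 'rV[R]_d -> R) (astar : 'rV[R]_d),
  let K := size A in
  let thstar := mean_vec P (theta 0%N) in
  let Sigma := cov_mx P (theta 0%N) in
  uniq A -> (0 < K)%N -> 0 < delta < 1 ->
  iid_vectors P theta ->
  (forall i, P.-integrable setT (fun w => (theta 0%N w ord0 i)%:E)) ->
  (forall i, P.-integrable setT (fun w => ((theta 0%N w ord0 i) ^+ 2)%:E)) ->
  (forall t a, a \in A -> {ae P, forall w, `|dotv a (theta t w)| <= 1}) ->
  (forall B : seq 'rV[R]_d, {subset B <= A} -> B != [::] ->
     G_optimal B (design B) /\
     (size (supp B (design B)) <= (d * d.+1) %/ 2)%N) ->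
  astar \in A -> (forall a, a \in A -> dotv a thstar <= dotv astar thstar) ->
  exists E : set Om,
    [/\ measurable E, ((1 - 3 * delta)%:E <= P E)%E &
     forall w, E w ->
       pseudo_regret astar thstar
         (vase_action_at K delta design A (fun t => theta t w)) T
       <= C%:R * (ln (expR 1 + d%:R + K%:R + T%:R + delta^-1)) ^+ k
              * ((d ^ 2)%:R
                 + Num.sqrt (d%:R * T%:R * ln (K%:R / delta)
                             * M_sigma A Sigma))].
Proof.
(* One logarithm bounds the number of phases, at most [3 * Lam], the other the cost of a phase, with
   constant 18000. *)
exists (3 * 18000)%N, 2%N => R dd Om P d A T delta theta design astar K th Sigma.
move=> _ K0 delta01 iid i1 i2 bnd designP astarA opt.
have Ane : A != [::] by rewrite -size_eq0 -lt0n.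
have [[isd _ _] szs] := designP A (fun _ => id) Ane.
have d0 := dim_gt0 A (design A) isd szs.
have [E [mE PE hE]] := good_event P theta iid delta design A T d0 K0 delta01 bnd.
exists E; split => // w Ew; have [bw gE gP] := hE w Ew.
set M := M_sigma A Sigma.
have s2M a : a \in A -> qform Sigma a <= M.
  by move=> aA; have /andP[] := M_sigma_bounds P theta A i1 i2 a aA.
have M0 : 0 <= M.
  by have /andP[h1 h2] := M_sigma_bounds P theta A i1 i2 astar astarA; exact: le_trans h2.
pose run := clip_run theta K delta design A w.
set Lam := ln (_ + delta^-1).
pose B H : R := 18000 * Lam * ((d ^ 2)%:R + Num.sqrt (d%:R * T%:R * H * M)).
have arm1 a (aA : a \in A) := arm_mean P theta iid i1 a (bnd 0%N a aA).
have arm2 a (aA : a \in A) := arm_sq P theta iid i1 i2 a (bnd 0%N a aA).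
have runS t : run t.+1 =
  vase_step K delta design (run t) (clip_reward theta K delta design A w t) by [].
have xb t : `|clip_reward theta K delta design A w t| <= 1 by exact: clip_norm.
(* Which arms are played does not depend on the regret bound, so the invariant is instantiated with
   1/2 for [H], which also covers a single arm. *)
have act t : (t <= T)%N -> vase_action (run t) \in A.
  have half : 1 / 2 <= 1 / 2 :> R by [].
  exact: (run_action _ A delta design th astar (qform Sigma) M (B (1 / 2)) d0 K0
    delta01 arm1 arm2 s2M designP astarA opt run _ T erefl runS xb gE gP
    (fun l n lT nT => phase_bound2 d K T delta M (1 / 2) d0 K0 delta01 M0 half l lT n nT)).
(* The clipped run plays arms of [A], whose rewards on the event lie in [-1, 1]; clipping is then
   the identity and both runs coincide. *)
have runE t : (t <= T)%N ->
    vase_state_at K delta design A (fun t => theta t w) t = run t.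
  elim: t => // t IH tT.
  rewrite runS /clip_reward -/(run t) clip_id; last by apply/bw/act/ltnW.
  by rewrite -(IH (ltnW tT)).
have regE : pseudo_regret astar th
    (vase_action_at K delta design A (fun t => theta t w)) T = regret th astar run T.
  by apply: eq_bigr => t _; rewrite /vase_action_at runE// ltnW.
rewrite regE.
have Lam0 : 0 <= Lam := le_trans ler01 (Lam_ge1 d K T delta delta01).
(* With a single arm [ln (K%:R / delta)] has no positive lower bound, as [delta] may be close to 1;
   but then every play is optimal and the regret is 0. *)
have [K1|K2] := leqP K 1.
  rewrite /regret big1 => [|t _].
    apply: mulr_ge0; last by apply: addr_ge0 (sqrtr_ge0 _); exact: ler0n.
    by apply: mulr_ge0; [exact: ler0n|exact: exprn_ge0].
  have u b c : b \in A -> c \in A -> b = c.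
    by move: K1; rewrite /K; case: (A) => [|b' [|]]//= _; rewrite !inE => /eqP -> /eqP ->.
  by rewrite (u _ _ (act t (ltnW (ltn_ord t))) astarA) subrr dotv0l.
set H := ln (K%:R / delta).
have /andP[dp d1] := delta01.
have H2 : 1 / 2 <= H.
  apply: le_trans ln2_ge _; rewrite ler_ln ?posrE ?divr_gt0 ?ltr0n//.
  rewrite ler_pdivlMr//; apply: (@le_trans _ _ 2); last by rewrite ler_nat.
  by rewrite ler_piMr// ltW.
have [l [l0 lT hreg]] := run_regret _ A delta design th astar (qform Sigma) M (B H) d0
  K0 delta01 arm1 arm2 s2M designP astarA opt run _ T erefl runS xb gE gP
  (fun l lT => phase_bound1 d K T delta M H d0 delta01 l lT)
  (fun l n lT nT => phase_bound2 d K T delta M H d0 K0 delta01 M0 H2 l lT n nT).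
apply: (le_trans hreg).
apply: (@le_trans _ _ (3 * Lam * B H)).
  apply: ler_wpM2r (phase_count d K T delta delta01 l l0 lT).
  by apply: mulr_ge0; [apply: mulr_ge0 Lam0|apply: addr_ge0 (sqrtr_ge0 _)]; exact: ler0n.
by rewrite /B natrM expr2 !mulrA (mulrAC 3 Lam) lexx.
Qed.
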